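(* Let $f\colon X\to Y$ be a stratified map between stratified spaces. (1) The induced morphism $f^*\colon \widetilde N^*(Y;R)\to\widetilde N^*(X;R)$ is a chain map. (2) The map $f^*$ is compatible with the cup product. (3) The maps $f_*\colon\mathfrak C_*(X;R)\to\mathfrak C_*(Y;R)$ and $f^*\colon\widetilde N^*(Y;R)\to\widetilde N^*(X;R)$ satisfy $f_*(f^*\omega\cap\xi)=\omega\cap f_*\xi$ for each $\omega\in\widetilde N^*(Y;R)$ and each $\xi\in\mathfrak C_*(X;R)$. (4) Let $\overline p$ be a perversity on $X$ and $\overline q$ a perversity on $Y$ such that $\overline p\ge f^*\overline q$. Then $f$ induces a chain map $f^*\colon\widetilde N^*_{\overline q}(Y;R)\to\widetilde N^*_{\overline p}(X;R)$, and thus a homomorphism $f^*\colon\mathscr H^*_{\overline q}(Y;R)\to\mathscr H^*_{\overline p}(X;R)$.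
   Context: $R$ is a commutative ring with unity. Filtered spaces. A filtered space is a Hausdorff space $X$ with a filtration by closed subspaces $\emptyset=X_{-1}\subseteq X_0\subseteq\dots\subseteq X_{n-1}\subsetneq X_n=X$; $n=\dim X$ is the formal dimension. Strata are the non-empty connected components of the $X_i\setminus X_{i-1}$; a stratum $S\subset X_i\setminus X_{i-1}$ has $\operatorname{codim}S=n-i$; it is regular if $\operatorname{codim}S=0$, singular otherwise. A stratified space is a filtered space such that, for strata $S,S'$, $S\cap\overline{S'}\neq\emptyset$ implies $S\subset\overline{S'}$. A continuous map $f\colon X\to Y$ between stratified spaces is a stratified map if each stratum $S$ of $X$ is sent into a stratum $S^f$ of $Y$ with $\operatorname{codim}S\ge\operatorname{codim}S^f$. A perversity on $X$ is a map $\overline p$ from the set of strata to $\mathbb Z\cup\{\pm\infty\}$ with value $0$ on regular strata. The pull-back of a perversity $\overline q$ of $Y$ is $(f^*\overline q)(S)=\overline q(S^f)$. Filtered simplices. A filtered singular simplex is a continuous map $\sigma\colon\Delta\to X$ from a euclidean simplex (with ordered vertices) with a join decomposition $\Delta=\Delta_0*\dots*\Delta_n$ (some $\Delta_i$ may be empty), compatible with the vertex order, such that $\sigma^{-1}(X_i)=\Delta_0*\dots*\Delta_i$ for all $i$. It is regular if $\Delta_n\neq\emptyset$. A regular face operator is the inclusion $\delta_\ell\colon\nabla\to\Delta$ of a codimension-one face with $\nabla_i=\nabla\cap\Delta_i$ and $\nabla_n\ne\emptyset$. Blow-up. For an ordered simplicial complex $K$, $N_*(K)$ is its simplicial chain complex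 over $R$, $N^*(K)=\operatorname{Hom}(N_*(K),R)$ with $(\delta f)(v)=-(-1)^{|f|}f(\partial v)$, and $\mathbf 1_F$ is the cochain equal to $1$ on the simplex $F$ and $0$ on the others. For a simplex $E$, $\mathtt cE=E*[\mathtt v]$ is the cone with apex $\mathtt v$ as last vertex ($\mathtt c\emptyset=[\mathtt v]$); its faces are written $(F,0)=F$ ($\emptyset\ne F$ a face of $E$) and $(F,1)=F*[\mathtt v]$ ($F$ a possibly empty face of $E$). Put $|(F,\varepsilon)|=\dim F+\varepsilon$, with $|(\emptyset,1)|=0$. For a regular simplex $\Delta$ put $\widetilde N^*(\Delta)=N^*(\mathtt c\Delta_0)\otimes\dots\otimes N^*(\mathtt c\Delta_{n-1})\otimes N^*(\Delta_n)$ with the tensor product differential and basis $\mathbf 1_{(F,\varepsilon)}=\mathbf 1_{(F_0,\varepsilon_0)}\otimes\dots\otimes\mathbf 1_{(F_{n-1},\varepsilon_{n-1})}\otimes\mathbf 1_{F_n}$ ($\varepsilon_n=0$, $F_n\neq\emptyset$). For $\ell\in\{1,\dots,n\}$, $\|\mathbf 1_{(F,\varepsilon)}\|_\ell=-\infty$ if $\varepsilon_{n-\ell}=1$ and $=\sum_{i>n-\ell}|(F_i,\varepsilon_i)|$ if $\varepsilon_{n-\ell}=0$; for a linear combination with non-zero coefficients take the maximum; $\|0\|_\ell=-\infty$. $\widetilde N^*(X;R)$ is the complex of families $\omega=(\omega_\sigma)_\sigma$ indexed by regular simplices $\sigma\colon\Delta\to X$, $\omega_\sigma\in\widetilde N^*(\Delta)$,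 with $\delta_\ell^*\omega_\sigma=\omega_{\sigma\circ\delta_\ell}$ for every regular face operator; $(\delta\omega)_\sigma=\delta(\omega_\sigma)$. For a singular stratum $S$, $\|\omega\|_S=\sup\{\|\omega_\sigma\|_{\operatorname{codim}S}: \sigma\text{ regular},\ \operatorname{im}\sigma\cap S\neq\emptyset\}$. $\omega$ is $\overline p$-allowable if $\|\omega\|_S\le\overline p(S)$ for all singular $S$. $\widetilde N^*_{\overline p}(X;R)$ is the complex of $\omega$ with $\omega,\delta\omega$ both $\overline p$-allowable; its cohomology is the blown-up intersection cohomology $\mathscr H^*_{\overline p}(X;R)$. Cup product. Ordered simplices $F=[a_0,\dots,a_k]$, $G=[b_0,\dots,b_\ell]$ of a simplex are compatible if $a_k=b_0$, and then $F\cup G=[a_0,\dots,a_k,b_1,\dots,b_\ell]$. On $N^*(\Delta)$: $\mathbf 1_F\cup\mathbf 1_G=(-1)^{k\ell}\mathbf 1_{F\cup G}$ if compatible, $0$ otherwise. On the cone $\mathtt c E$ (same rule): $\mathbf 1_{(F,\varepsilon)}\cup\mathbf 1_{(G,\kappa)}=(-1)^{|F||(G,\kappa)|}\mathbf 1_{(F\cup G,\kappa)}$ if $\varepsilon=0$ and $F,G$ compatible; $=\mathbf 1_{(F,\varepsilon)}$ if $\varepsilon=1$ and $(G,\kappa)=(\emptyset,1)$; $0$ otherwise. On $\widetilde N^*(\Delta)$: $(\omega_0\otimes\dots\otimes\omega_n)\cup(\eta_0\otimes\dots\otimes\eta_n)=(-1)^{\sum_{i>j}|\omega_i||\eta_j|}(\omega_0\cup\eta_0)\otimes\dots\otimes(\omega_n\cup\eta_n)$.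 On $\widetilde N^*(X;R)$: $(\omega\cup\eta)_\sigma=\omega_\sigma\cup\eta_\sigma$. Chains and cap product. $\mathfrak C_*(X;R)$ is the complex freely generated by regular simplices with differential $\mathfrak d\sigma$ = the sum of the terms of $\partial\sigma$ which are regular simplices. For a simplex $\Delta$, $\mathbf 1_F\cap[\Delta]=G$ if $G$ is the face with $F\cup G=\Delta$, and $0$ if there is none. For the cone, $\mathbf 1_{(F,j)}\cap[\mathtt c\Delta]=(G,1)$ where $F\cup G=\Delta$ if $j=0$ (and $0$ if no such $G$), $=(\emptyset,1)$ if $(F,j)=(\Delta,1)$, and $0$ otherwise. For a regular simplex $\Delta$ of dimension $d$, $\mathbf 1_{(F,\varepsilon)}\,\widetilde\cap\,\widetilde\Delta=(-1)^{\nu}(\mathbf 1_{(F_0,\varepsilon_0)}\cap[\mathtt c\Delta_0])\otimes\dots\otimes(\mathbf 1_{(F_{n-1},\varepsilon_{n-1})}\cap[\mathtt c\Delta_{n-1}])\otimes(\mathbf 1_{F_n}\cap[\Delta_n])$ with $\nu=\sum_{j=0}^{n-1}(\dim\Delta_j+1)\sum_{i>j}|(F_i,\varepsilon_i)|$ (here $\dim\emptyset=-1$). Let $\mu_*\big(\bigotimes_{k<n}(F_k,\varepsilon_k)\otimes F_n\big)=F_0*\dots*F_\ell$ if $\sum_{i}|(F_i,\varepsilon_i)|=\dim(F_0*\dots*F_\ell)$ and $0$ otherwise, where $\ell$ is the smallest $j$ with $\varepsilon_j=0$ ($\varepsilon_n=0$). Put $c\cap\widetilde\Delta=\mu_*(c\,\widetilde\cap\,\widetilde\Delta)\in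 N_{d-*}(\Delta)$, and $\omega\cap\sigma=\sigma_*(\omega_\sigma\cap\widetilde\Delta)$ for $\omega\in\widetilde N^*(X;R)$ and $\sigma\colon\Delta\to X$ regular, extended linearly: this is the cap product $\widetilde N^*(X;R)\otimes\mathfrak C_m(X;R)\to\mathfrak C_{m-*}(X;R)$. Induced maps. For $f\colon X\to Y$ stratified, $f_*\colon\mathfrak C_*(X;R)\to\mathfrak C_*(Y;R)$ is $\sigma\mapsto f\circ\sigma$. For the definition of $f^*$: for a join of two (possibly empty) simplices $E_0*E_1$ let $\Xi\colon N^*(\mathtt c(E_0*E_1))\to N^*(\mathtt cE_0)\otimes N^*(\mathtt cE_1)$ be given, for $F_0,F_1$ faces of $E_0,E_1$, by $\Xi(\mathbf 1_{(F_0*F_1,\varepsilon)})=(-1)^{|(F_0,1)||(F_1,\varepsilon)|}\mathbf 1_{(F_0,1)}\otimes\mathbf 1_{(F_1,\varepsilon)}$ if $(F_1,\varepsilon)\ne(\emptyset,0)$, and $\Xi(\mathbf 1_{(F_0,0)})=\mathbf 1_{(F_0,0)}\otimes\big(\mathbf 1_{(\emptyset,1)}+\sum_{e}\mathbf 1_{(e,0)}\big)$, the sum running over vertices $e$ of $E_1$. Let $\Xi\colon N^*(E_0*E_1)\to N^*(\mathtt cE_0)\otimes N^*(E_1)$ be the analogous map: $\mathbf 1_{F_0*F_1}\mapsto(-1)^{|(F_0,1)||F_1|}\mathbf 1_{(F_0,1)}\otimes\mathbf 1_{F_1}$ if $F_1\ne\emptyset$, and $\mathbf 1_{F_0}\mapsto\mathbf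 1_{(F_0,0)}\otimes\sum_e\mathbf 1_e$. For a longer join $E_0*\dots*E_r$, $\Xi$ is iterated by first splitting $(E_0*\dots*E_{r-1})*E_r$ and then splitting the first factor, and so on. If $\sigma\colon\Delta\to X$ is regular, so is $f\circ\sigma$; let $\Delta_\sigma=\Delta_0*\dots*\Delta_n$ and $\Delta_{f\circ\sigma}=\Delta'_0*\dots*\Delta'_m$ ($m=\dim Y$) be the two decompositions of $\Delta$. Let $i_0<\dots<i_a=m$ be the indices with $\Delta'_i\neq\emptyset$; there are $-1=j_{-1}<j_0<\dots<j_a=n$ with $\Delta_{j_{b-1}+1}*\dots*\Delta_{j_b}=\Delta'_{i_b}$ for $b=0,\dots,a$. Identifying each factor $N^*(\mathtt c\emptyset)=R\,\mathbf 1_{(\emptyset,1)}$ (for $\Delta'_i=\emptyset$) with $R$, and applying the iterated $\Xi$ to the factor corresponding to each $\Delta'_{i_b}$, one gets $\mathcal A_\sigma^*\colon\widetilde N^*(\Delta_{f\circ\sigma})\to\widetilde N^*(\Delta_\sigma)$. The induced map is $(f^*\omega)_\sigma=\mathcal A_\sigma^*(\omega_{f\circ\sigma})$. *)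

(* Defs.v *)
From HB Require Import structures.
From mathcomp Require Import all_boot all_order all_algebra.
From mathcomp Require Import all_classical all_reals all_analysis.
From mathcomp Require Import zify.

Set Implicit Arguments.
Unset Strict Implicit.
Unset Printing Implicit Defensive.

Import Order.TTheory GRing.Theory Num.Theory.
Import numFieldNormedType.Exports.

Local Open Scope classical_set_scope.
Local Open Scope ring_scope.

Section DependentProduct.
Variables (R : pzRingType) (I : Type) (V : I -> lmodType R).

Definition dprod : Type := forall i, V i.

HB.instance Definition _ := gen_eqMixin dprod.
HB.instance Definition _ := gen_choiceMixin dprod.

Let dadd (u v : dprod) : dprod := fun i => u i + v i.
Let dopp (u : dprod) : dprod := fun i => - u i.
Let dscale (a : R) (u : dprod) : dprod := fun i => a *: u i.

Fact dprod_addA : associative dadd.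
Proof. by move=> u v w; apply: functional_extensionality_dep => i; exact: addrA. Qed.
Fact dprod_addC : commutative dadd.
Proof. by move=> u v; apply: functional_extensionality_dep => i; exact: addrC. Qed.
Fact dprod_add0 : left_id (fun i => 0) dadd.
Proof. by move=> u; apply: functional_extensionality_dep => i; exact: add0r. Qed.
Fact dprod_addN : left_inverse (fun i => 0) dopp dadd.
Proof. by move=> u; apply: functional_extensionality_dep => i; exact: addNr. Qed.

HB.instance Definition _ :=
  GRing.isZmodule.Build dprod dprod_addA dprod_addC dprod_add0 dprod_addN.

Fact dprod_scaleA a b (u : dprod) : dscale a (dscale b u) = dscale (a * b) u.
Proof. by apply: functional_extensionality_dep => i; exact: scalerA. Qed.
Fact dprod_scale1 : left_id 1 dscale.
Proof. by move=> u; apply: functional_extensionality_dep => i; exact: scale1r. Qed.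
Fact dprod_scaleDr : right_distributive dscale +%R.
Proof. by move=> a u v; apply: functional_extensionality_dep => i; exact: scalerDr. Qed.
Fact dprod_scaleDl (u : dprod) : {morph dscale^~ u : a b / a + b}.
Proof. by move=> a b; apply: functional_extensionality_dep => i; exact: scalerDl. Qed.

HB.instance Definition _ := GRing.Zmodule_isLmodule.Build R dprod
  dprod_scaleA dprod_scale1 dprod_scaleDr dprod_scaleDl.

Lemma dprodE (a : R) (u v : dprod) i : (a *: u + v) i = a *: u i + v i.
Proof. by []. Qed.

End DependentProduct.

Section Submodules.
Variables (R : pzRingType) (V : lmodType R).

Record submodule := Submodule {
  submodule_set :> V -> Prop;
  submodule_0 : submodule_set 0;
  submodule_linear : forall a u v,
    submodule_set u -> submodule_set v -> submodule_set (a *: u + v)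
}.

Definition submodule_pred (S : submodule) : {pred V} := fun u => `[< S u >].

Fact submodule_pred_closed S : submod_closed (submodule_pred S).
Proof.
split; first exact/asboolP/submodule_0.
move=> a u v /asboolP Su /asboolP Sv; apply/asboolP; exact: submodule_linear.
Qed.

HB.instance Definition _ S :=
  GRing.isSubmodClosed.Build R V (submodule_pred S) (@submodule_pred_closed S).

Definition elements (S : submodule) : Type := {u : V | submodule_pred S u}.

HB.instance Definition _ S := SubChoice.on (elements S).
HB.instance Definition _ S :=
  [SubChoice_isSubLmodule of elements S by <:].

End Submodules.

Section QuotientModule.
Local Open Scope quotient_scope.
Variables (R : pzRingType) (V : lmodType R) (B : submodule V).

Definition quotient_module : Type := {ideal_quot submodule_pred B}.
HB.instance Definition _ := GRing.Zmodule.on quotient_module.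

Definition class_of (u : V) : quotient_module := \pi_({ideal_quot submodule_pred B}) u.

Let qscale (a : R) (x : quotient_module) : quotient_module :=
  class_of (a *: repr (x : {ideal_quot submodule_pred B})).

Lemma class_ofD u v : class_of (u + v) = class_of u + class_of v.
Proof. exact: (raddfD (\pi_({ideal_quot submodule_pred B}))). Qed.

Lemma class_ofP u v : class_of u = class_of v <-> B (u - v).
Proof.
split=> [|Buv]; first by move/eqP; rewrite piE => /asboolP.
by apply/eqP; rewrite piE; apply/asboolP.
Qed.

Lemma class_of_repr (x : quotient_module) :
  class_of (repr (x : {ideal_quot submodule_pred B})) = x.
Proof. exact: reprK. Qed.

Let qscaleE a u : qscale a (class_of u) = class_of (a *: u).
Proof.
apply/class_ofP; rewrite -scalerBr.
have /class_ofP Bu := class_of_repr (class_of u).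
by rewrite -[_ *: _]addr0; apply: submodule_linear => //; exact: submodule_0.
Qed.

Fact quotient_scaleA a b x : qscale a (qscale b x) = qscale (a * b) x.
Proof. by rewrite -(class_of_repr x) !qscaleE scalerA. Qed.
Fact quotient_scale1 : left_id 1 qscale.
Proof. by move=> x; rewrite -(class_of_repr x) qscaleE scale1r. Qed.
Fact quotient_scaleDr : right_distributive qscale +%R.
Proof.
move=> a x y; rewrite -(class_of_repr x) -(class_of_repr y).
by rewrite -class_ofD !qscaleE scalerDr class_ofD.
Qed.
Fact quotient_scaleDl x : {morph qscale^~ x : a b / a + b}.
Proof.
by move=> a b; rewrite -(class_of_repr x) !qscaleE scalerDl class_ofD.
Qed.

HB.instance Definition _ := GRing.Zmodule_isLmodule.Build R quotient_module
  quotient_scaleA quotient_scale1 quotient_scaleDr quotient_scaleDl.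

End QuotientModule.

Section ChainMaps.
Variables (R : pzRingType).

(* g is a chain map from the complex (C, dV) to (D, dW), where C k and D k are
   the submodules of elements of degree k *)
Definition chain_map (V W : lmodType R) (dV : V -> V) (C : nat -> submodule V)
    (dW : W -> W) (D : nat -> submodule W) (g : V -> W) : Prop :=
  [/\ linear g,
      forall k x, C k x -> D k (g x)
    & forall k x, C k x -> g (dV x) = dW (g x)].

Section Cohomology.
Variables (V : lmodType R) (d : {linear V -> V}) (C : nat -> submodule V).

Definition cocycle_set k (x : V) : Prop := C k x /\ d x = 0.

Fact cocycle_set0 k : cocycle_set k 0.
Proof. by split; [exact: submodule_0 | exact: linear0]. Qed.
Fact cocycle_set_linear k a x y :
  cocycle_set k x -> cocycle_set k y -> cocycle_set k (a *: x + y).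
Proof.
move=> [Cx dx] [Cy dy]; split; first exact: submodule_linear.
by rewrite linearP dx dy scaler0 addr0.
Qed.
Definition cocycles k := Submodule (cocycle_set0 k) (@cocycle_set_linear k).

Definition coboundary_set k (z : elements (cocycles k)) : Prop :=
  if k is k'.+1 then exists2 y, C k' y & d y = val z else val z = 0.

Fact coboundary_set0 k : coboundary_set (0 : elements (cocycles k)).
Proof.
by case: k => [|k] //=; exists 0; [exact: submodule_0 | exact: linear0].
Qed.
Fact coboundary_set_linear k a (x y : elements (cocycles k)) :
  coboundary_set x -> coboundary_set y -> coboundary_set (a *: x + y).
Proof.
case: k x y => [|k] x y /=; first by move=> -> ->; rewrite scaler0 addr0.
move=> [x' Cx' <-] [y' Cy' <-]; exists (a *: x' + y').
  exact: submodule_linear.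
by rewrite linearP.
Qed.
Definition coboundaries k :=
  Submodule (coboundary_set0 k) (@coboundary_set_linear k).

Definition cohomology k : lmodType R := quotient_module (coboundaries k).

Definition cohomology_class k (z : elements (cocycles k)) : cohomology k :=
  class_of (coboundaries k) z.

End Cohomology.

(* phi is the map induced by g in cohomology: phi [z] = [g z] *)
Definition induced_in_cohomology (V W : lmodType R)
    (dV : {linear V -> V}) (C : nat -> submodule V)
    (dW : {linear W -> W}) (D : nat -> submodule W) (g : V -> W) k
    (phi : cohomology dV C k -> cohomology dW D k) : Prop :=
  forall z : elements (cocycles dV C k),
    exists2 z' : elements (cocycles dW D k),
      val z' = g (val z) & phi (cohomology_class z) = cohomology_class z'.

End ChainMaps.

Section FilteredSpaces.

(* [below F i] is F_(i-1), with the convention F_(-1) = set0 *)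
Definition below (T : Type) (F : nat -> set T) (i : nat) : set T :=
  if i is i'.+1 then F i' else set0.

(* Only the values X_0, ..., X_n of the filtration carry information: the
   conditions force X_i = X for i >= n. *)
Record filteredSpace := FilteredSpace {
  fspace :> topologicalType;
  fspace_dim : nat;
  filtration : nat -> set fspace;
  fspace_hausdorff : hausdorff_space fspace;
  filtration_closed : forall i, closed (filtration i);
  filtration_mono : forall i, filtration i `<=` filtration i.+1;
  filtration_top : filtration fspace_dim = setT;
  filtration_proper : below filtration fspace_dim `<` filtration fspace_dim
}.

Definition slice (X : filteredSpace) (i : nat) : set X :=
  @filtration X i `\` below (@filtration X) i.

Record stratum (X : filteredSpace) := Stratum {
  stratum_index : 'I_(fspace_dim X).+1;
  stratum_set : set X;
  stratumP : exists2 x, slice stratum_index x &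
    stratum_set = connected_component (slice stratum_index) x
}.

Definition codim (X : filteredSpace) (S : stratum X) : nat :=
  (fspace_dim X - stratum_index S)%N.

Record stratifiedSpace := StratifiedSpace {
  sspace :> filteredSpace;
  frontier_condition : forall S S' : stratum sspace,
    (stratum_set S `&` closure (stratum_set S')) !=set0 ->
    stratum_set S `<=` closure (stratum_set S')
}.

(* The stratum S^f containing f(S) is unique; it is kept as data. *)
Record stratifiedMap (X Y : filteredSpace) := StratifiedMap {
  smap :> X -> Y;
  smap_continuous : continuous smap;
  smap_stratum : stratum X -> stratum Y;
  smap_image : forall S, smap @` stratum_set S `<=` stratum_set (smap_stratum S);
  smap_codim : forall S, (codim (smap_stratum S) <= codim S)%N
}.

Record perversity (X : filteredSpace) := Perversity {
  perv :> stratum X -> \bar int;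
  perv_regular : forall S, codim S = 0%N -> perv S = 0%E
}.

Definition perversity_pullback (X Y : filteredSpace) (f : stratifiedMap X Y)
    (q : perversity Y) (S : stratum X) : \bar int :=
  q (smap_stratum f S).

Lemma perversity_pullback_regular (X Y : filteredSpace)
    (f : stratifiedMap X Y) (q : perversity Y) (S : stratum X) :
  codim S = 0%N -> perversity_pullback f q S = 0%E.
Proof.
by move=> S0; apply: perv_regular; apply/eqP; rewrite -leqn0 -S0 smap_codim.
Qed.

End FilteredSpaces.

(* rr is the field of real numbers in which the euclidean simplices live. *)
Section FilteredSimplices.
Variable rr : realType.

Definition std_simplex (N : nat) : set 'rV[rr]_N :=
  [set t | (forall v, 0 <= t ord0 v) /\ \sum_v t ord0 v = 1].
Arguments std_simplex N : clear implicits.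

Definition weight N (t : std_simplex N) (v : 'I_N) : rr := set_val t ord0 v.

(* The join decomposition D_0 * ... * D_n is given by the map [level] sending a
   vertex v to the i such that v is in D_i. The point t lies in D_0 * ... * D_i
   iff the vertices carrying t have level at most i. *)
Record filteredSimplex (X : filteredSpace) := FilteredSimplex {
  nvert : nat;
  nvert_gt0 : (0 < nvert)%N;
  simplex_map :> std_simplex nvert -> X;
  level : {ffun 'I_nvert -> 'I_(fspace_dim X).+1};
  simplex_continuous : continuous simplex_map;
  level_mono : {homo level : u v / (u <= v)%N};
  simplex_filtered : forall i t, @filtration X i (simplex_map t) <->
    (forall v, weight t v != 0 -> (level v <= i)%N)
}.

Record regularSimplex (X : filteredSpace) := RegularSimplex {
  regular_val :> filteredSimplex X;
  regular_level : [exists v, level regular_val v == ord_max]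
}.

HB.instance Definition _ (X : filteredSpace) := gen_eqMixin (regularSimplex X).
HB.instance Definition _ (X : filteredSpace) := gen_choiceMixin (regularSimplex X).

End FilteredSimplices.

Arguments std_simplex rr N : clear implicits.

Section Points.
Variable rr : realType.

Lemma continuous_row (T : topologicalType) N (g : T -> 'rV[rr]_N) :
  (forall v, continuous (fun t => g t ord0 v)) -> continuous g.
Proof.
move=> cg t A [P PM sPA].
have nP : \forall x \near t, forall v, P ord0 v (g x ord0 v).
  by apply: filter_forall => v; exact: cg (PM ord0 v).
by apply: filterS nP => x Px; apply: sPA => i v; rewrite (ord1 i).
Qed.

Lemma weight_continuous N (v : 'I_N) :
  continuous (fun t : std_simplex rr N => weight t v).
Proof.
move=> t; apply: (@continuous_comp _ _ _ (set_val : std_simplex rr N -> 'rV[rr]_N)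
  (fun M : 'rV[rr]_N => M ord0 v)).
- exact: initial_continuous.
- exact: coord_continuous.
Qed.

Lemma weight_ge0 N (t : std_simplex rr N) v : 0 <= weight t v.
Proof. by have [+ _] := set_valP t; exact. Qed.

Lemma weight_sum N (t : std_simplex rr N) : \sum_v weight t v = 1.
Proof. by have [_] := set_valP t. Qed.

Definition simplex_point N (w : 'I_N -> rr)
    (w0 : forall v, 0 <= w v) (w1 : \sum_v w v = 1) : std_simplex rr N.
Proof.
exists (\row_v w v); apply/mem_set; split=> [v|]; first by rewrite mxE.
by under eq_bigr do rewrite mxE.
Defined.

Lemma weight_point N w w0 w1 v : weight (@simplex_point N w w0 w1) v = w v.
Proof. by rewrite /weight /= mxE. Qed.

Lemma continuous_simplex (T : topologicalType) N (g : T -> std_simplex rr N) :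
  (forall v, continuous (fun t => weight (g t) v)) -> continuous g.
Proof. by move=> cg; apply: continuous_comp_initial; exact: continuous_row. Qed.

Lemma simplex_eq N (t u : std_simplex rr N) : weight t =1 weight u -> t = u.
Proof.
by move=> e; apply: val_inj; apply/rowP => v; exact: e.
Qed.

Definition vertex_weight N (v u : 'I_N) : rr := (u == v)%:R.
Fact vertex_weight_ge0 N (v u : 'I_N) : 0 <= vertex_weight v u.
Proof. exact: ler0n. Qed.
Fact vertex_weight_sum N (v : 'I_N) : \sum_u vertex_weight v u = 1.
Proof.
rewrite (bigD1 v) //= /vertex_weight eqxx big1 ?addr0 // => u.
by move=> /negbTE ->.
Qed.
Definition vertex N (v : 'I_N) : std_simplex rr N :=
  simplex_point (vertex_weight_ge0 v) (vertex_weight_sum v).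

Lemma weight_vertex N (v u : 'I_N) : weight (vertex v) u = (u == v)%:R.
Proof. by rewrite weight_point. Qed.

(* the segment from t to u, extended by constants outside of [0, 1] *)
Definition clamp (s : rr) : rr := Num.max 0 (Num.min 1 s).

Lemma clamp_ge0 s : 0 <= clamp s.
Proof. by rewrite /clamp le_max lexx. Qed.
Lemma clamp_le1 s : clamp s <= 1.
Proof. by rewrite /clamp ge_max ler01 ge_min lexx. Qed.
Lemma clamp_id s : 0 <= s -> s <= 1 -> clamp s = s.
Proof. by move=> s0 s1; rewrite /clamp min_r // max_r. Qed.
Lemma clamp_continuous : continuous clamp.
Proof.
move=> s; apply: (@continuous_max rr rr (fun=> 0) (fun s => Num.min 1 s)).
  exact: cvg_cst.
apply: (@continuous_min rr rr (fun=> 1) id); first exact: cvg_cst.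
exact: cvg_id.
Qed.

Section Segment.
Variables (N : nat) (t u : std_simplex rr N).

Definition segment_weight s v :=
  (1 - clamp s) * weight t v + clamp s * weight u v.
Fact segment_weight_ge0 s v : 0 <= segment_weight s v.
Proof.
by apply: addr_ge0; apply: mulr_ge0; rewrite ?weight_ge0 ?clamp_ge0 //
  subr_ge0 clamp_le1.
Qed.
Fact segment_weight_sum s : \sum_v segment_weight s v = 1.
Proof.
by rewrite big_split /= -!mulr_sumr !weight_sum !mulr1 subrK.
Qed.
Definition segment s : std_simplex rr N :=
  simplex_point (segment_weight_ge0 s) (segment_weight_sum s).

Lemma segment0 : segment 0 = t.
Proof.
apply: simplex_eq => v; rewrite weight_point /segment_weight clamp_id //.
by rewrite subr0 mul1r mul0r addr0.
Qed.
Lemma segment1 : segment 1 = u.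
Proof.
apply: simplex_eq => v; rewrite weight_point /segment_weight clamp_id //.
by rewrite subrr mul1r mul0r add0r.
Qed.
Lemma segment_continuous : continuous segment.
Proof.
apply: continuous_simplex => v s.
have -> : (fun s => weight (segment s) v) = fun s => segment_weight s v.
  by apply/funext => x; rewrite weight_point.
apply: cvgD; apply: cvgMl => //; last exact: clamp_continuous.
by apply: cvgB; [exact: cvg_cst | exact: clamp_continuous].
Qed.

Lemma segment_support s v : weight (segment s) v != 0 ->
  weight t v != 0 \/ weight u v != 0.
Proof.
rewrite weight_point /segment_weight => nz.
have [t0|] := eqVneq (weight t v) 0; last by left.
have [u0|] := eqVneq (weight u v) 0; last by right.
by move: nz; rewrite t0 u0 !mulr0 addr0 eqxx.
Qed.

Lemma segment_supportr s v : 0 < s -> weight u v != 0 ->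
  weight (segment s) v != 0.
Proof.
move=> s0 nz; rewrite weight_point gt_eqF // ltr_wpDl //.
  by rewrite mulr_ge0 ?weight_ge0 // subr_ge0 clamp_le1.
rewrite mulr_gt0 //; first by rewrite /clamp lt_max lt_min ltr01 s0 orbT.
by rewrite lt_def nz weight_ge0.
Qed.
Lemma segment_supportl s v : s < 1 -> weight t v != 0 ->
  weight (segment s) v != 0.
Proof.
move=> s1 nz; rewrite weight_point gt_eqF // ltr_pwDl //; last first.
  by rewrite mulr_ge0 ?weight_ge0 // clamp_ge0.
rewrite mulr_gt0 //.
  by rewrite subr_gt0 /clamp gt_max ltr01 gt_min s1 orbT.
by rewrite lt_def nz weight_ge0.
Qed.

End Segment.
End Points.

Section Strata.
Variable X : filteredSpace.

Lemma filtration_le i j : (i <= j)%N -> @filtration X i `<=` @filtration X j.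
Proof.
move=> /subnK <-; elim: (j - i)%N => [|k IH] //.
by apply: subset_trans IH _; exact: filtration_mono.
Qed.

Lemma sliceP i x : slice i x <-> (forall j, @filtration X j x <-> (i <= j)%N).
Proof.
split=> [[Fi nF] j|h].
  split=> [Fj|/filtration_le]; last exact.
  rewrite leqNgt; apply/negP => ji; apply: nF.
  by case: i ji Fi => // i ji _; exact: filtration_le Fj.
split; first exact/h.
by case: i h => [|i] h //= /h; rewrite ltnn.
Qed.

Lemma slice_inj i j x : @slice X i x -> slice j x -> i = j.
Proof.
move=> /sliceP hi /sliceP hj; apply/eqP; rewrite eqn_leq.
by apply/andP; split; [apply/hi/hj | apply/hj/hi].
Qed.

Lemma stratum_sub (S : stratum X) : stratum_set S `<=` slice (stratum_index S).
Proof.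
by have [x _ ->] := stratumP S; exact: connected_component_sub.
Qed.

Fact point_index_ex (x : X) : exists i, `[< filtration i x >].
Proof. by exists (fspace_dim X); apply/asboolP; rewrite filtration_top. Qed.
Fact point_index_lt x : (ex_minn (point_index_ex x) < (fspace_dim X).+1)%N.
Proof.
case: ex_minnP => i _; apply; apply/asboolP; by rewrite filtration_top.
Qed.
Definition point_index x : 'I_(fspace_dim X).+1 := Ordinal (point_index_lt x).

Lemma slice_point_index x : slice (point_index x) x.
Proof.
apply/sliceP => j /=; case: ex_minnP => i /asboolP Fi mi.
by split=> [Fj|/filtration_le]; [apply: mi; exact/asboolP | exact].
Qed.

Fact point_stratumP x : exists2 y, @slice X (point_index x) y &
  connected_component (slice (point_index x)) x =
  connected_component (slice (point_index x)) y.
Proof. by exists x => //; exact: slice_point_index. Qed.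
(* the stratum through x *)
Definition point_stratum x : stratum X := Stratum (point_stratumP x).

Lemma point_stratum_refl x : stratum_set (point_stratum x) x.
Proof. exact/connected_component_refl/slice_point_index. Qed.

End Strata.

Section InducedSimplices.
Variable rr : realType.

Section Faces.
Variables (X : filteredSpace) (s : filteredSimplex rr X) (F : {set 'I_(nvert s)}).

Definition face_weight (t : std_simplex rr #|F|) (v : 'I_(nvert s)) : rr :=
  \sum_(i | enum_val i == v) weight t i.
Fact face_weight_ge0 t v : 0 <= face_weight t v.
Proof. by apply: sumr_ge0 => i _; exact: weight_ge0. Qed.
Fact face_weight_sum t : \sum_v face_weight t v = 1.
Proof.
rewrite -(weight_sum t) (partition_big (fun i => enum_val i) predT) //=.
Qed.
(* the affine inclusion of the face F, sending the i-th vertex of the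
   standard simplex to the i-th vertex of F *)
Definition face_incl t : std_simplex rr (nvert s) :=
  simplex_point (face_weight_ge0 t) (face_weight_sum t).

Lemma face_incl_continuous : continuous face_incl.
Proof.
apply: continuous_simplex => v t.
have -> : (fun t => weight (face_incl t) v) = fun t => face_weight t v.
  by apply/funext => x; rewrite weight_point.
have h := @cvg_big rr 'I_#|F| +%R 0 (fun i => enum_val i == v)
  (@add_continuous rr) _ (nbhs t) (index_enum _)
  (fun i (t : std_simplex rr #|F|) => weight t i) (fun i => weight t i).
by apply: h => i _; exact: weight_continuous.
Qed.

Lemma face_weight_val t (i : 'I_#|F|) : face_weight t (enum_val i) = weight t i.
Proof.
rewrite /face_weight (eq_bigl (pred1 i)) ?big_pred1_eq // => j /=.
exact: (inj_eq enum_val_inj).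
Qed.

Lemma face_weight_neq0 t v : face_weight t v != 0 ->
  exists2 i : 'I_#|F|, enum_val i = v & weight t i != 0.
Proof.
move=> nz; have [i /andP[/eqP ei wi]|no] :=
  pickP (fun i : 'I_#|F| => (enum_val i == v) && (weight t i != 0)).
  by exists i.
case/eqP: nz; apply: big1 => i ei.
by apply/eqP; move: (no i); rewrite ei /= => /negbFE.
Qed.

Lemma enum_val_mono (i j : 'I_#|F|) : (i <= j)%N -> (enum_val i <= enum_val j)%N.
Proof.
move=> ij; have srt : sorted leq (map val (enum F)).
  apply: (subseq_sorted leq_trans _ (iota_sorted 0 (nvert s))).
  by rewrite -val_enum_ord map_subseq // enumT /enum_mem filter_subseq.
have x0 : 'I_(nvert s) by exact: enum_val i.
have nE (k : 'I_#|F|) : val (enum_val k) = nth 0%N (map val (enum F)) k.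
  by rewrite (nth_map x0) -?cardE // (enum_val_nth x0).
rewrite !nE; apply: (sorted_leq_nth leq_trans leqnn) => //;
  by rewrite inE size_map -cardE.
Qed.

End Faces.

Section RegularFaces.
Variables (X : filteredSpace) (s : regularSimplex rr X).

Definition is_regular_face (F : {set 'I_(nvert s)}) : bool :=
  [exists v in F, level s v == ord_max].

Definition regular_face : Type := {F : {set 'I_(nvert s)} | is_regular_face F}.
HB.instance Definition _ := Finite.on regular_face.

Variable F : regular_face.

Definition face_map (t : std_simplex rr #|val F|) : X := s (face_incl t).
Definition face_level : {ffun 'I_#|val F| -> 'I_(fspace_dim X).+1} :=
  [ffun i => level s (enum_val i)].

Fact face_gt0 : (0 < #|val F|)%N.
Proof.
have /existsP [v /andP[vF _]] := valP F.
by rewrite card_gt0; apply/set0Pn; exists v.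
Qed.
Fact face_continuous : continuous face_map.
Proof.
by move=> t; apply: continuous_comp;
  [exact: face_incl_continuous | exact: simplex_continuous].
Qed.
Fact face_mono : {homo face_level : u v / (u <= v)%N}.
Proof. by move=> i j ij; rewrite !ffunE; exact/level_mono/enum_val_mono. Qed.
Fact face_filtered i t : @filtration X i (face_map t) <->
  (forall v, weight t v != 0 -> (face_level v <= i)%N).
Proof.
rewrite simplex_filtered; split=> h v.
  by move=> wv; rewrite ffunE; apply: h; rewrite weight_point face_weight_val.
rewrite weight_point => /face_weight_neq0 [j <- wj].
by have := h j wj; rewrite ffunE.
Qed.
Fact face_regular : [exists v, face_level v == ord_max].
Proof.
have /existsP [v /andP[vF lv]] := valP F.
by apply/existsP; exists (enum_rank_in vF v); rewrite ffunE enum_rankK_in.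
Qed.

Definition face : regularSimplex rr X :=
  @RegularSimplex rr X (FilteredSimplex face_gt0 face_continuous face_mono
    face_filtered) face_regular.

End RegularFaces.

Section Composition.
Variables (X Y : filteredSpace) (f : stratifiedMap X Y) (s : regularSimplex rr X).

Definition comp_map (t : std_simplex rr (nvert s)) : Y := f (s t).
(* the level of v is the index of the stratum S^f, for S the stratum of X
   through the image of v *)
Definition comp_level : {ffun 'I_(nvert s) -> 'I_(fspace_dim Y).+1} :=
  [ffun v => stratum_index
     (smap_stratum f (point_stratum (s (vertex rr v))))].

Lemma simplex_slice t v0 : weight t v0 != 0 ->
    (forall v, weight t v != 0 -> (level s v <= level s v0)%N) ->
  slice (level s v0) (s t).
Proof.
move=> w0 wm; apply/sliceP => j; rewrite simplex_filtered; split=> [|lj v wv].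
  exact.
exact: leq_trans (wm v wv) lj.
Qed.

Lemma vertex_slice v : slice (level s v) (s (vertex rr v)).
Proof.
apply: simplex_slice; first by rewrite weight_vertex eqxx oner_neq0.
by move=> u; rewrite weight_vertex; have [->|] := eqVneq u v; rewrite ?eqxx.
Qed.

Lemma comp_slice t v0 : weight t v0 != 0 ->
    (forall v, weight t v != 0 -> (level s v <= level s v0)%N) ->
  slice (comp_level v0) (comp_map t).
Proof.
move=> w0 wm; rewrite ffunE; set S := point_stratum _.
apply: stratum_sub; apply: smap_image; exists (s t) => //.
have Si : val (point_index (s (vertex rr v0))) = level s v0 :> nat.
  exact: slice_inj (slice_point_index _) (vertex_slice v0).
rewrite /S /= in Si *; rewrite Si.
pose g x := s (segment t (vertex rr v0) x).
have cg : continuous g.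
  by move=> x; apply: continuous_comp;
    [exact: segment_continuous | exact: simplex_continuous].
have g01 : forall x, (0 <= x <= 1)%R -> slice (level s v0) (g x).
  move=> x /andP[x0 x1]; apply: simplex_slice.
    have [lx1|] := ltP x 1; first exact: segment_supportl.
    move=> gx1; apply: segment_supportr.
      by apply: lt_le_trans gx1; exact: ltr01.
    by rewrite weight_vertex eqxx oner_neq0.
  move=> v /segment_support [|]; first exact: wm.
  by rewrite weight_vertex; have [->|] := eqVneq v v0; rewrite ?eqxx.
have := @connected_component_max X (slice (level s v0)) (g @` `[0%R, 1%R])
  (s (vertex rr v0)).
apply.
- exists 1; last by rewrite /g segment1.
  by rewrite /= in_itv /= lexx ler01.
- by move=> _ [x + <-]; rewrite /= in_itv /= => /g01.
- apply: connected_continuous_connected; first exact: segment_connected.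
  exact: continuous_subspaceT.
- exists 0; last by rewrite /g segment0.
  by rewrite /= in_itv /= lexx ler01.
Qed.

Fact comp_continuous : continuous comp_map.
Proof.
by move=> t; apply: continuous_comp;
  [exact: simplex_continuous | exact: smap_continuous].
Qed.

Lemma comp_level_le u v : (level s u <= level s v)%N ->
  (comp_level u <= comp_level v)%N.
Proof.
move=> uv; pose g x := comp_map (segment (vertex rr u) (vertex rr v) x).
have cg : continuous g.
  by move=> x; apply: (@continuous_comp _ _ _ (segment _ _) comp_map);
    [exact: segment_continuous | exact: comp_continuous].
have gpos x : 0 < x -> @filtration Y (comp_level v) (g x).
  move=> x0; have : slice (comp_level v) (g x); last by case.
  apply: comp_slice.
    by apply: segment_supportr => //; rewrite weight_vertex eqxx oner_neq0.
  move=> w /segment_support []; rewrite weight_vertex.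
    by have [->|] := eqVneq w u; rewrite ?eqxx.
  by have [->|] := eqVneq w v; rewrite ?eqxx.
have F0 : @filtration Y (comp_level v) (g 0).
  have h := @closed_cvg _ Y (at_right (0 : rr)) _ g _
    (@filtration_closed Y (comp_level v)).
  apply: h; first by near=> x; apply: gpos; near: x; exact: nbhs_right_gt.
  by apply: cvg_at_right_filter; exact: cg.
have /sliceP : slice (comp_level u) (g 0).
  rewrite /g segment0; apply: comp_slice.
    by rewrite weight_vertex eqxx oner_neq0.
  by move=> w; rewrite weight_vertex; have [->|] := eqVneq w u; rewrite ?eqxx.
by move=> /(_ (comp_level v)) <-.
Unshelve. all: by end_near.
Qed.

Fact comp_mono : {homo comp_level : u v / (u <= v)%N}.
Proof. by move=> u v uv; exact/comp_level_le/level_mono. Qed.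
Fact comp_filtered i t : @filtration Y i (comp_map t) <->
  (forall v, weight t v != 0 -> (comp_level v <= i)%N).
Proof.
have [v1 wv1] : exists v, weight t v != 0.
  apply: contrapT => no; have := weight_sum t; rewrite big1 => [/eqP|v _].
    by rewrite eq_sym oner_eq0.
  by apply: contrapT => /eqP wv; apply: no; exists v.
case: (@arg_maxnP _ v1 (fun v => weight t v != 0) (fun v => level s v) wv1).
move=> v0 w0 wm.
have /sliceP -> := comp_slice w0 wm.
split=> [h v wv|]; last exact.
by apply: leq_trans h; apply: comp_level_le; exact: wm.
Qed.
Fact comp_regular : [exists v, comp_level v == ord_max].
Proof.
have /existsP [v /eqP lv] := regular_level s.
apply/existsP; exists v; rewrite ffunE.
set S := point_stratum _; have := smap_codim f S; rewrite /codim.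
have -> : stratum_index S = ord_max.
  apply/val_inj; rewrite -lv.
  exact: slice_inj (slice_point_index _) (vertex_slice v).
rewrite subnn leqn0 subn_eq0 => le; apply/eqP/val_inj/anti_leq.
by rewrite le -ltnS ltn_ord.
Qed.

Definition comp_simplex : regularSimplex rr Y :=
  @RegularSimplex rr Y (FilteredSimplex (nvert_gt0 s) comp_continuous comp_mono
    comp_filtered) comp_regular.

End Composition.

End InducedSimplices.

Local Close Scope classical_set_scope.

(* Faces of the cones c E, for E a set of vertices in 'I_N: the pair (F, e)
   stands for F if e = false and for F * [v], with apex v, if e = true. Faces of
   E itself are the pairs (F, false). The pair (set0, false) is not a face. *)
Notation cface N := ({set 'I_N} * bool)%type.

(* The modules N^*(c E), N^*(E) and their tensor products are free on finite sets
   of faces; cochains are written in these bases, and the linear maps between them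
   are given by their matrix coefficients. *)
Section ConeFactors.
Variables (R : comPzRingType) (N : nat).
Implicit Types (E F G : {set 'I_N}) (a b c g : cface N).

Definition sgn (k : nat) : R := (-1) ^+ k.

Definition apex : cface N := (finset.set0, true).
Definition no_face : cface N := (finset.set0, false).

Definition cdim a : nat := (#|a.1| + a.2).-1.

(* coefficient of a in the boundary of b, the apex being the last vertex *)
Definition incidence b a : R :=
  \sum_(v in b.1 | a == (b.1 :\ v, b.2)) sgn #|[set u in b.1 | (u < v)%N]|
  + (if b.2 && (a == (b.1, false)) then sgn #|b.1| else 0).

(* coefficient of 1_b in the coboundary of 1_a *)
Definition coboundary_coef a b : R := - sgn (cdim a) * incidence b a.

Definition compatible F G : bool :=
  [exists v in F :&: G,
    [forall u in F, (u <= v)%N] && [forall u in G, (v <= u)%N]].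

(* coefficient of 1_c in the cup product of 1_a and 1_b *)
Definition cup_coef a b c : R :=
  if ~~ a.2 && compatible a.1 b.1 then
    sgn (cdim a * cdim b) * (c == (a.1 :|: b.1, b.2))%:R
  else if a.2 && (b == apex) then (c == a)%:R
  else 0.

(* coefficient of g in the cap product of 1_a with [E], resp. with [c E] *)
Definition cap_coef E a g : R :=
  [&& compatible a.1 g.1, a.1 :|: g.1 == E & ~~ g.2]%:R.
Definition cone_cap_coef E a g : R :=
  if ~~ a.2 then [&& compatible a.1 g.1, a.1 :|: g.1 == E & g.2]%:R
  else ((a.1 == E) && (g == apex))%:R.

(* Coefficient of 1_a0 (x) 1_a1 in Xi(1_b), for the join E0 * E1. The map with
   values in N^*(c E0) (x) N^*(E1) is obtained by keeping the terms such that a1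
   is a face of E1, that is, a1.2 = false. *)
Definition Xi E0 E1 b a0 a1 : R :=
  let F0 := b.1 :&: E0 in
  let F1 := b.1 :&: E1 in
  if (F1, b.2) != no_face then
    sgn (cdim (F0, true) * cdim (F1, b.2))
    * ((a0 == (F0, true)) && (a1 == (F1, b.2)))%:R
  else
    (a0 == (F0, false))%:R
    * ((a1 == apex)%:R + \sum_(e in E1) (a1 == ([set e], false))%:R).

(* Coefficient of 1_a0 (x) ... (x) 1_ar in the iterated Xi(1_b), for the join
   E0 * ... * Er; the argument is the REVERSED list (Er, ar), ..., (E0, a0). The
   empty list corresponds to N^*(c set0) = R. *)
Fixpoint Xi_iter (s : seq ({set 'I_N} * cface N)) b : R :=
  match s with
  | [::] => (b == apex)%:R
  | (E, a) :: s' =>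
    if s' is [::] then (b == a)%:R
    else \sum_(a0 : cface N) Xi (\bigcup_(p <- s') p.1) E b a0 a * Xi_iter s' a0
  end.

End ConeFactors.

Arguments sgn R k : clear implicits.
Arguments apex {N}.
Arguments no_face {N}.


Section BlownUpSimplex.
Variables (R : comPzRingType) (N n : nat).
Implicit Type h : {ffun 'I_N -> 'I_n.+1}.

Definition join_factor h (i : 'I_n.+1) : {set 'I_N} := [set v | h v == i].

(* (F, e) = ((F_0, e_0), ..., (F_(n-1), e_(n-1)), F_n) *)
Definition is_blowup_face h (x : {ffun 'I_n.+1 -> cface N}) : bool :=
  [forall i, [&& (x i).1 \subset join_factor h i, x i != no_face
               & (i == ord_max) ==> ~~ (x i).2]].

Definition blowup_face h : Type := {x : {ffun 'I_n.+1 -> cface N} | is_blowup_face h x}.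
HB.instance Definition _ h := Finite.on (blowup_face h).

(* N~^*(D), in the basis of the 1_(F, e) *)
Definition blowup_cochain h : Type := {ffun blowup_face h -> R^o}.
HB.instance Definition _ h := GRing.Lmodule.on (blowup_cochain h).

Definition total_degree (x : {ffun 'I_n.+1 -> cface N}) : nat :=
  (\sum_i cdim (x i))%N.

Definition blowup_diff h (w : blowup_cochain h) : blowup_cochain h :=
  [ffun c : blowup_face h => \sum_a w a *
    \sum_(i < n.+1) sgn R (\sum_(j : 'I_n.+1 | (j < i)%N) cdim (val a j))
      * coboundary_coef R (val a i) (val c i)
      * \prod_(j | j != i) (val a j == val c j)%:R].

Definition blowup_cup h (w e : blowup_cochain h) : blowup_cochain h :=
  [ffun c : blowup_face h => \sum_a \sum_b w a * e b
    * sgn R (\sum_(i < n.+1) \sum_(j : 'I_n.+1 | (j < i)%N) cdim (val a i) * cdim (val b j))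
    * \prod_(i < n.+1) cup_coef R (val a i) (val b i) (val c i)].

(* the product of w with D~, in N_*(c D_0) (x) ... (x) N_*(D_n) *)
Definition blowup_cap h (w : blowup_cochain h) : blowup_cochain h :=
  [ffun g : blowup_face h => \sum_a w a
    * sgn R (\sum_(j : 'I_n.+1 | (j < n)%N)
               #|join_factor h j| * \sum_(i : 'I_n.+1 | (j < i)%N) cdim (val a i))
    * \prod_(i < n.+1) (if (i < n)%N
               then cone_cap_coef R (join_factor h i) (val a i) (val g i)
               else cap_coef R (join_factor h i) (val a i) (val g i))].

Definition first_base (x : {ffun 'I_n.+1 -> cface N}) : 'I_n.+1 :=
  [arg min_(j < ord_max | ~~ (x j).2) j].
Definition mu_face (x : {ffun 'I_n.+1 -> cface N}) : {set 'I_N} :=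
  \bigcup_(i < n.+1 | (i <= first_base x)%N) (x i).1.

Definition mu h (c : blowup_cochain h) : {ffun {set 'I_N} -> R^o} :=
  [ffun F : {set 'I_N} => \sum_(g | (mu_face (val g) == F) && (total_degree (val g) == #|F|.-1)) c g].

Definition cap_simplex h (w : blowup_cochain h) : {ffun {set 'I_N} -> R^o} :=
  mu (blowup_cap w).

Definition face_norm (l : nat) (x : {ffun 'I_n.+1 -> cface N}) : \bar int :=
  let k := inord (n - l) in
  if (x k).2 then -oo%E
  else ((\sum_(i : 'I_n.+1 | (k < i)%N) cdim (x i))%N%:Z)%:E.

Definition blowup_norm (l : nat) h (w : blowup_cochain h) : \bar int :=
  \big[Order.max/-oo%E]_(a | w a != 0) face_norm l (val a).

End BlownUpSimplex.

Section Restriction.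
Variables (R : comPzRingType) (N n : nat) (h : {ffun 'I_N -> 'I_n.+1}).
Variable F : {set 'I_N}.

Definition face_image (x : {ffun 'I_n.+1 -> cface #|F|}) :
    {ffun 'I_n.+1 -> cface N} :=
  [ffun i => ([set enum_val u | u in (x i).1], (x i).2)].

Definition restriction (h' : {ffun 'I_#|F| -> 'I_n.+1})
    (w : blowup_cochain R h) : blowup_cochain R h' :=
  [ffun b : blowup_face h' => oapp w 0 (insub (face_image (val b)))].

End Restriction.

(* Comparison of two join decompositions D_0 * ... * D_n and D'_0 * ... * D'_m of
   the same simplex, given by h and h', the second one coarser than the first. *)
Section Comparison.
Variables (R : comPzRingType) (N n m : nat).
Variables (h : {ffun 'I_N -> 'I_n.+1}) (h' : {ffun 'I_N -> 'I_m.+1}).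

(* If j = i_b, these are the indices j_(b-1) < i <= j_b, in increasing order,
   where j_b is the highest h-level of a vertex of D'_j, that is, the empty D_i
   are attached to the next non-empty one. If D'_j is empty, so is the list. *)
Definition block (j : 'I_m.+1) : seq 'I_n.+1 :=
  [seq i : 'I_n.+1 <- enum 'I_n.+1
  | [exists v, (h' v == j) && (i <= h v)%N]
    && [forall v, (h' v < j)%N ==> (h v < i)%N]].

Definition blowup_comparison (w : blowup_cochain R h') : blowup_cochain R h :=
  [ffun a : blowup_face h => \sum_b w b *
    \prod_j Xi_iter R (rev [seq (join_factor h i, val a i) | i <- block j])
              (val b j)].

End Comparison.

Section BlownUpCochains.
Variables (rr : realType) (R : comPzRingType) (X : filteredSpace).

Definition cochain : Type :=
  dprod (fun s : regularSimplex rr X => blowup_cochain R (level s)).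
HB.instance Definition _ := GRing.Lmodule.on cochain.

Implicit Types w e : cochain.

(* w is an element of N~^*(X; R) *)
Definition face_compatible w : Prop :=
  forall (s : regularSimplex rr X) (F : regular_face s),
    #|~: val F| = 1%N -> restriction (level (face F)) (w s) = w (face F).

Definition homogeneous (k : nat) w : Prop :=
  forall s a, w s a != 0 -> total_degree (val a) = k.

Definition cochain_diff w : cochain := fun s => blowup_diff (w s).

Definition cup_product w e : cochain := fun s => blowup_cup (w s) (e s).

Definition stratum_norm (S : stratum X) w : \bar int :=
  supremum -oo%E
    [set blowup_norm (codim S) (w s) | s in
      [set s : regularSimplex rr X | (range s `&` stratum_set S) !=set0]]%classic.

Definition allowable (p : perversity X) w : Prop :=
  forall S : stratum X, (0 < codim S)%N -> (stratum_norm S w <= p S)%E.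

End BlownUpCochains.

Local Open Scope classical_set_scope.

Section LinearStructures.
Variable R : comPzRingType.

Lemma blowup_cochainP N n (h : {ffun 'I_N -> 'I_n.+1}) (c : R)
  (u v : blowup_cochain R h) b : (c *: u + v) b = c * u b + v b.
Proof. by rewrite !ffunE. Qed.

Fact blowup_diff_linear N n (h : {ffun 'I_N -> 'I_n.+1}) :
  linear (@blowup_diff R N n h).
Proof.
move=> c u v; apply/ffunP => b; rewrite blowup_cochainP !ffunE mulr_sumr.
rewrite -big_split; apply: eq_bigr => a _ /=.
by rewrite blowup_cochainP mulrDl mulrA.
Qed.

Fact restriction_linear N n (h : {ffun 'I_N -> 'I_n.+1}) (F : {set 'I_N})
  (h' : {ffun 'I_#|F| -> 'I_n.+1}) : linear (@restriction R N n h F h').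
Proof.
move=> c u v; apply/ffunP => b; rewrite blowup_cochainP !ffunE.
case: insubP => [a _ _|_] /=; first exact: blowup_cochainP.
by rewrite mulr0 addr0.
Qed.

Lemma blowup_norm_le N n (h : {ffun 'I_N -> 'I_n.+1}) l
    (w : blowup_cochain R h) x :
  (blowup_norm l w <= x)%E <->
  forall a, w a != 0 -> (face_norm l (val a) <= x)%E.
Proof.
rewrite /blowup_norm; split=> [|h1].
  by move/bigmax_leP => [_ h1] a /h1.
by apply/bigmax_leP; split; [exact: leNye | move=> a /h1].
Qed.

Lemma ereal_int_has_sup (A : set (\bar int)) : supremums A !=set0.
Proof.
have [[b Ab]|nob] := pselect (exists b : int, ubound A b%:E); last first.
  have [Ny|nNy] := pselect (ubound A -oo%E).
    by exists -oo%E; split => // y _; exact: leNye.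
  exists +oo%E; split=> [y _|]; first exact: leey.
  by case=> [r Ar|//|//]; case: nob; exists r.
have [a [Aa|nA]] : exists a : int, A a%:E \/ (forall c : int, ~ A c%:E).
  have [[c Ac]|no] := pselect (exists c : int, A c%:E); first by exists c; left.
  by exists 0; right => c Ac; apply: no; exists c.
- pose P n := `[< ubound A (a + n%:Z)%:E >].
  have exP : exists n, P n.
    exists `|b - a|%N; apply/asboolP => y Ay.
    by apply: le_trans (Ab _ Ay) _; rewrite lee_fin; lia.
  exists (a + (ex_minn exP)%:Z)%:E; case: ex_minnP => k /asboolP Pk mk.
  split=> // -[r| |] Ar; [|exact: leey|by have := Ar _ Aa; rewrite leeNy_eq].
  have ar : a <= r by have := Ar _ Aa; rewrite lee_fin.
  have /mk kr : P `|r - a|%N.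
    by apply/asboolP; have -> : a + `|r - a|%N = r by lia.
  by have h : a + k%:Z <= r by lia.
- exists -oo%E; split; last by move=> y _; exact: leNye.
  by move=> [c /nA //| /Ab|//]; rewrite leye_eq.
Qed.

End LinearStructures.

Section BlownUpComplexes.
Variables (rr : realType) (R : comPzRingType) (X : filteredSpace).
Local Notation cochain := (cochain rr R X).
Implicit Types (w e : cochain) (k : nat).

Fact cochain_diff_linear : linear (@cochain_diff rr R X).
Proof.
move=> c w e; apply: functional_extensionality_dep => s.
exact: blowup_diff_linear.
Qed.
HB.instance Definition _ := GRing.isLinear.Build R cochain cochain *:%R
  (@cochain_diff rr R X) cochain_diff_linear.

Lemma stratum_norm_le (S : stratum X) w x :
  (stratum_norm S w <= x)%E <->
  forall s : regularSimplex rr X, (range s `&` stratum_set S) !=set0 ->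
    (blowup_norm (codim S) (w s) <= x)%E.
Proof.
rewrite /stratum_norm; set A := [set blowup_norm _ _ | s in _].
have supA : supremums A (supremum -oo%E A).
  rewrite /supremum; case: ifPn => [/eqP ->|_].
    by split=> [y []|y _]; exact: leNye.
  by have [y Ay] := ereal_int_has_sup A; exact: (xgetI _ Ay).
split=> [le s sS|h].
  by apply: le_trans le; apply: supA.1; exists s.
by apply: supA.2 => _ [s sS <-]; exact: h.
Qed.

Fact allowable0 (p : perversity X) : allowable p (0 : cochain).
Proof.
move=> S _; apply/stratum_norm_le => s _; apply/blowup_norm_le => a.
by rewrite [X in X != 0]ffunE eqxx.
Qed.

Fact allowable_linear (p : perversity X) (c : R) w e :
  allowable p w -> allowable p e -> allowable p (c *: w + e).
Proof.
move=> pw pe S S0; apply/stratum_norm_le => s sS; apply/blowup_norm_le => a.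
rewrite dprodE blowup_cochainP => nz.
have [w0|wa] := eqVneq (w s a) 0.
  have ea : e s a != 0 by move: nz; rewrite w0 mulr0 add0r.
  have /stratum_norm_le /(_ s sS) /blowup_norm_le := pe S S0; exact.
by have /stratum_norm_le /(_ s sS) /blowup_norm_le := pw S S0; exact.
Qed.

Definition blowup_set k w : Prop := face_compatible w /\ homogeneous k w.

Fact blowup_set0 k : blowup_set k 0.
Proof.
split=> [s F _|s a]; last by rewrite ffunE eqxx.
apply/ffunP => b; rewrite !ffunE; case: insubP => // a _ _ /=.
by rewrite ffunE.
Qed.
Fact blowup_set_linear k (c : R) w e :
  blowup_set k w -> blowup_set k e -> blowup_set k (c *: w + e).
Proof.
move=> [cw hw] [ce he]; split=> [s F F1|s a].
  by rewrite !dprodE restriction_linear cw // ce.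
rewrite dprodE blowup_cochainP => nz.
have [w0|] := eqVneq (w s a) 0; last exact: hw.
by apply: he; move: nz; rewrite w0 mulr0 add0r.
Qed.

(* N~^k(X; R) *)
Definition blowup k : submodule cochain :=
  Submodule (blowup_set0 k) (@blowup_set_linear k).

Section Perverse.
Variable p : perversity X.

Definition perverse_set k w : Prop :=
  [/\ blowup k w, allowable p w & allowable p (cochain_diff w)].

Fact perverse_set0 k : perverse_set k 0.
Proof.
by split; [exact: submodule_0|exact: allowable0|rewrite linear0; exact: allowable0].
Qed.
Fact perverse_set_linear k (c : R) w e :
  perverse_set k w -> perverse_set k e -> perverse_set k (c *: w + e).
Proof.
move=> [bw aw dw] [be ae de]; split; first exact: submodule_linear.
  exact: allowable_linear.
by rewrite linearP; exact: allowable_linear.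
Qed.

(* N~_p^k(X; R) *)
Definition perverse_blowup k : submodule cochain :=
  Submodule (perverse_set0 k) (@perverse_set_linear k).

Definition blownup_cohomology k : lmodType R :=
  cohomology (@cochain_diff rr R X) perverse_blowup k.

End Perverse.
End BlownUpComplexes.

Section Chains.
Variables (rr : realType) (R : comPzRingType).

Section Module.
Variable X : filteredSpace.

Definition finitely_supported
    (c : dprod (fun _ : regularSimplex rr X => R^o)) : Prop :=
  finite_set [set s | c s != 0].

Fact finitely_supported0 : finitely_supported 0.
Proof.
by apply: (@sub_finite_set _ _ set0) => // s /=; rewrite eqxx.
Qed.
Fact finitely_supported_linear (a : R) c d :
  finitely_supported c -> finitely_supported d ->
  finitely_supported (a *: c + d).
Proof.
move=> fc fd; apply: (@sub_finite_set _ _ ([set s | c s != 0] `|` [set s | d s != 0])).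
  move=> s /=; rewrite dprodE => nz.
  have [c0|] := eqVneq (c s) 0; last by left.
  by right; move: nz; rewrite c0 scaler0 add0r.
by rewrite finite_setU.
Qed.

(* the free module on the regular simplices, all degrees together *)
Definition chain : lmodType R :=
  elements (Submodule finitely_supported0 finitely_supported_linear).

Definition generator_fun (s : regularSimplex rr X) :
  dprod (fun _ : regularSimplex rr X => R^o) := fun t => (t == s)%:R.
Fact generator_finite s :
  submodule_pred (Submodule finitely_supported0 finitely_supported_linear)
    (generator_fun s).
Proof.
apply/asboolP; apply: (@sub_finite_set _ _ [set s]) => [t|]; last exact: finite_set1.
by rewrite /= /generator_fun; have [->|_] := eqVneq t s; rewrite ?eqxx.
Qed.
Definition generator s : chain := Sub (generator_fun s) (generator_finite s).

Definition linear_extension (V : lmodType R) (g : regularSimplex rr X -> V)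
    (c : chain) : V :=
  \sum_(s \in [set: regularSimplex rr X]) (val c s : R) *: g s.

(* The faces in the support of [cap_simplex] are all regular. *)
Definition cap_on_simplex (w : cochain rr R X) (s : regularSimplex rr X) : chain :=
  \sum_(F : regular_face s) cap_simplex (w s) (val F) *: generator (face F).

Definition cap_product (w : cochain rr R X) (c : chain) : chain :=
  linear_extension (cap_on_simplex w) c.

End Module.

Variables (X Y : filteredSpace) (f : stratifiedMap X Y).

Definition chain_pushforward (c : chain X) : chain Y :=
  linear_extension (fun s => generator (comp_simplex f s)) c.

Definition cochain_pullback (w : cochain rr R Y) : cochain rr R X :=
  fun s => blowup_comparison (level s) (w (comp_simplex f s)).

End Chains.

(* Main.v *)
Require Import Defs.
From HB Require Import structures.
From mathcomp Require Import all_boot all_order all_algebra.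
From mathcomp Require Import all_classical all_reals all_analysis.
From mathcomp Require Import finset zify ring.

(** A basis element of the blown-up cochains of a regular simplex is a family of
    faces of the cones c E_0, ..., c E_(n-1) and of E_n. The transpose of Xi acts
    on such families: it sends (F_0, 1) (x) (F_1, e) to (F_0 * F_1, e), and
    (F_0, 0) (x) a to (F_0, 0) if a is a point and to 0 otherwise ([cone_merge]).
    This is the chain map of the projection c E_0 x c E_1 -> c (E_0 * E_1) which
    collapses the second factor over the base of the first one. It sends basis
    elements to basis elements or to 0, so the iterated Xi is read off from a
    left fold of this partial operation ([Xi_iter_merge_along]), and a coefficient
    of the pull-back of a cochain is, up to sign, one coefficient of the cochain.

    The signs disappear after rescaling the basis elements by the sign [twist] of
    the permutation that reverses a product of graded elements. In the rescaled
    basis the pull-back is the transpose of the unsigned map [merge_blocks]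
    ([rescaled_comparison]), the differential is the transpose of the boundary of
    a product of simplices, and the cup product that of its Alexander-Whitney
    diagonal ([rescaled_diff], [rescaled_cup]); the cap product is the diagonal of
    the top face ([rescaled_cap]). A cone is handled as a simplex whose last
    vertex is the apex, which gives one formula for the factors c E_i and E_n.

    So the compatibilities with the differential, the cup product and the cap
    product say that merging is a map of differential graded coalgebras. For two
    factors this is [boundary_merge], and [merge_cut] with its two converses
    [merge_cut_exists] and [merge_cut_uniq]: the cuts of a merged face are exactly
    the merged cuts. These facts extend to the factors of a block
    by induction and to all blocks because the blocks do not interact; the result
    is [merge_blocks_boundary] and [sum_cuts_merge_blocks]. For the cap product,
    moreover, the top face merges to the top face.

    The pull-back of a compatible family is compatible because a factor that
    becomes empty in a face contributes only its apex, which is a unit for merging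
    ([restriction_comparison]). As for perversities, a base factor occurring in a
    block forces all later factors of the block to be points. Hence the degree above the level
    of a stratum S is unchanged by merging when S meets the simplex
    ([merge_blocks_above]), and it is 0 if the stratum of Y containing the image of
    S is regular, where the perversity of Y is 0 too. *)

Set Implicit Arguments.
Unset Strict Implicit.
Unset Printing Implicit Defensive.

Import Order.TTheory GRing.Theory Num.Theory.
Import numFieldNormedType.Exports.

Local Open Scope ring_scope.

(** * Merging two cones *)

Section Sign.
Variable R : comPzRingType.

Lemma sgnD a b : sgn R (a + b) = sgn R a * sgn R b.
Proof. exact: exprD. Qed.

Lemma sgn_sqr k : sgn R k * sgn R k = 1.
Proof. by rewrite -sgnD addnn -mul2n /sgn exprM sqrrN expr1n expr1n. Qed.

Lemma sgnS k : sgn R k.+1 = - sgn R k.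
Proof. by rewrite /sgn exprS mulN1r. Qed.

End Sign.

Section ConeFaces.
Variable N : nat.
Implicit Types (a b c x y : cface N) (F G : {set 'I_N}).

(** The apex counts as a vertex, so that the dimension of a face of a cone is one
    less than this number; only [no_face] has no vertex. *)
Definition nverts a : nat := (#|a.1| + a.2)%N.

Definition is_point a : bool := nverts a == 1%N.

(** The transpose of Xi on basis elements, without its sign; [None] stands for 0.
    Over the base of the first cone, the second factor is collapsed: only its
    points survive. *)
Definition cone_merge x a : option (cface N) :=
  if x.2 then Some (x.1 :|: a.1, a.2) else if is_point a then Some x else None.

(** The order condition satisfied by the vertices of two successive factors of a
    join. *)
Definition precedes F G : Prop :=
  forall u v : 'I_N, u \in F -> v \in G -> (u < v)%N.

Lemma precedes_disjoint F G : precedes F G -> F :&: G = set0.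
Proof.
move=> FG; apply/setP => v; rewrite !inE; apply/negP => /andP[vF vG].
by have := FG v v vF vG; rewrite ltnn.
Qed.

Lemma face_nonempty a : (a != no_face) = (0 < nverts a)%N.
Proof.
case: a => F []; first by rewrite xpair_eqE andbF /nverts addn1.
by rewrite /nverts addn0 card_gt0 /no_face xpair_eqE eqxx andbT.
Qed.

Lemma cdimE a : cdim a = (nverts a).-1.
Proof. by []. Qed.

Lemma nverts_cone F : nverts (F, true) = #|F|.+1.
Proof. exact: addn1. Qed.

Lemma nverts_base F : nverts (F, false) = #|F|.
Proof. exact: addn0. Qed.

Lemma nverts_union F G (e : bool) : precedes F G ->
  nverts (F :|: G, e) = (#|F| + nverts (G, e))%N.
Proof.
by move=> /precedes_disjoint FG; rewrite /nverts /= cardsU FG cards0 subn0 addnA.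
Qed.

Lemma cdim_merge x a y : precedes x.1 a.1 -> x != no_face -> a != no_face ->
  cone_merge x a = Some y -> cdim y = (cdim x + cdim a)%N.
Proof.
rewrite !face_nonempty !cdimE /cone_merge /is_point.
case: x a => X [] [A b] /= xa x0 a0; last by case: eqP => // a1 [<-]; lia.
move=> [<-]; rewrite nverts_union // nverts_cone; lia.
Qed.

Lemma merge_neq_no_face x a y : x != no_face -> a != no_face ->
  cone_merge x a = Some y -> y != no_face.
Proof.
rewrite /cone_merge => x0 a0; case: ifP => [x1 [<-]|x1]; last by case: ifP => // _ [<-].
move: a0; rewrite !face_nonempty => /leq_trans; apply; rewrite /nverts leq_add2r.
exact: subset_leq_card (subsetUr _ _).
Qed.

Lemma merge_apexl a : cone_merge apex a = Some a.
Proof. by rewrite /cone_merge /= set0U -surjective_pairing. Qed.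

Lemma merge_apexr x : cone_merge x apex = Some x.
Proof.
rewrite /cone_merge /is_point /nverts cards0 /= setU0.
by case: x => F [].
Qed.

Lemma merge_sub x a y : cone_merge x a = Some y -> y.1 \subset x.1 :|: a.1.
Proof.
rewrite /cone_merge; case: ifP => [_ [<-] //|_]; case: ifP => // _ [<-].
exact: subsetUl.
Qed.

End ConeFaces.

(** * Merging is compatible with the boundary *)

Section Boundary.
Variables (R : comPzRingType) (N : nat).
Implicit Types (a b c x y : cface N) (X A : {set 'I_N}) (phi : cface N -> R).

(** The value on the boundary of y of the linear form with coefficients phi. The
    boundary of a point contains the empty face [no_face]: this is the augmented
    boundary. *)
Definition boundary_sum phi y : R :=
  \sum_(v in y.1) sgn R #|[set u in y.1 | (u < v)%N]| * phi (y.1 :\ v, y.2)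
  + (if y.2 then sgn R #|y.1| * phi (y.1, false) else 0).

Lemma incidence_sum phi y :
  \sum_x incidence R y x * phi x = boundary_sum phi y.
Proof.
rewrite /incidence /boundary_sum.
under eq_bigr do rewrite mulrDl.
rewrite big_split /=; congr (_ + _).
  under eq_bigr do rewrite mulr_suml.
  under eq_bigr => x _.
    rewrite big_mkcondr /=.
  over.
  rewrite exchange_big /=; apply: eq_bigr => v vy.
  rewrite (bigD1 (y.1 :\ v, y.2)) //= eqxx big1 ?addr0 // => x.
  by move=> /negbTE ->.
case: ifP => y2 /=; last by rewrite big1 // => x _; rewrite mul0r.
rewrite (bigD1 (y.1, false)) //= eqxx big1 ?addr0 // => x.
by move=> /negbTE ->; rewrite mul0r.
Qed.

(** Killing the value at [no_face] turns the augmented boundary into the boundary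
    of the cone. *)
Definition reduced phi x : R := if x == no_face then 0 else phi x.

Lemma boundary_reduced phi a : a != no_face ->
  boundary_sum phi a =
  boundary_sum (reduced phi) a + (is_point a)%:R * phi no_face.
Proof.
rewrite /is_point /boundary_sum; case: a => F [] /= a0.
  rewrite nverts_cone eqSS cards_eq0.
  have [->|F0] := eqVneq F set0.
    by rewrite !big_set0 /reduced eqxx cards0 /sgn expr0 mulr0 !add0r.
  rewrite mul0r addr0 {2}/reduced /no_face xpair_eqE (negbTE F0) /=.
  by congr (_ + _); apply: eq_bigr => v _; rewrite /reduced xpair_eqE andbF.
rewrite nverts_base !addr0.
have [/cards1P[v ->]|F1] := boolP (#|F| == 1%N).
  rewrite !big_set1 setDv /reduced eqxx mulr0 add0r mul1r.
  rewrite (_ : [set u in _ | _] = set0) ?cards0 /sgn ?expr0 ?mul1r //.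
  by apply/setP => u; rewrite !inE; case: eqP => // ->; rewrite ltnn.
rewrite mul0r addr0; apply: eq_bigr => v vF; rewrite /reduced xpair_eqE andbT.
by case: eqP => // Fv; move: F1; rewrite (cardsD1 v F) vF Fv cards0.
Qed.

Lemma boundary_point phi a : is_point a -> boundary_sum (reduced phi) a = 0.
Proof.
rewrite /is_point /boundary_sum; case: a => F [] /=.
  rewrite nverts_cone eqSS cards_eq0 => /eqP ->.
  by rewrite big_set0 add0r /reduced eqxx mulr0.
rewrite nverts_base => /cards1P [v ->].
by rewrite big_set1 addr0 setDv /reduced eqxx mulr0.
Qed.

(** The Leibniz rule of the augmented complex of a join. *)
Lemma boundary_union phi X A (e : bool) : precedes X A ->
  boundary_sum phi (X :|: A, e) =
  \sum_(v in X) sgn R #|[set u in X | (u < v)%N]| * phi (X :\ v :|: A, e)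
  + sgn R #|X| * boundary_sum (fun a => phi (X :|: a.1, a.2)) (A, e).
Proof.
move=> XA; have dXA := precedes_disjoint XA.
rewrite /boundary_sum /= (eq_bigl [predU X & A]); last by move=> v; rewrite !inE.
rewrite bigU /=; last by rewrite -setI_eq0 dXA.
rewrite -addrA mulrDr; congr (_ + (_ + _)).
- apply: eq_bigr => v vX; congr (sgn R _ * phi _).
    congr #|pred_of_set _|; apply/setP => u; rewrite !inE.
    case uA : (u \in A); rewrite ?orbF // orbT /=.
    by rewrite ltnNge ltnW ?XA // andbF.
  congr pair; apply/setP => u; rewrite !inE; case: eqP => //= ->.
  by apply/esym/negP => vA; have := XA v v vX vA; rewrite ltnn.
- rewrite mulr_sumr; apply: eq_bigr => v vA; rewrite mulrA -sgnD.
  congr (sgn R _ * phi _).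
    have -> : [set u in X :|: A | (u < v)%N] = X :|: [set u in A | (u < v)%N].
      apply/setP => u; rewrite !inE.
      by case uX : (u \in X) => //=; rewrite (XA _ _ uX vA).
    rewrite cardsU (_ : X :&: _ = set0) ?cards0 ?subn0 //.
    by apply/setP => u; have /setP/(_ u) := dXA; rewrite !inE andbA => ->.
  congr pair; apply/setP => u; rewrite !inE; case: eqP => //= ->.
  by rewrite orbF; apply/esym/negP => vX; have := XA v v vX vA; rewrite ltnn.
case: e; last by rewrite mulr0.
rewrite mulrA -sgnD.
by rewrite cardsU dXA cards0 subn0.
Qed.

(** The composite of the boundary with the augmentation vanishes: only edges have
    points in their boundary, with opposite signs. *)
Lemma boundary_augmentation a : a != no_face ->
  boundary_sum (fun x => (is_point x)%:R) a = 0.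
Proof.
move=> a0; rewrite /boundary_sum /is_point; case: a a0 => F [] /= a0.
  have [/cards1P[v ->]|F1] := boolP (#|F| == 1%N).
    rewrite big_set1 setDv nverts_cone nverts_base cards0 cards1 eqxx !mulr1.
    set A := [set u in _ | _]; have -> : A = set0.
      by apply/setP => u; rewrite !inE; case: eqP => // ->; rewrite ltnn.
    by rewrite cards0 /sgn expr0 expr1 subrr.
  rewrite nverts_base (negbTE F1) mulr0 addr0 big1 // => v vF.
  rewrite nverts_cone (_ : _ == _ = false) ?mulr0 //.
  by apply/negbTE; move: F1; rewrite (cardsD1 v F) vF eqSS.
rewrite addr0.
have [/cards2P[u0 [v0 [uv0 FE]]]|F2] := boolP (#|F| == 2%N); last first.
  rewrite big1 // => v vF; rewrite nverts_base.
  rewrite (_ : _ == _ = false) ?mulr0 //.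
  by apply/negbTE; move: F2; rewrite (cardsD1 v F) vF eqSS.
rewrite FE.
wlog uv : u0 v0 uv0 {FE} / (u0 < v0)%N.
  move=> wl; case: (ltngtP u0 v0) => uv; first exact: wl uv.
    by rewrite setUC; apply: (wl v0 u0) => //; rewrite eq_sym.
  by move/eqP: uv0; case; exact: val_inj.
rewrite big_setU1 ?inE //= big_set1 !nverts_base.
have -> : [set u0; v0] :\ u0 = [set v0] by rewrite setU1K // inE.
have -> : [set u0; v0] :\ v0 = [set u0].
  by rewrite setUC setU1K // inE eq_sym.
rewrite !cards1 eqxx !mulr1.
have -> : [set u in [set u0; v0] | (u < u0)%N] = set0.
  apply/setP => u; rewrite !inE; apply/negP.
  by move=> /andP[/orP[]/eqP->]; rewrite ?ltnn // ltnNge ltnW.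
have -> : [set u in [set u0; v0] | (u < v0)%N] = [set u0].
  apply/setP => u; rewrite !inE; have [->|] /= := eqVneq u u0; first by rewrite uv.
  by have [->|] //= := eqVneq u v0; rewrite ltnn.
by rewrite cards0 cards1 /sgn expr0 expr1 subrr.
Qed.

(** Merging is a chain map c E_0 (x) c E_1 -> c (E_0 * E_1). If x contains the apex,
    both sides are the boundary of a join, except for the removal of that apex, to
    be compared with the removal of the only vertex of a point a. If x lies in the
    base and a is not a point, all terms vanish but the augmentation of the
    boundary of a, and this is 0 by [boundary_augmentation]. *)
Lemma boundary_merge phi x a :
    precedes x.1 a.1 -> x != no_face -> a != no_face ->
  boundary_sum (reduced (fun x' => oapp (reduced phi) 0 (cone_merge x' a))) x
  + sgn R (cdim x) *
    boundary_sum (reduced (fun a' => oapp (reduced phi) 0 (cone_merge x a'))) a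
  = oapp (boundary_sum (reduced phi)) 0 (cone_merge x a).
Proof.
move=> xa x0 a0; rewrite {3}/cone_merge.
case: x xa x0 => X [] /= XA x0.
  rewrite cdimE nverts_cone /= boundary_union //.
  have -> : (a.1, a.2) = a by case: (a).
  rewrite {1}/boundary_sum /= -addrA -mulrDr; congr (_ + _ * _).
    by apply: eq_bigr => v _; rewrite /reduced xpair_eqE andbF.
  rewrite (boundary_reduced (fun a' => _ (X :|: _, _))) // addrC; congr (_ + _).
  rewrite {1}/reduced /cone_merge /= setU0.
  by case: eqP => [->|_]; case: (is_point a); rewrite ?mul1r ?mul0r // /reduced eqxx.
case: ifP => pa /=.
  rewrite (boundary_point _ pa) mulr0 addr0 /boundary_sum /= !addr0.
  apply: eq_bigr => v _; congr (_ * _); rewrite /reduced; case: eqP => //=.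
  by rewrite /cone_merge /= pa /= => /eqP/negbTE ->.
rewrite {1}/boundary_sum /= big1 ?add0r ?addr0 /=; last first.
  by move=> v _; rewrite /reduced /cone_merge /= pa /= if_same mulr0.
(* a is not a point, so only the points of its boundary contribute *)
rewrite (_ : boundary_sum _ a = boundary_sum (fun y => (is_point y)%:R) a
                                * reduced phi (X, false)).
  by rewrite boundary_augmentation // mul0r mulr0.
have F y : reduced (fun a' => oapp (reduced phi) 0 (cone_merge (X, false) a')) y
    = (is_point y)%:R * reduced phi (X, false).
  rewrite {1}/reduced /cone_merge /=; case: eqP => [->|_].
    by rewrite /is_point nverts_base cards0 mul0r.
  by case: ifP; rewrite ?mul1r ?mul0r.
rewrite /boundary_sum mulrDl mulr_suml; congr (_ + _).
  by apply: eq_bigr => v _; rewrite F mulrA.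
by case: ifP; rewrite ?mul0r // F mulrA.
Qed.

End Boundary.

(** * Merging is compatible with the diagonal *)

Section Cuts.
Variable N : nat.
Implicit Types (a b c x y : cface N) (A B F G X Y : {set 'I_N}) (u v : 'I_N).

(** 1_c occurs in the product of 1_a and 1_b: c is cut at one of its vertices into
    its front face a and its back face b. With the apex as last vertex, cutting at
    the apex gives the second case of the product on a cone. *)
Definition cut a b c : bool :=
  if a.2 then (b == apex) && (c == a)
  else compatible a.1 b.1 && (c == (a.1 :|: b.1, b.2)).

Variant cut_spec : cface N -> cface N -> cface N -> Prop :=
| CutApex A : cut_spec (A, true) apex (A, true)
| CutVertex A B (e : bool) u of u \in A & u \in B
    & (forall v, v \in A -> (v <= u)%N) & (forall v, v \in B -> (u <= v)%N) :
    cut_spec (A, false) (B, e) (A :|: B, e).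

Lemma cutP a b c : reflect (cut_spec a b c) (cut a b c).
Proof.
apply: (iffP idP) => [|[A|A B e u uA uB Au Bu]]; last 2 first.
- by rewrite /cut /= !eqxx.
- rewrite /cut /= eqxx andbT; apply/existsP; exists u; rewrite inE uA uB /=.
  by apply/andP; split; apply/forallP => v; apply/implyP; [exact: Au|exact: Bu].
case: a b => A [] [B e]; rewrite /cut /=; first by move=> /andP[/eqP-> /eqP->]; left.
move=> /andP[/existsP[u /andP[]]]; rewrite inE => /andP[uA uB].
move=> /andP[/forallP Au /forallP Bu] /eqP ->.
by apply: CutVertex uA uB _ _ => v; [have /implyP := Au v | have /implyP := Bu v].
Qed.

Lemma cut_nonempty a b c : cut a b c ->
  [/\ a != no_face, b != no_face & c != no_face].
Proof.
move=> /cutP[A|A B e u uA uB _ _]; first by rewrite !xpair_eqE !andbF.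
have A0 : A != set0 by apply/set0Pn; exists u.
have B0 : B != set0 by apply/set0Pn; exists u.
have U0 : A :|: B != set0 by apply/set0Pn; exists u; rewrite inE uA.
by rewrite !xpair_eqE (negbTE A0) (negbTE B0) (negbTE U0).
Qed.

Lemma cut_subset a b c : cut a b c -> (a.1 \subset c.1) && (b.1 \subset c.1).
Proof.
by move=> /cutP[A|A B e u _ _ _ _] /=; rewrite ?sub0set ?subxx ?subsetUl ?subsetUr.
Qed.

(** The apex of c, if any, belongs to the back face; the front face contains it
    only for the cut at the apex. *)
Lemma cut_base a b c : cut a b c -> b.2 = c.2 /\ (~~ c.2 -> ~~ a.2).
Proof. by move=> /cutP[]. Qed.

Lemma cut_cdim a b c : cut a b c -> cdim c = (cdim a + cdim b)%N.
Proof.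
move=> /cutP[A|A B e u uA uB Au Bu]; rewrite !cdimE ?nverts_cone ?cards0 ?addn0 //.
have AB : A :&: B = [set u].
  apply/setP => v; rewrite !inE; apply/andP/eqP => [[/Au vu /Bu uv]|-> //].
  by apply/val_inj/anti_leq; rewrite vu.
have A0 : (0 < #|A|)%N by rewrite card_gt0; apply/set0Pn; exists u.
have B0 : (0 < #|B|)%N by rewrite card_gt0; apply/set0Pn; exists u.
rewrite nverts_base /nverts /= cardsU AB cards1.
by case: #|A| A0 => // k _; case: #|B| B0 => // l _; case: (e); lia.
Qed.

(** A point is a front face only for the cut at the first vertex. *)
Lemma cut_point a b c : is_point a -> cut a b c -> b = c.
Proof.
move=> pa /cutP abc; case: abc pa => [A|A B e u uA uB Au Bu] pa.
  by move: pa; rewrite /is_point nverts_cone eqSS cards_eq0 => /eqP ->.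
congr pair; apply/esym/setUidPr; move: pa; rewrite /is_point nverts_base.
by move=> /cards1P[v E]; move: uA; rewrite E inE => /eqP <-; rewrite sub1set.
Qed.

Lemma cut_point_uniq a a' b b' c : is_point a -> is_point a' ->
  cut a b c -> cut a' b' c -> a = a'.
Proof.
have pt A u : is_point (A, false) -> u \in A -> A = [set u].
  by rewrite /is_point nverts_base => /cards1P[v ->]; rewrite inE => /eqP ->.
move=> pa pa' ab ab'.
have bc := cut_point pa ab; have bc' := cut_point pa' ab'; subst b b'.
case: a pa ab => A [] pa ab; case: a' pa' ab' => A' [] pa' ab' //.
- have A0 : A = set0 by move: pa; rewrite /is_point nverts_cone eqSS cards_eq0 => /eqP.
  have A'0 : A' = set0 by move: pa'; rewrite /is_point nverts_cone eqSS cards_eq0 => /eqP.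
  by rewrite A0 A'0.
- by move: ab ab'; rewrite /cut /= => /andP[/eqP -> _] /andP[/existsP[u]]; rewrite !inE andbF.
- by move: ab' ab; rewrite /cut /= => /andP[/eqP -> _] /andP[/existsP[u]]; rewrite !inE andbF.
move: ab ab'; rewrite /cut /= => /andP[/existsP[u]]; rewrite inE.
move=> /andP[/andP[uA uc] /andP[_ /forallP cu]] _ /andP[/existsP[v]]; rewrite inE.
move=> /andP[/andP[vA' vc] /andP[_ /forallP cv]] _.
rewrite (pt A u) // (pt A' v) //; congr ([set _], _).
apply/val_inj/anti_leq.
by apply/andP; split; [exact: (implyP (cu v)) | exact: (implyP (cv u))].
Qed.

Lemma cut_self a : is_point a -> cut a a a.
Proof.
case: a => A [] pa.
  have -> : A = set0 by move: pa; rewrite /is_point nverts_cone eqSS cards_eq0 => /eqP.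
  by rewrite /cut /= !eqxx.
move: pa; rewrite /is_point nverts_base => /cards1P[v ->].
rewrite -{3}[[set v]]setUid; apply/cutP; apply: (@CutVertex _ _ _ v);
  by rewrite ?inE // => u; rewrite inE => /eqP ->.
Qed.

Lemma cut_first a : a != no_face -> exists2 a1, is_point a1 & cut a1 a a.
Proof.
case: a => A e a0; have [A0|/set0Pn[v vA]] := eqVneq A set0.
  case: e a0 => a0; last by rewrite A0 eqxx in a0.
  by exists apex; rewrite ?A0 /cut /= ?eqxx // /is_point nverts_cone cards0.
case: (@arg_minnP _ v (mem A) val vA) => u uA umin.
exists ([set u], false); first by rewrite /is_point nverts_base cards1.
rewrite -{2}(setUidPr _ : [set u] :|: A = A) ?sub1set //.
apply/cutP; apply: (@CutVertex _ _ _ u); rewrite ?inE // => w; 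
by rewrite inE => /eqP ->.
Qed.

(** Merging maps cuts to cuts: at a vertex of the second cone if x is cut at its
    apex, and otherwise at the vertex where x is cut. In the second case a1 must be
    a point, hence the first vertex of a. *)
Lemma merge_cut x1 x2 x a1 a2 a y1 y2 : precedes x.1 a.1 ->
    cut x1 x2 x -> cut a1 a2 a ->
    cone_merge x1 a1 = Some y1 -> cone_merge x2 a2 = Some y2 ->
  exists2 y, cone_merge x a = Some y & cut y1 y2 y.
Proof.
move=> xa /cutP cx; case: cx xa => [X|X1 X2 e u uX1 uX2 X1u X2u] /= xa ca.
  rewrite merge_apexl => -[<-] [<-]; exists (X :|: a.1, a.2) => //.
  move/cutP: ca xa => [A|A1 A2 f u uA1 uA2 A1u A2u] /= xa; first exact/cutP/CutApex.
  rewrite setUA; apply/cutP/(@CutVertex _ _ _ u); rewrite ?inE ?uA1 ?orbT //.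
  move=> v; rewrite inE => /orP[vX|/A1u //].
  by rewrite ltnW ?xa // inE uA1.
rewrite /cone_merge /=; case: ifP => // pa1 [<-]; rewrite (cut_point pa1 ca).
case: e => [[<-]|].
  exists (X1 :|: X2 :|: a.1, a.2) => //.
  rewrite -setUA; apply/cutP/(@CutVertex _ _ _ u); rewrite ?inE ?uX2 //.
  move=> v; rewrite inE => /orP[/X2u //|va].
  by rewrite ltnW ?xa // inE uX1.
case: ifP => // pa [<-]; exists (X1 :|: X2, false) => //.
exact/cutP/(@CutVertex _ _ _ u).
Qed.

(** The sign exchanging the back face of x with the front face of a is trivial on
    the cuts that survive merging. *)
Lemma merge_cut_cdim x1 x2 x a1 y1 : cut x1 x2 x -> cone_merge x1 a1 = Some y1 ->
  (cdim x2 * cdim a1 = 0)%N.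
Proof.
move=> /cutP[X|X1 X2 e u _ _ _ _] /=.
  by rewrite cdimE nverts_cone cards0.
by rewrite /cone_merge /=; case: ifP => // /eqP pa _; rewrite [cdim a1]cdimE pa muln0.
Qed.

(** A cut of the merged face lifts: a cut vertex in x cuts x there and a at its
    first vertex, while a cut vertex in a cuts x at its apex. *)
Lemma merge_cut_exists x a y1 y2 y : precedes x.1 a.1 -> a != no_face ->
    cone_merge x a = Some y -> cut y1 y2 y ->
  exists x1 x2 a1 a2, [/\ cut x1 x2 x, cut a1 a2 a,
    cone_merge x1 a1 = Some y1 & cone_merge x2 a2 = Some y2].
Proof.
case: x a => X [] [A e] xa a0; rewrite /cone_merge /=; [move=> [<-]|]; last first.
  case: ifP => // pa [<-] cy; exists y1, y2, (A, e), (A, e).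
  split=> //; first exact: cut_self.
    by have [_ /(_ isT)/negbTE ->] := cut_base cy; rewrite pa.
  by have [-> _] := cut_base cy; rewrite pa.
move E: (X :|: A, e) => y' cy; case/cutP: cy E => [Y [<- eT]|Y1 Y2 f u uY1 uY2 Y1u Y2u [XAE eF]]; subst e.
  exists (X, true), apex, (A, true), apex; split=> //.
  - exact/cutP/CutApex.
  - exact/cutP/CutApex.
  - exact: merge_apexl.
have XAv v : (v \in X) || (v \in A) = (v \in Y1) || (v \in Y2).
  by have /setP/(_ v) := XAE; rewrite !inE.
have XnA v : v \in X -> (v \in A) = false.
  by move=> vX; apply/negP => vA; have := xa v v vX vA; rewrite ltnn.
have : (u \in X) || (u \in A) by rewrite XAv uY1.
have [uX _|uX /= uA] := boolP (u \in X).
  have Y1A v : v \in A -> (v \in Y1) = false.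
    by move=> vA; apply/negP => /Y1u; rewrite leqNgt xa.
  have [a1 pa1 ca1] := cut_first a0.
  exists (Y1, false), (Y2 :&: X, true), a1, (A, f); split=> //.
  - have {2}-> : X = Y1 :|: Y2 :&: X.
      apply/setP => v; have := XAv v; rewrite !inE /=.
      case vA : (v \in A); first by rewrite (Y1A v vA); case vX : (v \in X);
        [have := XnA v vX; rewrite vA | rewrite andbF].
      by rewrite orbF => ->; case: (v \in Y1); case: (v \in Y2).
    apply/cutP/(@CutVertex _ _ _ u); rewrite ?inE ?uY2 //.
    by move=> v; rewrite inE => /andP[/Y2u].
  - by rewrite pa1.
  congr (Some (_, _)); apply/setP => v; have := XAv v; rewrite !inE /=.
  case vX : (v \in X); first by rewrite !(XnA v vX) !orbF !andbT.
  case vA : (v \in A); first by rewrite (Y1A v vA) /= => <-; rewrite orbT.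
  by case: (v \in Y1); case: (v \in Y2).
have XY2 v : v \in X -> (v \in Y2) = false.
  by move=> vX; apply/negP => /Y2u; rewrite leqNgt xa.
exists (X, true), apex, (Y1 :&: A, false), (Y2, f); split=> //.
- exact/cutP/CutApex.
- have {2}-> : A = Y1 :&: A :|: Y2.
    apply/setP => v; have := XAv v; rewrite !inE /=.
    case vX : (v \in X); first by rewrite !(XnA v vX) XY2 // andbF.
    by case: (v \in Y1); case: (v \in Y2); case: (v \in A).
  apply/cutP/(@CutVertex _ _ _ u); rewrite ?inE ?uY1 //.
  by move=> v; rewrite inE => /andP[/Y1u].
- congr (Some (_, _)); apply/setP => v; have := XAv v; rewrite !inE /=.
  case vX : (v \in X); first by rewrite XY2 // orbF => <-.
  by case: (v \in Y1); case: (v \in Y2); case: (v \in A).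
- exact: merge_apexl.
Qed.

(** The position of the cut is seen on y1: it contains the apex or a vertex of a
    exactly when x is cut at its apex. In that case a is recovered from y1 and y2, and otherwise a1 is
    the first vertex of a. *)
Lemma merge_cut_uniq x1 x2 x a1 a2 a x1' x2' a1' a2' y1 y2 :
    precedes x.1 a.1 ->
    cut x1 x2 x -> cut a1 a2 a -> cut x1' x2' x -> cut a1' a2' a ->
    cone_merge x1 a1 = Some y1 -> cone_merge x2 a2 = Some y2 ->
    cone_merge x1' a1' = Some y1 -> cone_merge x2' a2' = Some y2 ->
  [/\ x1 = x1', x2 = x2', a1 = a1' & a2 = a2'].
Proof.
have cancel X A A' B : X :&: B = set0 -> A \subset B -> A' \subset B ->
    X :|: A = X :|: A' -> A = A'.
  move=> XB AB AB' /setP E; apply/setP => v; have := E v; rewrite !inE.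
  case vX : (v \in X) => // _.
  have vB : v \notin B by move/setP/(_ v): XB; rewrite !inE vX => /= ->.
  by rewrite (contraNF (fintype.subsetP AB v)) // (contraNF (fintype.subsetP AB' v)).
have mixed X1 X1' b2 c2 b c b1 c1 c2' b2' y : precedes b.1 c.1 ->
    cut (X1, true) b2 b -> cut c1 c2 c -> cut (X1', false) b2' b -> cut b1 c2' c ->
    cone_merge (X1, true) c1 = Some y -> cone_merge (X1', false) b1 = Some y -> False.
  move=> bc _ cc cb' _; rewrite /cone_merge /= => -[<-]; case: ifP => // _ [E c10].
  have [] := cut_nonempty cc; case: c1 cc E c10 => C1 f /= cc E f0 + _ _.
  rewrite -f0 xpair_eqE andbT => /set0Pn[v vC1].
  have /andP[/fintype.subsetP/(_ v vC1) vc _] := cut_subset cc.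
  have /andP[/fintype.subsetP/(_ v) vb _] := cut_subset cb'.
  have := bc v v; rewrite vb /= ?E ?inE ?vC1 ?orbT // => /(_ isT vc).
  by rewrite ltnn.
case: x1 x1' => X1 [] [X1' []] xa cx ca cx' ca'; first 1 last.
- by move=> m1 _ m1' _; case: (mixed _ _ _ _ _ _ _ _ _ _ _ xa cx ca cx' ca' m1 m1').
- by move=> m1 _ m1' _; case: (mixed _ _ _ _ _ _ _ _ _ _ _ xa cx' ca' cx ca m1' m1).
- rewrite /cone_merge /=; case: ifP => // pa1 [<-] m2; case: ifP => // pa1' [->] m2'.
  have a11' := cut_point_uniq pa1 pa1' ca ca'.
  have E2 := cut_point pa1 ca; have E2' := cut_point pa1' ca'; subst a2 a2'.
  split=> //; move: cx cx'; rewrite /cut /=.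
  move=> /andP[_ /eqP cx] /andP[_ /eqP cx'].
  have e2 : x2.2 = x2'.2 by have := cx; rewrite cx' => -[].
  move: m2 m2'; rewrite -e2; case: x2 e2 cx => X2 [] /= e2 cx; last first.
    by case: ifP => // _ [->] [].
  case: x2' e2 cx' => X2' [] //= _ cx' [<-] [E].
  congr pair; apply: (@cancel a.1 _ _ x.1).
  - by rewrite setIC precedes_disjoint.
  - by rewrite cx /= subsetUr.
  - by rewrite cx' /= subsetUr.
  by rewrite setUC -E setUC.
move: cx cx' xa; rewrite /cut /= => /andP[/eqP-> /eqP->] /andP[/eqP-> /eqP[<-]] /= xa.
rewrite !merge_apexl => -[<-] [->] [/esym E e1] [->]; split=> //.
case: a1 a1' ca ca' E e1 => A1 f [A1' f'] /= ca ca' E ->; congr pair.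
apply: (@cancel X1 _ _ a.1).
- exact: precedes_disjoint.
- by have /andP[] := cut_subset ca.
- by have /andP[] := cut_subset ca'.
exact: E.
Qed.

End Cuts.

(** * Merging a list of factors *)

Section Families.
Variables (N n : nat).
Implicit Types (a b c : 'I_n.+1 -> cface N) (l : seq 'I_n.+1) (x y : cface N).

(** The iterated splitting of Xi starts with the last factor of the join; its
    transpose therefore merges from the left. *)
Definition merge_along c l : option (cface N) :=
  foldl (fun o i => obind (fun x => cone_merge x (c i)) o) (Some apex) l.

Lemma merge_along_rcons c l i :
  merge_along c (rcons l i) = obind (fun x => cone_merge x (c i)) (merge_along c l).
Proof. exact: foldl_rcons. Qed.

Lemma eq_in_merge_along a b l :
  {in l, a =1 b} -> merge_along a l = merge_along b l.
Proof.
elim/last_ind: l => [//|l i IH] ab; rewrite !merge_along_rcons IH.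
  by rewrite ab // mem_rcons mem_head.
by move=> k kl; apply: ab; rewrite mem_rcons inE kl orbT.
Qed.

Definition increasing l : bool := pairwise (fun i j : 'I_n.+1 => (i < j)%N) l.

Definition ordered c : Prop :=
  forall i j : 'I_n.+1, (i < j)%N -> precedes (c i).1 (c j).1.

Lemma increasing_rcons l i :
  increasing (rcons l i) = all (fun k : 'I_n.+1 => (k < i)%N) l && increasing l.
Proof. exact: pairwise_rcons. Qed.

Lemma merge_along_mem c l x u : merge_along c l = Some x -> u \in x.1 ->
  exists2 i, i \in l & u \in (c i).1.
Proof.
elim/last_ind: l x => [|l i IH] x; first by move=> [<-]; rewrite inE.
rewrite merge_along_rcons; case E: merge_along => [y|] //= /merge_sub/fintype.subsetP xy ux.
move: (xy _ ux); rewrite inE => /orP[uy|ui]; last first.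
  by exists i; rewrite // mem_rcons mem_head.
by have [k kl uk] := IH y E uy; exists k; rewrite // mem_rcons inE kl orbT.
Qed.

Lemma merge_along_precedes c l i x : ordered c -> increasing (rcons l i) ->
  merge_along c l = Some x -> precedes x.1 (c i).1.
Proof.
rewrite increasing_rcons => oc /andP[/allP li _] /merge_along_mem xl u v.
by move=> /xl[k kl uk]; apply: (oc k i) => //; exact: li.
Qed.

Lemma merge_along_neq_no_face c l x : {in l, forall i, c i != no_face} ->
  merge_along c l = Some x -> x != no_face.
Proof.
elim/last_ind: l x => [|l i IH] x c0.
  by move=> [<-]; rewrite xpair_eqE andbF.
rewrite merge_along_rcons; case E: merge_along => [y|] //=; apply: merge_neq_no_face.
  by apply: (IH y _ E) => k kl; apply: c0; rewrite mem_rcons inE kl orbT.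
by apply: c0; rewrite mem_rcons mem_head.
Qed.

Lemma ordered_subset b c : ordered c -> (forall i, (b i).1 \subset (c i).1) ->
  ordered b.
Proof.
move=> oc bc i j ij u v ui vj.
by apply: (oc i j) => //; apply: (fintype.subsetP (bc _)).
Qed.

Lemma merge_along_cdim c l x : ordered c -> {in l, forall i, c i != no_face} ->
    increasing l -> merge_along c l = Some x ->
  cdim x = (\sum_(i <- l) cdim (c i))%N.
Proof.
move=> oc; elim/last_ind: l x => [|l i IH] x c0 inc.
  by move=> [<-]; rewrite big_nil cdimE nverts_cone cards0.
rewrite merge_along_rcons; case E: merge_along => [y|] //=.
have c0l : {in l, forall i, c i != no_face}.
  by move=> k kl; apply: c0; rewrite mem_rcons inE kl orbT.
move=> /cdim_merge ->; last first.
- by apply: c0; rewrite mem_rcons mem_head.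
- exact: merge_along_neq_no_face E.
- exact: merge_along_precedes E.
rewrite (IH y) //; first by rewrite big_rcons.
by move: inc; rewrite increasing_rcons => /andP[].
Qed.

Definition cut_along l a b c : Prop := {in l, forall i, cut (a i) (b i) (c i)}.

Lemma cut_along_rcons l i a b c :
  cut_along (rcons l i) a b c <-> cut_along l a b c /\ cut (a i) (b i) (c i).
Proof.
split=> [h|[h hi] k].
  by split=> [k kl|]; apply: h; rewrite mem_rcons ?mem_head // inE kl orbT.
by rewrite mem_rcons inE => /orP[/eqP ->|/h].
Qed.

Lemma merge_along_cut a b c l y1 y2 : ordered c -> increasing l ->
    cut_along l a b c -> merge_along a l = Some y1 -> merge_along b l = Some y2 ->
  exists2 y, merge_along c l = Some y & cut y1 y2 y.
Proof.
move=> oc; elim/last_ind: l y1 y2 => [|l i IH] y1 y2 inc.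
  by move=> _ [<-] [<-]; exists apex => //; exact/cutP/CutApex.
move=> /cut_along_rcons[cl ci]; rewrite !merge_along_rcons.
case E1: (merge_along a l) => [x1|] //= m1; case E2: (merge_along b l) => [x2|] //= m2.
have incl : increasing l by move: inc; rewrite increasing_rcons => /andP[].
have [x Ex cx] := IH _ _ incl cl E1 E2.
rewrite Ex; exact: (merge_cut (merge_along_precedes oc inc Ex) cx ci m1 m2).
Qed.

(** The lift of a cut of the merged face; the values outside l are arbitrary. *)
Lemma merge_along_cut_exists c l y1 y2 y : ordered c -> increasing l ->
    {in l, forall i, c i != no_face} -> merge_along c l = Some y -> cut y1 y2 y ->
  exists a b, [/\ cut_along l a b c, merge_along a l = Some y1
    & merge_along b l = Some y2].
Proof.
move=> oc; elim/last_ind: l y1 y2 y => [|l i IH] y1 y2 y inc c0.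
  case=> <- /cutP; move E: apex => z cz; case: cz E => [A [<-]|A B e u uA _ _ _ [/setP/(_ u)]].
    by exists c, c; split=> // k.
  by rewrite !inE uA.
rewrite merge_along_rcons; case Ex: merge_along => [x|] //= m cy.
have xi := merge_along_precedes oc inc Ex.
have ci0 : c i != no_face by apply: c0; rewrite mem_rcons mem_head.
have [x1 [x2 [a1 [a2 [cx ca m1 m2]]]]] := merge_cut_exists xi ci0 m cy.
move: inc; rewrite increasing_rcons => /andP[/allP li incl].
have c0l : {in l, forall i, c i != no_face}.
  by move=> k kl; apply: c0; rewrite mem_rcons inE kl orbT.
have [a [b [cab Ea Eb]]] := IH _ _ _ incl c0l Ex cx.
have il k : k \in l -> (k == i) = false.
  by move=> /li; apply: contraTF => /eqP ->; rewrite ltnn.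
exists (fun k => if k == i then a1 else a k), (fun k => if k == i then a2 else b k).
split; first (apply/cut_along_rcons; split; last by rewrite eqxx).
- by move=> k kl; rewrite il //; exact: cab.
- rewrite merge_along_rcons eqxx (@eq_in_merge_along _ a) ?Ea // => k kl.
  by rewrite il.
- rewrite merge_along_rcons eqxx (@eq_in_merge_along _ b) ?Eb // => k kl.
  by rewrite il.
Qed.

Lemma merge_along_cut_uniq a b a' b' c l y1 y2 : ordered c -> increasing l ->
    cut_along l a b c -> cut_along l a' b' c ->
    merge_along a l = Some y1 -> merge_along b l = Some y2 ->
    merge_along a' l = Some y1 -> merge_along b' l = Some y2 ->
  {in l, forall i, a i = a' i /\ b i = b' i}.
Proof.
move=> oc; elim/last_ind: l y1 y2 => [//|l i IH] y1 y2 inc.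
move=> /cut_along_rcons[cl ci] /cut_along_rcons[cl' ci']; rewrite !merge_along_rcons.
case E1: (merge_along a l) => [x1|] //= m1; case E2: (merge_along b l) => [x2|] //= m2.
case E1': (merge_along a' l) => [x1'|] //= m1'; case E2': (merge_along b' l) => [x2'|] //= m2'.
have incl : increasing l by move: inc; rewrite increasing_rcons => /andP[].
have [x Ex cx] := merge_along_cut oc incl cl E1 E2.
have [x' Ex' cx'] := merge_along_cut oc incl cl' E1' E2'.
move: Ex' cx'; rewrite Ex => -[<-] cx'.
have xi := merge_along_precedes oc inc Ex.
have [e1 e2 ei1 ei2] := merge_cut_uniq xi cx ci cx' ci' m1 m2 m1' m2'.
move=> k; rewrite mem_rcons inE => /orP[/eqP -> //|kl].
by apply: (IH x1 x2) => //; rewrite ?E1' ?E2' ?e1 ?e2.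
Qed.

(** The exponent of the sign that moves each factor of degree f i across the
    earlier factors of degrees g k. *)
Definition pair_sum l (f g : 'I_n.+1 -> nat) : nat :=
  (\sum_(i <- l) \sum_(k <- l | (k < i)%N) f i * g k)%N.

Lemma sum_lt_rcons l i (f : 'I_n.+1 -> nat) : increasing (rcons l i) ->
  {in l, forall j : 'I_n.+1, (\sum_(k <- rcons l i | (k < j)%N) f k =
                   \sum_(k <- l | (k < j)%N) f k)%N}.
Proof.
rewrite increasing_rcons => /andP[/allP li _] j jl.
by rewrite -cats1 big_cat /= big_cons big_nil ltnNge ltnW ?li ?addn0.
Qed.

Lemma sum_lt_last l i (f : 'I_n.+1 -> nat) : increasing (rcons l i) ->
  (\sum_(k <- rcons l i | (k < i)%N) f k = \sum_(k <- l) f k)%N.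
Proof.
rewrite increasing_rcons => /andP[/allP li _].
rewrite -cats1 big_cat /= big_cons big_nil ltnn addn0 big_seq_cond [RHS]big_seq.
by apply: eq_bigl => k; case kl : (k \in l) => //=; rewrite li.
Qed.

Lemma pair_sum_rcons l i f g : increasing (rcons l i) ->
  pair_sum (rcons l i) f g = (pair_sum l f g + f i * \sum_(k <- l) g k)%N.
Proof.
move=> inc; rewrite /pair_sum big_rcons /= sum_lt_last // big_distrr /=.
congr (_ + _)%N; apply: eq_big_seq => k kl.
by rewrite -!big_distrr /= sum_lt_rcons.
Qed.

(** No signs arise inside a block from cuts that survive merging, by
    [merge_cut_cdim]. *)
Lemma pair_sum_cut a b c l y1 y2 : ordered c -> increasing l ->
    cut_along l a b c -> merge_along a l = Some y1 -> merge_along b l = Some y2 ->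
  pair_sum l (fun i => cdim (a i)) (fun i => cdim (b i)) = 0%N.
Proof.
move=> oc; elim/last_ind: l y1 y2 => [|l i IH] y1 y2 inc.
  by move=> *; rewrite /pair_sum big_nil.
move=> /cut_along_rcons[cl ci]; rewrite !merge_along_rcons.
case E1: (merge_along a l) => [x1|] //= m1; case E2: (merge_along b l) => [x2|] //= m2.
have incl : increasing l by move: inc; rewrite increasing_rcons => /andP[].
have [x Ex cx] := merge_along_cut oc incl cl E1 E2.
rewrite pair_sum_rcons // (IH _ _ incl cl E1 E2) add0n mulnC.
apply: etrans (merge_cut_cdim cx m1); congr (_ * _)%N.
pose b' k := if k \in l then b k else apex.
have bb' : {in l, b =1 b'} by move=> k kl; rewrite /b' kl.
rewrite (eq_in_merge_along bb') in E2.
rewrite (merge_along_cdim _ _ _ E2) //; first by apply: eq_big_seq => k /bb' ->.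
- apply: ordered_subset oc _ => k; rewrite /b'; case: ifP => [kl|_]; last exact: sub0set.
  by have /andP[] := cut_subset (cl k kl).
- by move=> k kl; rewrite -bb' //; have [] := cut_nonempty (cl k kl).
Qed.

Section Boundary.
Variable R : comPzRingType.
Implicit Types phi psi : cface N -> R.

Definition replace_at c i x : {ffun 'I_n.+1 -> cface N} :=
  [ffun k => if k == i then x else c k].

Lemma eq_boundary_sum phi psi y : phi =1 psi -> boundary_sum phi y = boundary_sum psi y.
Proof.
move=> e; rewrite /boundary_sum e; congr (_ + _).
by apply: eq_bigr => v _; rewrite e.
Qed.

Lemma boundary_sum0 y : boundary_sum (fun=> 0 : R) y = 0.
Proof.
rewrite /boundary_sum big1 => [|v _]; last by rewrite mulr0.
by rewrite mulr0 if_same addr0.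
Qed.

(** The boundary of the tensor product of the factors in l, on which the terms are
    indexed by the factor c i that is replaced by a face y of codimension 1. *)
Lemma merge_along_boundary phi c l : ordered c ->
    {in l, forall i, c i != no_face} -> increasing l ->
  \sum_(i <- l) sgn R (\sum_(k <- l | (k < i)%N) cdim (c k)) *
    boundary_sum
      (reduced (fun x => oapp (reduced phi) 0 (merge_along (replace_at c i x) l))) (c i)
  = oapp (boundary_sum (reduced phi)) 0 (merge_along c l).
Proof.
move=> oc; elim/last_ind: l phi => [|l i IH] phi c0 inc.
  rewrite big_nil /boundary_sum /= big_set0 cards0 add0r /reduced eqxx.
  by rewrite mulr0.
have c0l : {in l, forall i, c i != no_face}.
  by move=> k kl; apply: c0; rewrite mem_rcons inE kl orbT.
have ci0 : c i != no_face by apply: c0; rewrite mem_rcons mem_head.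
have [/allP li incl] : all (fun k : 'I_n.+1 => (k < i)%N) l /\ increasing l.
  by apply/andP; rewrite -increasing_rcons.
have il k : k \in l -> (i == k) = false.
  by move=> /li; apply: contraTF => /eqP ->; rewrite ltnn.
pose psi x := oapp (reduced phi) 0 (cone_merge x (c i)).
rewrite big_rcons /= sum_lt_last // merge_along_rcons.
have -> : \sum_(j <- l) sgn R (\sum_(k <- rcons l i | (k < j)%N) cdim (c k)) *
    boundary_sum (reduced (fun x => oapp (reduced phi) 0
      (merge_along (replace_at c j x) (rcons l i)))) (c j)
  = oapp (boundary_sum (reduced psi)) 0 (merge_along c l).
  rewrite -IH //; apply: eq_big_seq => j jl; rewrite sum_lt_rcons //; congr (_ * _).
  apply: eq_boundary_sum => x; rewrite /reduced; case: eqP => // /eqP x0.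
  rewrite merge_along_rcons [replace_at c j x i]ffunE il //.
  case E: (merge_along _ l) => [y|] //=.
  suff /negbTE -> : y != no_face by [].
  apply: merge_along_neq_no_face E => k kl; rewrite ffunE.
  by case: ifP => // _; exact: c0l.
have -> : boundary_sum (reduced (fun x => oapp (reduced phi) 0
      (merge_along (replace_at c i x) (rcons l i)))) (c i)
  = boundary_sum (reduced (fun x => oapp (reduced phi) 0
      (obind (fun y => cone_merge y x) (merge_along c l)))) (c i).
  apply: eq_boundary_sum => x; rewrite /reduced; case: eqP => // _.
  rewrite merge_along_rcons ffunE eqxx (@eq_in_merge_along _ c) // => k kl.
  by rewrite ffunE eq_sym il.
case E: (merge_along c l) => [x|] /=; last first.
  by rewrite add0r (@eq_boundary_sum _ (fun=> 0)) ?boundary_sum0 ?mulr0 // => x;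
    rewrite /reduced if_same.
rewrite -(merge_along_cdim oc c0l incl E).
by apply: boundary_merge => //; [exact: merge_along_precedes E|exact: merge_along_neq_no_face E].
Qed.

End Boundary.

End Families.

(** * The iterated map Xi *)

Section IteratedXi.
Variables (R : comPzRingType) (N n : nat).
Implicit Types (a b c x y : cface N) (E F X A : {set 'I_N}) (l : seq 'I_n.+1).

Lemma setI_precedes E0 E1 X A : precedes E0 E1 ->
  X \subset E0 -> A \subset E1 -> (X :|: A) :&: E0 = X /\ (X :|: A) :&: E1 = A.
Proof.
move=> /precedes_disjoint E01 XE AE.
split; apply/setP => v; have /setP/(_ v) := E01; rewrite !inE;
  have := fintype.subsetP AE v; have := fintype.subsetP XE v;
  case: (v \in X) => [/(_ isT) ->|_]; case: (v \in A) => [/(_ isT) ->|_] //=;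
  by rewrite ?andbT.
Qed.

(** The two terms of Xi on faces of the base, the apex and the vertices of the
    second simplex, are the points of the second cone. *)
Lemma Xi_merge E0 E1 b x a : precedes E0 E1 -> b.1 \subset E0 :|: E1 ->
    x.1 \subset E0 -> a.1 \subset E1 -> a != no_face ->
  Xi R E0 E1 b x a = sgn R (cdim x * cdim a) * (cone_merge x a == Some b)%:R.
Proof.
move=> E01 bE xE aE a0; have dE := precedes_disjoint E01; rewrite /Xi.
have bE0 : b.1 :&: E0 :|: b.1 :&: E1 = b.1 by rewrite -setIUr; apply/setIidPl.
case: ifP => b1.
  rewrite (_ : _ && _ = (cone_merge x a == Some b)).
    case: eqP => [ab|]; last by rewrite !mulr0.
    move: ab b1; rewrite /cone_merge; case: x xE => X [] /= xE; last first.
      case: ifP => // _ [<-] /=; rewrite (_ : X :&: E1 = set0) ?eqxx //.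
      by apply/eqP; rewrite -subset0 -dE setSI.
    by move=> [<-] /= _; have [-> ->] := setI_precedes E01 xE aE; rewrite -surjective_pairing.
  apply/andP/eqP => [[/eqP -> /eqP ->]|].
    by rewrite /cone_merge /= bE0 -surjective_pairing.
  move: b1; rewrite /cone_merge; case: x xE => X [] /= xE b1; last first.
    case: ifP => // _ [E]; move: b1; rewrite -E /=.
    rewrite (_ : X :&: E1 = set0) ?eqxx //.
    by apply/eqP; rewrite -subset0 -dE setSI.
  by move=> [<-] /=; have [-> ->] := setI_precedes E01 xE aE; rewrite -surjective_pairing !eqxx.
move: b1 => /negbFE/eqP[b1 b2].
have {}bE0 : b.1 :&: E0 = b.1 by rewrite -[RHS]bE0 b1 setU0.
rewrite bE0.
have -> : (a == apex)%:R + \sum_(e in E1) (a == ([set e], false))%:R = (is_point a)%:R :> R.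
  case: a aE a0 => A [] /= aE a0.
    rewrite big1 => [|e _]; last by rewrite xpair_eqE andbF.
    by rewrite addr0 /is_point nverts_cone eqSS cards_eq0 xpair_eqE andbT.
  rewrite xpair_eqE andbF add0r /is_point nverts_base.
  have [/cards1P[v Av]|A1] := boolP (#|A| == 1%N).
    rewrite (bigD1 v) /=; last by move: aE; rewrite Av sub1set.
    rewrite Av eqxx big1 ?addr0 // => e /andP[_ ev].
    by rewrite xpair_eqE andbT (inj_eq set1_inj) eq_sym (negbTE ev).
  rewrite big1 // => e _; rewrite xpair_eqE andbT; case: eqP => // Ae.
  by rewrite Ae cards1 in A1.
rewrite /cone_merge; case: x xE => X [] /= xE.
  rewrite xpair_eqE andbF mul0r; case: eqP => [[E]|]; last by rewrite mulr0.
  case: a aE a0 E => A e /= aE a0; case: b b1 b2 {bE bE0} => B f /= b1 -> [BE eF].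
  suff A0 : A = set0 by rewrite A0 eF eqxx in a0.
  by have [_ <-] := setI_precedes E01 xE aE; rewrite BE.
rewrite xpair_eqE andbT; have [/eqP pa|_] := boolP (is_point a); last by rewrite !mulr0.
rewrite [cdim a]cdimE pa muln0 /sgn expr0 mul1r mulr1.
by case: b b2 {bE b1 bE0} => B f /= ->; rewrite (inj_eq Some_inj) xpair_eqE andbT.
Qed.

Lemma Xi_support E0 E1 b x a : ~~ (x.1 \subset E0) -> Xi R E0 E1 b x a = 0.
Proof.
move=> xE; rewrite /Xi.
have xb e : (x == (b.1 :&: E0, e)) = false.
  by apply/negbTE; apply: contraNneq xE => ->; rewrite subsetIr.
by rewrite !xb /= mulr0 mul0r if_same.
Qed.

Lemma Xi_iter_merge_along (E : 'I_n.+1 -> {set 'I_N}) (a : 'I_n.+1 -> cface N) l b :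
    (forall i j : 'I_n.+1, (i < j)%N -> precedes (E i) (E j)) ->
    (forall i, (a i).1 \subset E i) -> (forall i, a i != no_face) ->
    increasing l -> b.1 \subset \bigcup_(i <- l) E i ->
  Xi_iter R (rev [seq (E i, a i) | i <- l]) b =
  sgn R (pair_sum l (fun i => cdim (a i)) (fun i => cdim (a i)))
  * (merge_along a l == Some b)%:R.
Proof.
move=> oE aE a0; have oa : ordered a.
  move=> i j ij u v ui vj.
  by apply: (oE i j) => //; [exact: (fintype.subsetP (aE i)) | exact: (fintype.subsetP (aE j))].
elim/last_ind: l b => [|l i IH] b inc bE.
  by rewrite /pair_sum big_nil /= /sgn expr0 mul1r (inj_eq Some_inj) eq_sym.
have [/allP li incl] : all (fun k : 'I_n.+1 => (k < i)%N) l /\ increasing l.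
  by apply/andP; rewrite -increasing_rcons.
rewrite map_rcons rev_rcons merge_along_rcons pair_sum_rcons //=.
case El: (rev _) => [|p s]; last rewrite -El.
  have /nilP -> : nilp l by rewrite /nilp -(size_map (fun i => (E i, a i))) -size_rev El.
  rewrite /pair_sum !big_nil muln0 /sgn expr0 mul1r [merge_along _ _]/= /= merge_apexl.
  by rewrite (inj_eq Some_inj) eq_sym.
set E0 := \bigcup_(p <- _) _.
have E0E : E0 = \bigcup_(k <- l) E k.
  by rewrite /E0 (perm_big _ (permEl (perm_rev _))) big_map.
have E0i : precedes E0 (E i).
  move=> u v; rewrite E0E bigcup_seq => /bigcupP[k kl uk] vi.
  by apply: (oE k i) => //; exact: li.
have aE0 x : merge_along a l = Some x -> x.1 \subset E0.
  move=> Ex; apply/fintype.subsetP => u /(merge_along_mem Ex)[k kl uk].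
  by rewrite E0E bigcup_seq; apply/bigcupP; exists k => //; exact: (fintype.subsetP (aE k)).
(* Xi only involves faces of E0, and there at most one of them contributes by
   the induction hypothesis *)
rewrite (bigID (fun x : cface N => x.1 \subset E0)) /= addrC big1 ?add0r; last first.
  by move=> x xE; rewrite Xi_support ?mul0r.
have bE' : b.1 \subset E0 :|: E i by move: bE; rewrite big_rcons /= -E0E.
under eq_bigr => x xE do rewrite IH // -?E0E // Xi_merge //.
case Ex: (merge_along a l) => [x|] /=; last first.
  rewrite big1 ?mulr0 // => x _; by rewrite !mulr0.
rewrite (bigD1 x) /=; last exact: aE0.
rewrite eqxx mulr1 big1 ?addr0; last first.
  by move=> y /andP[_ /negbTE yx]; rewrite (inj_eq Some_inj) [x == y]eq_sym yx !mulr0.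
rewrite (merge_along_cdim oa _ incl Ex) // sgnD mulnC.
by rewrite mulrC mulrA.
Qed.
End IteratedXi.

(** * Blocks of a coarser join decomposition *)

Section Blocks.
Variables (N n m : nat).
Implicit Types (i : 'I_n.+1) (j : 'I_m.+1).

(** What the levels of a simplex and of its image under a stratified map satisfy:
    h' is constant on the fibres of h and monotone in h, and the last factor for h
    is nonempty and contained in the last factor for h'. *)
Record coarser (h : {ffun 'I_N -> 'I_n.+1}) (h' : {ffun 'I_N -> 'I_m.+1}) : Prop :=
  Coarser {
    coarser_mono : {homo h : u v / (u <= v)%N};
    coarser_le : forall u v, (h u <= h v)%N -> (h' u <= h' v)%N;
    coarser_top : exists v, h v = ord_max;
    coarser_regular : forall v, h v = ord_max -> h' v = ord_max
  }.

Variables (h : {ffun 'I_N -> 'I_n.+1}) (h' : {ffun 'I_N -> 'I_m.+1}).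

(** The index of the block containing i: an empty factor is attached to the block
    of the next vertex. The default [ord_max] is itself a candidate, because the
    last factor is nonempty. *)
Definition block_index (i : 'I_n.+1) : 'I_m.+1 :=
  [arg min_(j < ord_max | [exists v, (h' v == j) && (i <= h v)%N]) j].

Hypothesis hh' : coarser h h'.

Lemma block_index_spec i :
  (exists2 v, h' v = block_index i & (i <= h v)%N) /\
  (forall v, (i <= h v)%N -> (block_index i <= h' v)%N).
Proof.
rewrite /block_index; have [v0 v0n] := coarser_top hh'.
case: arg_minnP => [|j /existsP[v /andP[/eqP vj iv]] jmin].
  apply/existsP; exists v0; rewrite v0n -ltnS ltn_ord andbT.
  by rewrite (coarser_regular hh' v0n).
split=> [|u iu]; first by exists v.
by apply: jmin; apply/existsP; exists u; rewrite eqxx.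
Qed.

Lemma mem_block i j : (i \in block h h' j) = (block_index i == j).
Proof.
have [[v vi iv] imin] := block_index_spec i.
rewrite mem_filter mem_enum andbT.
apply/andP/eqP => [[/existsP[u /andP[/eqP uj iu]] /forallP below]|<-].
  apply/val_inj/anti_leq; rewrite /= -{1}uj imin //= leqNgt; apply/negP => lt.
  by have /implyP := below v; rewrite vi => /(_ lt); rewrite ltnNge iv.
split; first by apply/existsP; exists v; rewrite vi eqxx.
apply/forallP => u; apply/implyP; apply: contraTT; rewrite -!leqNgt.
exact: imin.
Qed.

Lemma block_index_mono i i' : (i <= i')%N -> (block_index i <= block_index i')%N.
Proof.
move=> ii'; have [_ imin] := block_index_spec i.
have [[v <- iv] _] := block_index_spec i'.
by apply: imin; exact: leq_trans iv.
Qed.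

Lemma block_index_level v : block_index (h v) = h' v.
Proof.
have [[u ui iu] imin] := block_index_spec (h v).
apply/val_inj/anti_leq; rewrite /= imin //= -ui.
exact: (coarser_le hh').
Qed.

Lemma block_index_max : block_index ord_max = ord_max.
Proof.
have [v vn] := coarser_top hh'; rewrite -{1}vn block_index_level.
exact: (coarser_regular hh').
Qed.

Lemma block_increasing j : increasing (block h h' j).
Proof.
apply: pairwise_filter; rewrite -(pairwise_map val ltn) val_enum_ord.
by rewrite -sorted_pairwise ?iota_ltn_sorted //; exact: ltn_trans.
Qed.

Lemma join_factor_precedes (i j : 'I_n.+1) : (i < j)%N ->
  precedes (join_factor h i) (join_factor h j).
Proof.
move=> ij u v; rewrite !inE => /eqP hu /eqP hv; rewrite ltnNge; apply/negP.
by move=> /(coarser_mono hh'); rewrite hu hv leqNgt ij.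
Qed.

Lemma bigcup_block j : \bigcup_(i <- block h h' j) join_factor h i = join_factor h' j.
Proof.
rewrite bigcup_seq; apply/setP => v; apply/bigcupP/idP => [[i]|].
  by rewrite mem_block !inE => /eqP <- /eqP <-; rewrite block_index_level.
by rewrite inE => /eqP vj; exists (h v); rewrite ?mem_block ?block_index_level ?vj // inE.
Qed.

End Blocks.

Section Comparison.
Variables (R : comPzRingType) (N n m : nat).
Variables (h : {ffun 'I_N -> 'I_n.+1}) (h' : {ffun 'I_N -> 'I_m.+1}).
Hypothesis hh' : coarser h h'.
Implicit Types a b c : {ffun 'I_n.+1 -> cface N}.

Definition mergeable (c : 'I_n.+1 -> cface N) : bool :=
  [forall j, merge_along c (block h h' j) != None].

Definition merge_blocks (c : 'I_n.+1 -> cface N) : {ffun 'I_m.+1 -> cface N} :=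
  [ffun j => odflt apex (merge_along c (block h h' j))].

Lemma merge_blocksP c j : mergeable c ->
  merge_along c (block h h' j) = Some (merge_blocks c j).
Proof. by move=> /forallP/(_ j); rewrite ffunE; case: merge_along. Qed.

Lemma mergeableP c x : mergeable c /\ merge_blocks c = x <->
  forall j, merge_along c (block h h' j) = Some (x j).
Proof.
split=> [[cm <-] j|E]; first exact: merge_blocksP.
split; first by apply/forallP => j; rewrite E.
by apply/ffunP => j; rewrite ffunE E.
Qed.

End Comparison.

(** * Signs of tensor products *)

Section TotalPair.
Variable n : nat.
Implicit Types f g : 'I_n.+1 -> nat.

Definition total_pair f g : nat :=
  (\sum_(i < n.+1) \sum_(k : 'I_n.+1 | (k < i)%N) f i * g k)%N.

Lemma eq_total_pair f f' g g' : f =1 f' -> g =1 g' -> total_pair f g = total_pair f' g'.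
Proof.
by move=> e e'; apply: eq_bigr => i _; apply: eq_bigr => k _; rewrite e e'.
Qed.

Lemma total_pairDl f f' g :
  total_pair (fun i => f i + f' i)%N g = (total_pair f g + total_pair f' g)%N.
Proof.
rewrite /total_pair -big_split; apply: eq_bigr => i _ /=.
by rewrite -big_split; apply: eq_bigr => k _; rewrite mulnDl.
Qed.

Lemma total_pairDr f g g' :
  total_pair f (fun i => g i + g' i)%N = (total_pair f g + total_pair f g')%N.
Proof.
rewrite /total_pair -big_split; apply: eq_bigr => i _ /=.
by rewrite -big_split; apply: eq_bigr => k _; rewrite mulnDr.
Qed.

Lemma total_pair_exchange f g :
  total_pair f g = (\sum_(k < n.+1) \sum_(i : 'I_n.+1 | (k < i)%N) f i * g k)%N.
Proof. by rewrite /total_pair (exchange_big_dep xpredT). Qed.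

Lemma total_pair_prod f g :
  ((\sum_i f i) * (\sum_i g i) =
   total_pair f g + total_pair g f + \sum_i f i * g i)%N.
Proof.
rewrite big_distrl /= [total_pair g f]total_pair_exchange -!big_split /=.
apply: eq_bigr => i _; rewrite big_distrr /= (bigID (fun k : 'I_n.+1 => (k < i)%N)) /=.
rewrite -addnA; congr (_ + _)%N; rewrite (bigD1 i) /= ?ltnn // addnC; congr (_ + _)%N.
apply: eq_big => [k|k _]; last by rewrite mulnC.
by rewrite -leqNgt [(i < k)%N]ltn_neqAle -(inj_eq val_inj) eq_sym andbC.
Qed.

(** The change of the exponent of [twist] when the degree of the factor i grows by
    1: the new factor of degree 1 is moved across all the others. *)
Lemma total_pair_bump f g i : (forall k, g k = f k + (k == i))%N ->
  total_pair g g = (total_pair f f + \sum_(k | k != i) f k)%N.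
Proof.
move=> gE; pose d k : nat := (k == i).
rewrite (@eq_total_pair g (fun k => f k + d k)%N g (fun k => f k + d k)%N) //.
have sd (F : 'I_n.+1 -> nat) (P : pred 'I_n.+1) :
    (\sum_(k | P k) d k * F k = if P i then F i else 0)%N.
  rewrite (bigID (pred1 i)) /= [X in (_ + X)%N]big1 ?addn0; last first.
    by move=> k /andP[_ /negbTE ki]; rewrite /d ki.
  case: ifP => Pi; last by rewrite big1 // => k /andP[Pk /eqP ki]; rewrite -ki Pk in Pi.
  by rewrite (big_pred1 i) /= ?/d ?eqxx ?mul1n // => k /=; case: eqP => [->|]; rewrite ?Pi ?andbF.
rewrite !total_pairDl !total_pairDr -addnA; congr (_ + _)%N.
have -> : total_pair d d = 0%N.
  rewrite /total_pair; under eq_bigr do rewrite -big_distrr /=.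
  rewrite sd /= big1 // => k; rewrite /d; case: eqP => // ->; by rewrite ltnn.
have -> : total_pair d f = (\sum_(k : 'I_n.+1 | (k < i)%N) f k)%N.
  by rewrite /total_pair; under eq_bigr do rewrite -big_distrr /=; rewrite sd.
have -> : total_pair f d = (\sum_(k : 'I_n.+1 | (i < k)%N) f k)%N.
  rewrite total_pair_exchange.
  under eq_bigr do [under eq_bigr do rewrite mulnC; rewrite -big_distrr /=].
  by rewrite sd.
rewrite addn0 [RHS](bigID (fun k : 'I_n.+1 => (k < i)%N)) /= addnC; congr (_ + _)%N.
  by apply: eq_bigl => k; rewrite -(inj_eq val_inj) neq_ltn; case: ltngtP.
by apply: eq_bigl => k; rewrite -(inj_eq val_inj) neq_ltn; case: ltngtP.
Qed.

End TotalPair.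

(** * Differential and products in the rescaled basis *)

Section Rescaling.
Variables (R : comPzRingType) (N n : nat) (h : {ffun 'I_N -> 'I_n.+1}).
Implicit Types (w e : blowup_cochain R h) (a b x y c : {ffun 'I_n.+1 -> cface N}).

(** Extension by 0 to all families, so that the coordinates of a family may be
    changed without proving that it remains a face. *)
Definition extend w x : R := oapp w 0 (insub x).

Lemma extend_val w (a : blowup_face h) : extend w (val a) = w a.
Proof. by rewrite /extend valK. Qed.

Lemma extend_out w x : ~~ is_blowup_face h x -> extend w x = 0.
Proof. by move=> hx; rewrite /extend insubF //; exact/negbTE. Qed.

Lemma sum_extend w (G : {ffun 'I_n.+1 -> cface N} -> R) :
  \sum_(a : blowup_face h) w a * G (val a) = \sum_x extend w x * G x.
Proof.
rewrite [RHS](bigID (is_blowup_face h)) /= [X in _ + X]big1 ?addr0; last first.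
  by move=> x hx; rewrite extend_out ?mul0r.
rewrite (reindex_omap (val : blowup_face h -> _) insub) /=; last first.
  by move=> x hx; rewrite insubT.
apply: eq_big => [a|a _]; first by rewrite (valP a) valK eqxx.
by rewrite extend_val.
Qed.

(** The sign between a tensor product of dual basis elements and the dual of the
    tensor product of the basis elements. *)
Definition twist x : R :=
  sgn R (total_pair (fun i => cdim (x i)) (fun i => cdim (x i))).

Definition rescaled w x : R := twist x * extend w x.

Lemma twist_rescaled w x : twist x * rescaled w x = extend w x.
Proof. by rewrite mulrA sgn_sqr mul1r. Qed.

Lemma rescaled_out w x : ~~ is_blowup_face h x -> rescaled w x = 0.
Proof. by move=> hx; rewrite /rescaled extend_out ?mulr0. Qed.

Lemma blowup_faceP x : is_blowup_face h x <->
  [/\ forall i, (x i).1 \subset join_factor h i, forall i, x i != no_face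
    & ~~ (x ord_max).2].
Proof.
split=> [/forallP H|[H1 H2 H3]].
  split=> [i|i|]; first by have /and3P[] := H i.
    by have /and3P[] := H i.
  by have /and3P[_ _ /implyP] := H ord_max; apply.
apply/forallP => i; rewrite H1 H2 /=; apply/implyP => /eqP ->; exact: H3.
Qed.

Lemma sum_replace_at (F : {ffun 'I_n.+1 -> cface N} -> R) c i :
  \sum_x F x * \prod_(j | j != i) (x j == c j)%:R = \sum_y F (replace_at c i y).
Proof.
rewrite (partition_big (fun x => x i) xpredT) //=; apply: eq_bigr => y _.
rewrite (bigD1 (replace_at c i y)) /=; last by rewrite ffunE eqxx.
rewrite big1 ?mulr1 => [|j ji]; last by rewrite ffunE (negbTE ji) eqxx.
rewrite big1 ?addr0 // => x /andP[/eqP xi xc].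
have [j ji xj] : exists2 j, j != i & x j != c j.
  apply/exists_inP; apply: contraNT xc; rewrite negb_exists_in => /forall_inP all.
  apply/eqP/ffunP => j; rewrite ffunE; case: eqP => [->//|/eqP ji].
  by apply/eqP/negbNE/all.
by rewrite (bigD1 j) //= (negbTE xj) mul0r mulr0.
Qed.

Lemma incidence_nverts (b a : cface N) : nverts b != (nverts a).+1 ->
  incidence R b a = 0.
Proof.
move=> ba; rewrite /incidence big1 ?add0r => [|v /andP[vb /eqP aE]].
  case: b ba => B [] //= ba; case: eqP => // aE; move: ba.
  by rewrite aE nverts_base nverts_cone eqxx.
move: ba; rewrite aE; case: b vb {aE} => B e /= vb.
by rewrite /nverts /= (cardsD1 v B) vb addSn eqxx.
Qed.

(** In the rescaled basis, the differential of w is, up to the global sign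
    (-1)^|c|, the value of w on the boundary of the product c of simplices, whose
    factors are replaced one at a time with the usual Leibniz sign. *)
Lemma rescaled_diff w c : is_blowup_face h c ->
  rescaled (blowup_diff w) c = sgn R (total_degree c) *
    \sum_(i < n.+1) sgn R (\sum_(k : 'I_n.+1 | (k < i)%N) cdim (c k)) *
      boundary_sum (reduced (fun y : cface N => rescaled w (replace_at c i y))) (c i).
Proof.
move=> hc; pose c' : blowup_face h := Sub c hc.
rewrite {1}/rescaled (_ : c = val c') // extend_val ffunE /=.
pose G x (i : 'I_n.+1) := sgn R (\sum_(j : 'I_n.+1 | (j < i)%N) cdim (x j)) * coboundary_coef R (x i) (c i).
rewrite (sum_extend w (fun x : {ffun 'I_n.+1 -> cface N} => \sum_(i < n.+1) G x i * \prod_(j | j != i) (x j == c j)%:R)).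
under [X in twist c * X]eq_bigr => x _ do rewrite mulr_sumr.
rewrite exchange_big !mulr_sumr; apply: eq_bigr => i _ /=.
under eq_bigr => x _ do rewrite mulrA.
rewrite sum_replace_at -incidence_sum !mulr_sumr; apply: eq_bigr => y _.
rewrite /G ffunE eqxx.
have -> : (\sum_(j < n.+1 | (j < i)%N) cdim (replace_at c i y j) =
          \sum_(j < n.+1 | (j < i)%N) cdim (c j))%N.
  by apply: eq_bigr => j ji; rewrite ffunE -(inj_eq val_inj) ltn_eqF.
rewrite /coboundary_coef /reduced; case: eqP => [->|/eqP y0].
  rewrite extend_out ?mul0r ?mulr0 //; apply/negP => /blowup_faceP[_ /(_ i) + _].
  by rewrite ffunE eqxx eqxx.
have [ciy|/incidence_nverts ->] := eqVneq (nverts (c i)) (nverts y).+1; last first.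
  by rewrite !(mul0r, mulr0).
have ci : cdim (c i) = (cdim y).+1.
  by rewrite [cdim (c i)]cdimE ciy [cdim y]cdimE; case: (nverts y) y0 (face_nonempty y) => [|k] //= ->.
rewrite -sgnS /rescaled /twist.
have -> : total_pair (fun i => cdim (c i)) (fun i => cdim (c i)) =
   (total_pair (fun k => cdim (replace_at c i y k)) (fun k => cdim (replace_at c i y k)) +
   \sum_(k | k != i) cdim (c k))%N.
  rewrite (@total_pair_bump _ (fun k => cdim (replace_at c i y k)) _ i) => [|k]; last first.
    by rewrite ffunE; case: eqP => [->|_]; rewrite ?addn0 // ci addn1.
  by congr (_ + _)%N; apply: eq_bigr => k /negbTE ki; rewrite ffunE ki.
have -> : total_degree c = (\sum_(k | k != i) cdim (c k) + (cdim y).+1)%N.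
  by rewrite /total_degree (bigD1 i) //= ci addnC.
rewrite !sgnD; ring.
Qed.

Definition cuts (a b c : {ffun 'I_n.+1 -> cface N}) : bool :=
  [forall i, cut (a i) (b i) (c i)].

Lemma cutsP a b c : reflect (forall i, cut (a i) (b i) (c i)) (cuts a b c).
Proof. exact: forallP. Qed.

Lemma prod_bool (I : finType) (P : pred I) :
  \prod_(i : I) (P i)%:R = [forall i, P i]%:R :> R.
Proof.
have [/forallP all|] := boolP [forall i, P i]; first by rewrite big1 // => i _; rewrite all.
by rewrite negb_forall => /existsP[i /negbTE Pi]; rewrite (bigD1 i) //= Pi mul0r.
Qed.

Lemma cup_coefE (a b c : cface N) :
  cup_coef R a b c = sgn R (cdim a * cdim b) * (cut a b c)%:R.
Proof.
rewrite /cup_coef /cut; case: a => A [] /=.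
  case: eqP => [->|_] /=; last by rewrite mulr0.
  by rewrite [cdim apex]cdimE nverts_cone cards0 muln0 /sgn expr0 mul1r.
by case: ifP => _ /=; rewrite ?mulr0.
Qed.

Lemma prod_sgn (I : finType) (f : I -> nat) :
  \prod_i sgn R (f i) = sgn R (\sum_i f i).
Proof. by rewrite (big_morph (sgn R) (@sgnD R) (expr0 _)). Qed.

(** In the rescaled basis, the cup product is the transpose of the diagonal of a
    product of simplices: the total sign of exchanging w and e, times the sign that
    shuffles the pairs (a_i, b_i) into (a_0, ..., a_n) and (b_0, ..., b_n). *)
Lemma rescaled_cup w e c : is_blowup_face h c ->
  rescaled (blowup_cup w e) c = \sum_(p | cuts p.1 p.2 c)
    sgn R (total_degree p.1 * total_degree p.2
      + total_pair (fun i => cdim (p.1 i)) (fun i => cdim (p.2 i)))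
    * (rescaled w p.1 * rescaled e p.2).
Proof.
move=> hc; pose c' : blowup_face h := Sub c hc.
rewrite {1}/rescaled (_ : c = val c') // extend_val ffunE /=.
pose S (x y : {ffun 'I_n.+1 -> cface N}) :=
  sgn R (total_pair (fun i => cdim (x i)) (fun i => cdim (y i)))
  * \prod_(i < n.+1) cup_coef R (x i) (y i) (c i).
transitivity (twist c * \sum_x extend w x * \sum_y extend e y * S x y).
  rewrite -(sum_extend w (fun x => \sum_y extend e y * S x y)).
  congr (_ * _); apply: eq_bigr => a _; rewrite -(sum_extend e (fun y => S (val a) y)).
  by rewrite mulr_sumr; apply: eq_bigr => b _; rewrite !mulrA.
under [X in _ * X]eq_bigr => x _ do rewrite mulr_sumr.
rewrite pair_bigA mulr_sumr [RHS]big_mkcond; apply: eq_bigr => -[a b] _ /=.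
rewrite /S; under eq_bigr => i _ do rewrite cup_coefE.
rewrite big_split /= prod_bool prod_sgn -/(cuts a b c).
case: ifP => abc; last by rewrite !mulr0.
have cE i : cdim (c i) = (cdim (a i) + cdim (b i))%N by apply: cut_cdim; move/cutsP: abc; apply.
(* expanding the degrees of c and the product of the total degrees, both signs
   have the same exponents up to even numbers *)
rewrite mulr1 -sgnD /rescaled /twist (eq_total_pair cE cE) total_pairDl !total_pairDr.
rewrite /total_degree total_pair_prod !sgnD.
set A := sgn R (total_pair _ _); set B := sgn R (total_pair _ _).
set C := sgn R (total_pair _ _); set D := sgn R (total_pair _ _).
set E := sgn R (\sum_i _); ring.
Qed.

(** The product of the cones c D_0, ..., c D_(n-1) and of D_n, as a face of
    itself. *)
Definition top_face : {ffun 'I_n.+1 -> cface N} :=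
  [ffun i : 'I_n.+1 => (join_factor h i, (i < n)%N)].

(** Capping is evaluating on the front faces of the cuts of the top face. Since
    #|D_j| is the dimension of c D_j, hence the sum of the degrees of the two faces
    of the cut, the sign of the cap product is the shuffling sign times the
    [twist] of the front face. *)
Lemma rescaled_cap w (g : blowup_face h) :
  blowup_cap w g = \sum_(x | cuts x (val g) top_face)
    sgn R (total_pair (fun i => cdim (x i)) (fun i => cdim (val g i))) * rescaled w x.
Proof.
rewrite ffunE.
pose S (x : {ffun 'I_n.+1 -> cface N}) :=
  sgn R (\sum_(j : 'I_n.+1 | (j < n)%N)
    #|join_factor h j| * \sum_(i : 'I_n.+1 | (j < i)%N) cdim (x i))
  * \prod_(i < n.+1) (if (i < n)%N
      then cone_cap_coef R (join_factor h i) (x i) (val g i)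
      else cap_coef R (join_factor h i) (x i) (val g i)).
transitivity (\sum_x extend w x * S x).
  by rewrite -(sum_extend w S); apply: eq_bigr => a _; rewrite mulrA.
rewrite [RHS]big_mkcond; apply: eq_bigr => x _.
have [/blowup_faceP[_ _ xn]|hx] := boolP (is_blowup_face h x); last first.
  by rewrite extend_out // rescaled_out // mulr0 mul0r if_same.
have [_ _ gn] := (blowup_faceP _).1 (valP g).
have -> : S x = sgn R (\sum_(j : 'I_n.+1 | (j < n)%N)
    #|join_factor h j| * \sum_(i : 'I_n.+1 | (j < i)%N) cdim (x i))
    * (cuts x (val g) top_face)%:R.
  congr (_ * _); rewrite -prod_bool; apply: eq_bigr => i _.
  rewrite ffunE /cut /cap_coef /cone_cap_coef; case: ltnP => [lt_in|ni] /=.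
    rewrite ![(_, true) == _]eq_sym; case: (x i) => X [] /=.
      by rewrite xpair_eqE andbT andbC.
    by rewrite xpair_eqE eqb_id.
  have -> : i = ord_max by apply/val_inj/anti_leq; rewrite /= ni -ltnS ltn_ord.
  case: (x ord_max) xn => X [] //= _.
  by rewrite [(_, false) == _]eq_sym xpair_eqE eqbF_neg.
case: ifP => xg; last by rewrite !mulr0.
rewrite mulr1 /rescaled mulrA mulrC; congr (_ * _); rewrite -sgnD; congr (sgn R _).
rewrite addnC -total_pairDr total_pair_exchange big_mkcond /=; apply: eq_bigr => j _.
case: ltnP => [jn|nj]; last first.
  by rewrite big1 // => i; rewrite ltnNge (leq_trans _ nj) // -ltnS ltn_ord.
rewrite big_distrr /=; apply: eq_bigr => i _; rewrite mulnC; congr (_ * _)%N.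
move/cutsP: xg => /(_ j) /cut_cdim <-; rewrite ffunE jn cdimE nverts_cone //.
Qed.

End Rescaling.

(** * The comparison map in the rescaled basis *)

Section MergeAlong.
Variables (N n : nat).
Implicit Types (c : 'I_n.+1 -> cface N) (l : seq 'I_n.+1).

(** A factor in the base collapses all the later ones, which must be points. *)
Lemma merge_along_base c l y i0 : increasing l -> merge_along c l = Some y ->
    i0 \in l -> ~~ (c i0).2 ->
  ~~ y.2 /\ {in l, forall i : 'I_n.+1, (i0 < i)%N -> cdim (c i) = 0%N}.
Proof.
elim/last_ind: l y => [//|l i IH] y; rewrite increasing_rcons merge_along_rcons.
move=> /andP[/allP li incl]; case Ex: (merge_along c l) => [x|] //= m + ci0.
have Ei k : k \in rcons l i -> k = i \/ k \in l.
  by rewrite mem_rcons inE => /orP[/eqP|]; [left|right].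
move=> /Ei[Ei0|i0l]; move: m; rewrite /cone_merge.
  split=> [|k /Ei[->|/li kl]]; last 2 first.
  - by rewrite Ei0 ltnn.
  - by rewrite Ei0 ltnNge ltnW.
  by move: m; case: ifP => [_ [<-]|x2]; [rewrite -Ei0 | case: ifP => // _ [<-]; rewrite x2].
have [/negbTE x2 IHl] := IH x incl Ex i0l ci0.
rewrite x2; case: ifP => // /eqP pi [<-]; split; first by rewrite x2.
by move=> k /Ei[-> _|/IHl //]; rewrite cdimE pi.
Qed.

(** If only the last factor may lie in the base, then nothing is collapsed. *)
Lemma merge_along_cones c l : increasing l ->
    {in l, forall i : 'I_n.+1, (i < n)%N -> (c i).2} ->
  merge_along c l = Some (\bigcup_(i <- l) (c i).1, all (fun i => (c i).2) l).
Proof.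
elim/last_ind: l => [|l i IH]; first by rewrite big_nil.
rewrite increasing_rcons merge_along_rcons => /andP[/allP li incl] cl.
have cl' : {in l, forall i, (c i).2}.
  move=> k kl; apply: cl; first by rewrite mem_rcons inE kl orbT.
  by apply: leq_trans (li k kl) _; rewrite -ltnS ltn_ord.
rewrite IH // => [|k kl _]; last exact: cl'.
have al : all (fun i => (c i).2) l by apply/allP => k /cl'.
by rewrite al /= /cone_merge /= big_rcons all_rcons al andbT.
Qed.

End MergeAlong.

Section Comparison.
Variables (R : comPzRingType) (N n m : nat).
Variables (h : {ffun 'I_N -> 'I_n.+1}) (h' : {ffun 'I_N -> 'I_m.+1}).
Hypothesis hh' : coarser h h'.
Implicit Types (c x : {ffun 'I_n.+1 -> cface N}) (w e : blowup_cochain R h').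
Local Notation block := (block h h').
Local Notation blk := (block_index h h').
Local Notation mergeable := (mergeable h h').
Local Notation merge_blocks := (merge_blocks h h').

Lemma big_block (S : Type) (idx : S) (op : Monoid.com_law idx) (F : 'I_n.+1 -> S) P j :
  \big[op/idx]_(i <- block j | P i) F i = \big[op/idx]_(i | (blk i == j) && P i) F i.
Proof.
rewrite /Defs.block big_filter_cond big_enum_cond; apply: eq_bigl => i /=.
by have := mem_block hh' i j; rewrite mem_filter mem_enum andbT => ->.
Qed.

Lemma big_block_all (S : Type) (idx : S) (op : Monoid.com_law idx) (F : 'I_n.+1 -> S) :
  \big[op/idx]_i F i = \big[op/idx]_j \big[op/idx]_(i <- block j) F i.
Proof.
rewrite (partition_big blk xpredT) //=; apply: eq_bigr => j _.
by rewrite big_block; apply: eq_bigl => i; rewrite andbT.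
Qed.

(** The blocks are consecutive intervals, so the order of the factors is
    lexicographic. *)
Lemma ltn_block (k i : 'I_n.+1) :
  (k < i)%N = (blk k < blk i)%N || ((blk k == blk i) && (k < i)%N).
Proof.
case: (ltngtP (blk k) (blk i)) => [lt|gt|eq] /=.
- by apply: contraTT lt; rewrite -!leqNgt => /(block_index_mono hh').
- rewrite -(inj_eq val_inj) (gtn_eqF gt) /=; apply/negbTE; rewrite -leqNgt ltnW //.
  by apply: contraTT gt; rewrite -!leqNgt => /(block_index_mono hh').
- by rewrite -(inj_eq val_inj) /= eq eqxx.
Qed.

Lemma sum_lt_block (f : 'I_n.+1 -> nat) (i : 'I_n.+1) :
  (\sum_(k : 'I_n.+1 | (k < i)%N) f k =
   \sum_(j : 'I_m.+1 | (j < blk i)%N) \sum_(k <- block j) f k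
   + \sum_(k <- block (blk i) | (k < i)%N) f k)%N.
Proof.
rewrite (bigID (fun k => (blk k < blk i)%N)) /=; congr (_ + _)%N.
  rewrite (partition_big blk (fun j : 'I_m.+1 => (j < blk i)%N)) /=; last first.
    by move=> k /andP[].
  apply: eq_bigr => j ji; rewrite big_block; apply: eq_bigl => k.
  by rewrite ltn_block andbT; have [->|_] := eqVneq (blk k) j; rewrite ?ji ?andbF.
rewrite big_block; apply: eq_bigl => k; rewrite ltn_block -(inj_eq val_inj).
by case: ltngtP => //=; rewrite ?andbT.
Qed.

(** The exponent splits into the contributions inside the blocks and the exponent
    of the total degrees of the blocks. *)
Lemma total_pair_blocks (f g : 'I_n.+1 -> nat) :
  total_pair f g = (\sum_j pair_sum (block j) f g +
    total_pair (fun j => \sum_(i <- block j) f i) (fun j => \sum_(i <- block j) g i))%N.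
Proof.
rewrite /total_pair (big_block_all _ (fun i => \sum_(k < n.+1 | (k < i)%N) f i * g k)%N).
rewrite -big_split; apply: eq_bigr => j _ /=.
rewrite addnC -big_distrr /= big_distrl /= /pair_sum -big_split.
rewrite big_seq [RHS]big_seq; apply: eq_bigr => i.
rewrite mem_block // => /eqP ij; rewrite -big_distrr /= sum_lt_block mulnDr ij.
by rewrite -!big_distrr.
Qed.

Lemma face_ordered x : is_blowup_face h x -> ordered x.
Proof.
move=> /blowup_faceP[xE _ _] i j ij u v ui vj.
apply: (join_factor_precedes hh' ij).
  exact: (fintype.subsetP (xE i)).
exact: (fintype.subsetP (xE j)).
Qed.

Lemma cdim_merge_blocks x j : is_blowup_face h x -> mergeable x ->
  cdim (merge_blocks x j) = (\sum_(i <- block j) cdim (x i))%N.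
Proof.
move=> hx mx; have ox := face_ordered hx; have /blowup_faceP[_ x0 _] := hx.
by rewrite (merge_along_cdim ox _ (block_increasing h h' j) (merge_blocksP j mx)).
Qed.

Lemma total_degree_merge_blocks x : is_blowup_face h x -> mergeable x ->
  total_degree (merge_blocks x) = total_degree x.
Proof.
move=> hx mx; rewrite /total_degree [RHS]big_block_all.
by apply: eq_bigr => j _; exact: cdim_merge_blocks.
Qed.

Lemma merge_blocks_face x : is_blowup_face h x -> mergeable x ->
  is_blowup_face h' (merge_blocks x).
Proof.
move=> hx mx; have /blowup_faceP[xE x0 xn] := hx; apply/blowup_faceP; split.
- move=> j; apply/fintype.subsetP => v /(merge_along_mem (merge_blocksP j mx))[i].
  rewrite mem_block // => /eqP <- /(fintype.subsetP (xE i)); rewrite !inE => /eqP <-.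
  by rewrite block_index_level.
- by move=> j; apply: merge_along_neq_no_face (merge_blocksP j mx) => i _.
- have [] := merge_along_base (block_increasing h h' ord_max) (merge_blocksP _ mx) _ xn => //.
  by rewrite mem_block // block_index_max.
Qed.

(** The signs of the iterated maps Xi are the contributions inside the blocks to
    the twist of x; what remains of it is the twist of the merged family. *)
Lemma rescaled_comparison w x : is_blowup_face h x ->
  rescaled (blowup_comparison h w) x =
  if mergeable x then rescaled w (merge_blocks x) else 0.
Proof.
move=> hx; have /blowup_faceP[xE x0 xn] := hx.
pose x' : blowup_face h := Sub x hx.
rewrite {1}/rescaled (_ : x = val x') // extend_val ffunE /=.
pose S : R := \prod_j sgn R (pair_sum (block j) (fun i => cdim (x i)) (fun i => cdim (x i))).
pose G (y : {ffun 'I_m.+1 -> cface N}) := S * [forall j, merge_along x (block j) == Some (y j)]%:R.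
transitivity (twist R x * \sum_y extend w y * G y).
  rewrite -(sum_extend w G); congr (_ * _); apply: eq_bigr => b _; congr (_ * _).
  rewrite /G /S -prod_bool -big_split; apply: eq_bigr => j _.
  rewrite (Xi_iter_merge_along _ (join_factor_precedes hh')) ?block_increasing //.
  by rewrite (bigcup_block hh'); have /blowup_faceP[] := valP b.
have [mx|nmx] := boolP (mergeable x); last first.
  rewrite big1 ?mulr0 // => y _; rewrite /G (_ : [forall j, _] = false) ?mulr0 //.
  apply/negbTE; apply: contra nmx => /forallP xy.
  by apply/forallP => j; rewrite (eqP (xy j)).
rewrite (bigD1 (merge_blocks x)) //= big1 ?addr0; last first.
  move=> y /eqP yx; rewrite /G (_ : [forall j, _] = false) ?mulr0 //.
  apply/negbTE/negP => /forallP xy; apply: yx; apply/ffunP => j.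
  by have := eqP (xy j); rewrite (merge_blocksP j mx) => -[].
rewrite /G (_ : [forall j, _] = true); last first.
  by apply/forallP => j; rewrite (merge_blocksP j mx).
rewrite mulr1 mulrCA mulrC /rescaled; congr (_ * _).
rewrite /twist total_pair_blocks sgnD -prod_sgn -/S mulrAC.
have -> : S * S = 1 by rewrite -big_split big1 // => j _; exact: sgn_sqr.
rewrite mul1r; congr (sgn R _); apply: eq_total_pair => j;
  by rewrite cdim_merge_blocks.
Qed.

End Comparison.

(** * The comparison commutes with the differential *)

Section ChainMap.
Variables (R : comPzRingType) (N n m : nat).
Variables (h : {ffun 'I_N -> 'I_n.+1}) (h' : {ffun 'I_N -> 'I_m.+1}).
Hypothesis hh' : coarser h h'.
Implicit Types (c x : {ffun 'I_n.+1 -> cface N}) (w e : blowup_cochain R h').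
Local Notation block := (block h h').
Local Notation blk := (block_index h h').
Local Notation mergeable := (mergeable h h').
Local Notation merge_blocks := (merge_blocks h h').

Lemma eq_in_boundary_sum (phi psi : cface N -> R) (z : cface N) :
    (forall y : cface N, y.1 \subset z.1 -> (y.2 -> z.2) -> phi y = psi y) ->
  boundary_sum phi z = boundary_sum psi z.
Proof.
move=> e; rewrite /boundary_sum; congr (_ + _).
  by apply: eq_bigr => v _; rewrite e ?subsetDl.
by case: ifP => // z2; rewrite e.
Qed.

Lemma boundary_sum_zero (phi : cface N -> R) (z : cface N) : (forall y, phi y = 0) ->
  boundary_sum phi z = 0.
Proof. by move=> e; rewrite (eq_boundary_sum (psi := fun=> 0)) ?boundary_sum0. Qed.

Lemma merge_along_replace_at_out c i y j : i \notin block j ->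
  merge_along (replace_at c i y) (block j) = merge_along c (block j).
Proof.
move=> ij; apply: eq_in_merge_along => k kj; rewrite ffunE.
by case: eqP kj => // ->; rewrite (negbTE ij).
Qed.

(** Merging is a chain map. The terms where a factor of the block j is replaced
    are those of [merge_along_boundary] for this block: the other blocks do not
    change, and contribute to the Leibniz sign by their total degrees. They all
    vanish if one of the other blocks merges to 0. *)
Lemma merge_blocks_boundary (W : {ffun 'I_m.+1 -> cface N} -> R) c :
  is_blowup_face h c ->
  \sum_(i < n.+1) sgn R (\sum_(k : 'I_n.+1 | (k < i)%N) cdim (c k)) *
    boundary_sum (reduced (fun y : cface N =>
      if mergeable (replace_at c i y) then W (merge_blocks (replace_at c i y)) else 0)) (c i)
  = if mergeable c then
      \sum_(j < m.+1) sgn R (\sum_(k : 'I_m.+1 | (k < j)%N) cdim (merge_blocks c k)) *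
        boundary_sum (reduced (fun y : cface N => W (replace_at (merge_blocks c) j y)))
          (merge_blocks c j)
    else 0.
Proof.
move=> hc; have oc := face_ordered hh' hc; have /blowup_faceP[_ c0 _] := hc.
rewrite (big_block_all hh').
transitivity (\sum_(j < m.+1) if mergeable c then
  sgn R (\sum_(k : 'I_m.+1 | (k < j)%N) cdim (merge_blocks c k)) *
    boundary_sum (reduced (fun y : cface N => W (replace_at (merge_blocks c) j y)))
      (merge_blocks c j) else 0); last by case: ifP => // _; rewrite big1.
apply: eq_bigr => j _.
have rout i y j' : i \in block j -> j' != j ->
    merge_along (replace_at c i y) (block j') = merge_along c (block j').
  move=> ij j'j; apply: merge_along_replace_at_out.
  by move: ij; rewrite !mem_block // => /eqP ->; rewrite eq_sym.
have [/forallP all|] := boolP [forall j', (j' != j) ==> (merge_along c (block j') != None)];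
    last first.
  rewrite negb_forall => /existsP[j']; rewrite negb_imply negbK => /andP[j'j /eqP Ej'].
  have /negbTE -> : ~~ mergeable c.
    by rewrite negb_forall; apply/existsP; exists j'; rewrite Ej'.
  rewrite big_seq big1 // => i ij; rewrite boundary_sum_zero ?mulr0 // => y.
  rewrite /reduced (_ : mergeable _ = false) ?if_same //.
  by apply/negbTE; rewrite negb_forall; apply/existsP; exists j'; rewrite rout // Ej'.
pose phi (z : cface N) := W (replace_at (merge_blocks c) j z).
have mE i y : i \in block j -> (if mergeable (replace_at c i y)
    then W (merge_blocks (replace_at c i y)) else 0) =
    oapp phi 0 (merge_along (replace_at c i y) (block j)).
  move=> ij; case Ez: (merge_along _ (block j)) => [z|] /=; last first.
    rewrite (_ : mergeable _ = false) //.
    by apply/negbTE; rewrite negb_forall; apply/existsP; exists j; rewrite Ez.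
  have -> : mergeable (replace_at c i y).
    apply/forallP => j'; have [->|j'j] := eqVneq j' j; first by rewrite Ez.
    by rewrite rout //; have /implyP -> := all j'.
  rewrite /phi; congr W; apply/ffunP => j'; rewrite !ffunE.
  by case: eqP => [->|/eqP j'j]; [rewrite Ez | rewrite rout].
transitivity (sgn R (\sum_(j' : 'I_m.+1 | (j' < j)%N) \sum_(k <- block j') cdim (c k)) *
    oapp (boundary_sum (reduced phi)) 0 (merge_along c (block j))).
  rewrite -merge_along_boundary ?block_increasing // mulr_sumr.
  apply: eq_big_seq => i ij; rewrite (sum_lt_block hh').
  have -> : blk i = j by apply/eqP; rewrite -mem_block.
  rewrite sgnD -mulrA; congr (_ * (_ * _)); apply: eq_boundary_sum => y.
  rewrite {1 2}/reduced; case: eqP => // /eqP y0; rewrite mE //.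
  case Ez: (merge_along _ (block j)) => [z|] //=; rewrite /reduced.
  suff /negbTE -> : z != no_face by [].
  apply: merge_along_neq_no_face Ez => k _; rewrite ffunE.
  by case: ifP.
have [mc|nmc] := boolP (mergeable c); last first.
  have -> : merge_along c (block j) = None; last by rewrite mulr0.
  apply/eqP; apply: contraNT nmc => Ej; apply/forallP => j'.
  by have [->//|j'j] := eqVneq j' j; have /implyP -> := all j'.
rewrite (merge_blocksP j mc) /=; congr (sgn R _ * _).
by apply: eq_bigr => j' _; rewrite cdim_merge_blocks.
Qed.

Lemma replace_at_face c i (y : cface N) : is_blowup_face h c -> y != no_face ->
  y.1 \subset (c i).1 -> (y.2 -> (c i).2) -> is_blowup_face h (replace_at c i y).
Proof.
move=> /blowup_faceP[cE c0 cn] y0 yE y2; apply/blowup_faceP; split=> [k|k|].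
- by rewrite ffunE; case: eqP => [->|_ //]; exact: (fintype.subset_trans yE).
- by rewrite ffunE; have [_|_] := eqVneq k i.
- rewrite ffunE; have [En|//] := eqVneq _ i.
  by move: cn; rewrite En; apply: contra.
Qed.

Lemma rescaled_inj (u v : blowup_cochain R h) :
  (forall x, is_blowup_face h x -> rescaled u x = rescaled v x) -> u = v.
Proof.
move=> uv; apply/ffunP => a; rewrite -!extend_val -!twist_rescaled.
by rewrite uv ?(valP a).
Qed.

(** Merging preserves the total degree, so the global sign in [rescaled_diff] is
    the same on both sides. *)
Lemma comparison_diff w :
  blowup_comparison h (blowup_diff w) = blowup_diff (blowup_comparison h w).
Proof.
apply: rescaled_inj => c hc; rewrite (rescaled_comparison hh') // [RHS]rescaled_diff //.
transitivity (sgn R (total_degree c) *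
  \sum_(i < n.+1) sgn R (\sum_(k : 'I_n.+1 | (k < i)%N) cdim (c k)) *
    boundary_sum (reduced (fun y : cface N =>
      if mergeable (replace_at c i y) then rescaled w (merge_blocks (replace_at c i y)) else 0)) (c i)).
  rewrite (merge_blocks_boundary (rescaled w)) //; case: ifP => mc; last by rewrite mulr0.
  by rewrite rescaled_diff ?(merge_blocks_face hh') // (total_degree_merge_blocks hh').
congr (_ * _); apply: eq_bigr => i _; congr (_ * _); apply: eq_in_boundary_sum => y yE y2.
rewrite /reduced; case: eqP => // /eqP y0.
by rewrite (rescaled_comparison hh') //; apply: replace_at_face.
Qed.

End ChainMap.

(** * The comparison is multiplicative *)

Section Coproduct.
Variables (R : comPzRingType) (N n m : nat).
Variables (h : {ffun 'I_N -> 'I_n.+1}) (h' : {ffun 'I_N -> 'I_m.+1}).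
Hypothesis hh' : coarser h h'.
Implicit Types (a b c x y : {ffun 'I_n.+1 -> cface N}) (w e : blowup_cochain R h').
Local Notation block := (block h h').
Local Notation blk := (block_index h h').
Local Notation mergeable := (mergeable h h').
Local Notation merge_blocks := (merge_blocks h h').

Lemma cuts_face a b c : is_blowup_face h c -> cuts a b c ->
  is_blowup_face h a /\ is_blowup_face h b.
Proof.
move=> /blowup_faceP[cE c0 cn] /cutsP abc.
split; apply/blowup_faceP; split=> [i|i|].
- by have /andP[ac _] := cut_subset (abc i); exact: (fintype.subset_trans ac).
- by have [] := cut_nonempty (abc i).
- by have [_ ->] := cut_base (abc ord_max).
- by have /andP[_ bc] := cut_subset (abc i); exact: (fintype.subset_trans bc).
- by have [] := cut_nonempty (abc i).
- by have [-> _] := cut_base (abc ord_max).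
Qed.

Lemma merge_blocks_cuts a b c : is_blowup_face h c -> cuts a b c ->
    mergeable a -> mergeable b ->
  mergeable c && cuts (merge_blocks a) (merge_blocks b) (merge_blocks c).
Proof.
move=> hc /cutsP abc ma mb; have oc := face_ordered hh' hc.
have main j : exists2 y, merge_along c (block j) = Some y &
    cut (merge_blocks a j) (merge_blocks b j) y.
  apply: (@merge_along_cut _ _ a b) => //; [exact: block_increasing|exact: merge_blocksP..].
have mc : mergeable c by apply/forallP => j; have [y ->] := main j.
rewrite mc /=; apply/cutsP => j; have [y] := main j.
by rewrite (merge_blocksP j mc) => -[<-].
Qed.

Lemma merge_blocks_cuts_uniq a b a' b' c : is_blowup_face h c ->
    cuts a b c -> cuts a' b' c -> mergeable a -> mergeable b ->
    mergeable a' -> mergeable b' ->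
    merge_blocks a = merge_blocks a' -> merge_blocks b = merge_blocks b' ->
  a = a' /\ b = b'.
Proof.
move=> hc /cutsP ab /cutsP ab' ma mb ma' mb' Ea Eb; have oc := face_ordered hh' hc.
have E i : a i = a' i /\ b i = b' i.
  have inc := block_increasing h h' (blk i).
  apply: (merge_along_cut_uniq oc inc (a := a) (b := b) (a' := a') (b' := b')
    (y1 := merge_blocks a (blk i)) (y2 := merge_blocks b (blk i))) => //.
  - exact: merge_blocksP.
  - exact: merge_blocksP.
  - by rewrite Ea; exact: merge_blocksP.
  - by rewrite Eb; exact: merge_blocksP.
  - by rewrite mem_block.
by split; apply/ffunP => i; case: (E i).
Qed.

Lemma merge_blocks_cuts_exists c (a' b' : {ffun 'I_m.+1 -> cface N}) :
    is_blowup_face h c -> mergeable c -> cuts a' b' (merge_blocks c) ->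
  exists a b, [/\ cuts a b c, mergeable a && mergeable b,
    merge_blocks a = a' & merge_blocks b = b'].
Proof.
move=> hc mc /cutsP ab'; have oc := face_ordered hh' hc.
have /blowup_faceP[_ c0 _] := hc.
have main j : exists p : ('I_n.+1 -> cface N) * ('I_n.+1 -> cface N),
    [/\ cut_along (block j) p.1 p.2 c, merge_along p.1 (block j) = Some (a' j)
      & merge_along p.2 (block j) = Some (b' j)].
  have [a [b [Ec Ea Eb]]] := merge_along_cut_exists oc (block_increasing h h' j)
    (fun i _ => c0 i) (merge_blocksP j mc) (ab' j).
  by exists (a, b).
(* the lifts in the various blocks are glued along the partition into blocks *)
have [p pP] := fin_all_exists main.
pose a : {ffun 'I_n.+1 -> cface N} := [ffun i => (p (blk i)).1 i].
pose b : {ffun 'I_n.+1 -> cface N} := [ffun i => (p (blk i)).2 i].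
have Ea j : merge_along a (block j) = Some (a' j).
  have [_ <- _] := pP j; apply: eq_in_merge_along => i.
  by rewrite mem_block // ffunE => /eqP ->.
have Eb j : merge_along b (block j) = Some (b' j).
  have [_ _ <-] := pP j; apply: eq_in_merge_along => i.
  by rewrite mem_block // ffunE => /eqP ->.
have [ma Ma] := (mergeableP _ _ a a').2 Ea; have [mb Mb] := (mergeableP _ _ b b').2 Eb.
exists a, b; rewrite ma mb; split=> //; apply/cutsP => i; rewrite !ffunE.
by have [cp _ _] := pP (blk i); apply: cp; rewrite mem_block.
Qed.

(** Merging is a coalgebra map: each cut of the merged family comes from exactly
    one cut of c whose two parts do not merge to 0, and all such cuts occur. *)
Lemma sum_cuts_merge_blocks (V : nmodType)
    (F : {ffun 'I_m.+1 -> cface N} -> {ffun 'I_m.+1 -> cface N} -> V) c :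
  is_blowup_face h c ->
  \sum_(p | [&& cuts p.1 p.2 c, mergeable p.1 & mergeable p.2])
    F (merge_blocks p.1) (merge_blocks p.2)
  = if mergeable c then \sum_(q | cuts q.1 q.2 (merge_blocks c)) F q.1 q.2 else 0.
Proof.
move=> hc.
rewrite (partition_big (fun p : {ffun 'I_n.+1 -> cface N} * {ffun 'I_n.+1 -> cface N} => (merge_blocks p.1, merge_blocks p.2))
  (fun q => mergeable c && cuts q.1 q.2 (merge_blocks c))) /=; last first.
  by move=> p /and3P[]; exact: merge_blocks_cuts.
case: ifP => mc /=; last by rewrite big_pred0.
apply: eq_bigr => -[a' b'] /= cq.
have [a [b [ab /andP[ma mb] Ea Eb]]] := merge_blocks_cuts_exists hc mc cq.
rewrite (big_pred1 (a, b)) /= ?Ea ?Eb // => -[x y] /=.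
apply/andP/eqP => [[/and3P[xy mx my] /eqP[Ex Ey]]|[-> ->]]; last first.
  by rewrite ab ma mb Ea Eb.
have [-> ->//] := merge_blocks_cuts_uniq hc xy ab mx my ma mb (etrans Ex (esym Ea))
  (etrans Ey (esym Eb)).
Qed.

(** The shuffling sign is preserved by merging, because its contributions inside
    the blocks vanish. *)
Lemma total_pair_cuts a b c : is_blowup_face h c -> cuts a b c ->
    mergeable a -> mergeable b ->
  total_pair (fun i => cdim (a i)) (fun i => cdim (b i)) =
  total_pair (fun j => cdim (merge_blocks a j)) (fun j => cdim (merge_blocks b j)).
Proof.
move=> hc ab ma mb; have [ha hb] := cuts_face hc ab; have oc := face_ordered hh' hc.
rewrite (total_pair_blocks hh') big1 ?add0n => [|j _].
  by apply: eq_total_pair => j; rewrite cdim_merge_blocks.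
apply: (pair_sum_cut oc (block_increasing h h' j) _ (merge_blocksP j ma) (merge_blocksP j mb)).
by move=> i _; move/cutsP: ab.
Qed.

Lemma comparison_cup w e :
  blowup_comparison h (blowup_cup w e) =
  blowup_cup (blowup_comparison h w) (blowup_comparison h e).
Proof.
apply: rescaled_inj => c hc; rewrite (rescaled_comparison hh') // [RHS]rescaled_cup //.
pose F (x y : {ffun 'I_m.+1 -> cface N}) :=
  sgn R (total_degree x * total_degree y
    + total_pair (fun j => cdim (x j)) (fun j => cdim (y j))) * (rescaled w x * rescaled e y).
transitivity (if mergeable c then \sum_(q | cuts q.1 q.2 (merge_blocks c)) F q.1 q.2 else 0).
  by case: ifP => // mc; rewrite rescaled_cup // (merge_blocks_face hh').
rewrite -sum_cuts_merge_blocks // (eq_bigl (fun p : {ffun 'I_n.+1 -> cface N} * {ffun 'I_n.+1 -> cface N} => cuts p.1 p.2 c &&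
  (mergeable p.1 && mergeable p.2))) // big_mkcondr.
apply: eq_bigr => -[a b] /= ab; have [ha hb] := cuts_face hc ab.
rewrite !(rescaled_comparison hh') //; case: ifP => [/andP[ma mb]|].
  by rewrite ma mb /F /= !(total_degree_merge_blocks hh') // (total_pair_cuts hc ab).
by case: ifP => // _; case: ifP => // _ _; rewrite ?mulr0 ?mul0r ?mulr0.
Qed.

End Coproduct.

(** * The comparison and the cap product *)

Section CapSimplex.
Variables (R : comPzRingType) (N n : nat) (h : {ffun 'I_N -> 'I_n.+1}).
Hypothesis hh : coarser h h.
Implicit Types (x y : {ffun 'I_n.+1 -> cface N}) (w : blowup_cochain R h).

Lemma top_face_face : is_blowup_face h (top_face h).
Proof.
apply/blowup_faceP; split=> [i|i|]; rewrite ffunE //=; last by rewrite ltnn.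
have [//|ni] := ltnP i n; first by rewrite xpair_eqE andbF.
have [v vn] := coarser_top hh; rewrite xpair_eqE andbT; apply/set0Pn; exists v.
by rewrite inE vn; apply/eqP/val_inj/anti_leq; rewrite /= ni -ltnS ltn_ord.
Qed.

Lemma enum_increasing : increasing (enum 'I_n.+1).
Proof.
rewrite /increasing -(pairwise_map val ltn) val_enum_ord.
by rewrite -sorted_pairwise ?iota_ltn_sorted //; exact: ltn_trans.
Qed.

Lemma cuts_top_base x y (i : 'I_n.+1) : cuts x y (top_face h) -> (y i).2 = (i < n)%N.
Proof. by move=> /cutsP/(_ i)/cut_base[-> _]; rewrite ffunE. Qed.

(** A back face of the top face contains the apex of each cone, so nothing is
    collapsed by the map mu. *)
Lemma mu_face_top x y : cuts x y (top_face h) -> mu_face y = \bigcup_i (y i).1.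
Proof.
move=> xy; have -> : mu_face y = \bigcup_(i : 'I_n.+1 | (i <= first_base y)%N) (y i).1 by [].
have -> : first_base y = ord_max.
  rewrite /first_base; case: arg_minnP => [|j]; rewrite (cuts_top_base _ xy) ?ltnn //.
  by rewrite -leqNgt => nj _; apply/val_inj/anti_leq; rewrite /= nj -ltnS ltn_ord.
by apply: eq_bigl => i; rewrite -ltnS ltn_ord.
Qed.

Lemma total_degree_top x y : cuts x y (top_face h) ->
  total_degree y = #|\bigcup_i (y i).1|.-1.
Proof.
move=> xy; have [_ hy] := cuts_face top_face_face xy.
have /blowup_faceP[_ y0 _] := hy.
have My := @merge_along_cones _ _ y _ enum_increasing _.
have /merge_along_cdim := My (fun i _ => etrans (cuts_top_base i xy)).
move=> /(_ (face_ordered hh hy) (fun i _ => y0 i) enum_increasing).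
rewrite -big_enum /total_degree -big_enum /= => <-.
have -> : all (fun i => (y i).2) (enum 'I_n.+1) = false.
  apply/negbTE/allPn; exists ord_max; first by rewrite mem_enum.
  by rewrite (cuts_top_base _ xy) ltnn.
by rewrite cdimE nverts_base.
Qed.

(** The condition on degrees in the map mu holds automatically on back faces of
    the top face. *)
Lemma cap_simplexE w F : cap_simplex w F =
  \sum_(p | cuts p.1 p.2 (top_face h))
    if \bigcup_i (p.2 i).1 == F then
      sgn R (total_pair (fun i => cdim (p.1 i)) (fun i => cdim (p.2 i))) * rescaled w p.1
    else 0.
Proof.
rewrite /cap_simplex ffunE.
pose P y := (mu_face y == F) && (total_degree y == #|F|.-1).
pose H y := \sum_(x | cuts x y (top_face h))
  sgn R (total_pair (fun i => cdim (x i)) (fun i => cdim (y i))) * rescaled w x.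
transitivity (\sum_(y | is_blowup_face h y && P y) H y).
  rewrite (reindex_omap (val : blowup_face h -> _) insub) /=; last first.
    by move=> x /andP[hx _]; rewrite insubT.
  apply: eq_big => [g|g _]; last exact: rescaled_cap.
  by rewrite valK eqxx andbT (valP g).
rewrite /H (exchange_big_dep xpredT) //= pair_big_dep /= big_mkcond [RHS]big_mkcond.
apply: eq_bigr => -[x y] _ /=.
case: ifP => [/andP[/andP[hy Py] xy]|nP].
  by rewrite xy; move: Py; rewrite /P (mu_face_top xy) => /andP[->].
case: ifP => // xy; case: ifP => // Fy; move: nP.
have [_ ->] := cuts_face top_face_face xy.
by rewrite xy /P (mu_face_top xy) Fy (total_degree_top xy) (eqP Fy) eqxx.
Qed.

(** The back face of a cut of the last factor is nonempty. *)
Lemma cap_simplex_regular w F : cap_simplex w F != 0 -> exists2 v, v \in F & h v = ord_max.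
Proof.
rewrite cap_simplexE; apply: contraPP => nF; apply/negP/negPn/eqP.
apply: big1 => -[x y] /= xy; case: eqP => // FE; case: nF.
have [_ /blowup_faceP[yE y0 yn]] := cuts_face top_face_face xy.
have := y0 ord_max; have := yE ord_max; move: FE yn.
case E: (y ord_max) => [Y [] //] FE _ /= YE; rewrite xpair_eqE andbT => /set0Pn[v vY].
exists v; first by rewrite -FE; apply/bigcupP; exists ord_max; rewrite ?E.
by have := fintype.subsetP YE v vY; rewrite inE => /eqP.
Qed.

End CapSimplex.

Section Cap.
Variables (R : comPzRingType) (N n m : nat).
Variables (h : {ffun 'I_N -> 'I_n.+1}) (h' : {ffun 'I_N -> 'I_m.+1}).
Hypothesis hh' : coarser h h'.
Local Notation block := (block h h').
Local Notation mergeable := (mergeable h h').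
Local Notation merge_blocks := (merge_blocks h h').

(** The results on a single decomposition are applied to h as coarser than
    itself. *)
Lemma coarser_refl : coarser h h.
Proof.
by split=> //; [exact: (coarser_mono hh') | exact: (coarser_top hh')].
Qed.

Lemma coarser_refl_target : coarser h' h'.
Proof.
split=> //; first by move=> u v /(coarser_mono hh') /(coarser_le hh').
by have [v vn] := coarser_top hh'; exists v; exact: (coarser_regular hh').
Qed.

Lemma block_last j : all (fun i : 'I_n.+1 => (i < n)%N) (block j) = (j < m)%N.
Proof.
apply/idP/idP => [/allP all|jm].
  rewrite ltn_neqAle -[in (_ <= m)%N]ltnS ltn_ord andbT; apply/eqP => jm.
  have := all ord_max; rewrite mem_block // block_index_max // ltnn.
  have -> : j = ord_max by exact: val_inj.
  by move=> /(_ (eqxx _)).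
apply/allP => i; rewrite mem_block // => /eqP ij.
rewrite ltn_neqAle -[in (_ <= n)%N]ltnS ltn_ord andbT.
apply: contraTneq jm => iE; rewrite -ij.
have -> : i = ord_max by exact: val_inj.
by rewrite block_index_max // ltnn.
Qed.

Lemma merge_along_cut_top (x y : {ffun 'I_n.+1 -> cface N}) j : cuts x y (top_face h) ->
  merge_along y (block j) = Some (\bigcup_(i <- block j) (y i).1, (j < m)%N).
Proof.
move=> xy; rewrite merge_along_cones ?block_increasing // => [|i _ lt_in]; last first.
  by rewrite (cuts_top_base _ xy).
by rewrite -block_last; congr (Some (_, _)); apply: eq_all => i; exact: cuts_top_base xy.
Qed.

(** Only the block of [ord_max] has a factor without apex, by [block_last], and
    this factor is its last one. *)
Lemma top_face_merge_blocks : mergeable (top_face h) /\ merge_blocks (top_face h) = top_face h'.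
Proof.
apply/mergeableP => j.
rewrite merge_along_cones ?block_increasing // => [|i _ lt_in]; last by rewrite ffunE.
rewrite [top_face h' j]ffunE -block_last -(bigcup_block hh'); congr (Some (_, _)).
  by apply: eq_bigr => i _; rewrite ffunE.
by apply: eq_all => i; rewrite ffunE.
Qed.

(** Both sides are sums over cuts of top faces, and the top face for h merges to
    the top face for h'. The simplex underlying a back face is the union of its
    factors, which merging does not change. *)
Lemma comparison_cap_simplex (w : blowup_cochain R h') :
  cap_simplex (blowup_comparison h w) = cap_simplex w.
Proof.
apply/ffunP => F.
rewrite (cap_simplexE coarser_refl) (cap_simplexE coarser_refl_target).
have [mt Et] := top_face_merge_blocks.
pose G (x y : {ffun 'I_m.+1 -> cface N}) : R := if \bigcup_j (y j).1 == F then
  sgn R (total_pair (fun j => cdim (x j)) (fun j => cdim (y j))) * rescaled w x else 0.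
have ht := top_face_face coarser_refl.
transitivity (\sum_(q | cuts q.1 q.2 (merge_blocks (top_face h))) G q.1 q.2); last by rewrite Et.
have := sum_cuts_merge_blocks hh' G ht; rewrite mt => <-.
rewrite [RHS]big_mkcondr.
apply: eq_bigr => -[x y] /= xy; have [hx hy] := cuts_face ht xy.
have my : mergeable y by apply/forallP => j; rewrite (merge_along_cut_top j xy).
rewrite (rescaled_comparison hh') // my andbT.
have [mx|_] := boolP (mergeable x); last by rewrite mulr0 if_same.
rewrite /G (total_pair_cuts hh' ht xy) // (big_block_all hh').
congr (if _ == F then _ else _); apply: eq_bigr => j _.
by have := merge_along_cut_top j xy; rewrite (merge_blocksP j my) => -[->].
Qed.

End Cap.

(** * The comparison and the perverse degree *)

Section Norm.
Variables (R : comPzRingType) (N n m : nat).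
Variables (h : {ffun 'I_N -> 'I_n.+1}) (h' : {ffun 'I_N -> 'I_m.+1}).
Hypothesis hh' : coarser h h'.
Implicit Types (x : {ffun 'I_n.+1 -> cface N}).
Local Notation block := (block h h').
Local Notation blk := (block_index h h').
Local Notation mergeable := (mergeable h h').
Local Notation merge_blocks := (merge_blocks h h').

(** Inside the block of i0, the factors after i0 are points and contribute
    nothing to the degree. *)
Lemma merge_blocks_above x (i0 : 'I_n.+1) :
    is_blowup_face h x -> mergeable x -> ~~ (x i0).2 ->
  ~~ (merge_blocks x (blk i0)).2 /\
  (\sum_(i : 'I_n.+1 | (i0 < i)%N) cdim (x i) =
   \sum_(j : 'I_m.+1 | (blk i0 < j)%N) cdim (merge_blocks x j))%N.
Proof.
move=> hx mx xi0.
have [y2 x0] := merge_along_base (block_increasing h h' (blk i0))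
  (merge_blocksP (blk i0) mx) (etrans (mem_block hh' i0 _) (eqxx _)) xi0.
split=> //; rewrite (bigID (fun i => blk i0 < blk i)%N) /= [X in (_ + X)%N]big1 ?addn0.
  rewrite (partition_big blk (fun j : 'I_m.+1 => (blk i0 < j)%N)) /=; last first.
    by move=> i /andP[].
  apply: eq_bigr => j ji; rewrite cdim_merge_blocks // (big_block hh').
  apply: eq_bigl => i; rewrite (ltn_block hh') andbT.
  by have [->|_] := eqVneq (blk i) j; rewrite ?ji ?andbF.
move=> i /andP[]; rewrite (ltn_block hh') => + /negbTE bi; rewrite bi /= => /andP[/eqP ii i0i].
by apply: x0; rewrite // mem_block // ii.
Qed.

(** If the block of i0 is the last one, then the degree above i0 is 0, which is the
    source of the second condition. *)
Lemma blowup_norm_comparison (w : blowup_cochain R h') (i0 : 'I_n.+1) (z : \bar int) :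
    ((blk i0 < m)%N -> (blowup_norm (m - blk i0) w <= z)%E) ->
    ((blk i0 : nat) = m -> (0 <= z)%E) ->
  (blowup_norm (n - i0) (blowup_comparison h w) <= z)%E.
Proof.
move=> zlt zeq; apply/blowup_norm_le => a.
rewrite -extend_val -twist_rescaled (rescaled_comparison hh') ?(valP a) //.
case: ifP => ma; last by rewrite mulr0 eqxx.
set x := val a => nz; have hx : is_blowup_face h x := valP a.
have wm : extend w (merge_blocks x) != 0.
  by apply: contraNneq nz => w0; rewrite /rescaled w0 !mulr0.
have hm := merge_blocks_face hh' hx ma.
have in0 : (i0 <= n)%N by rewrite -ltnS ltn_ord.
have bm : (blk i0 <= m)%N by rewrite -ltnS ltn_ord.
rewrite /face_norm subKn // inord_val.
case: ifP => [_|/negbT xi0]; first exact: leNye.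
have [mi0 ->] := merge_blocks_above hx ma xi0.
have [lt|ge] := ltnP (blk i0) m; last first.
  have E : (blk i0 : nat) = m by apply/anti_leq; rewrite ge bm.
  rewrite big1 ?zeq // => j; rewrite E ltnNge -ltnS ltn_ord //.
have /blowup_norm_le/(_ (Sub (merge_blocks x) hm : blowup_face h')) := zlt lt.
rewrite -extend_val => /(_ wm).
by rewrite /face_norm subKn // inord_val (negbTE mi0).
Qed.

End Norm.

(** * The comparison and faces of the simplex *)

Section Restriction.
Variables (R : comPzRingType) (N n m : nat) (F : {set 'I_N}).
Variables (h : {ffun 'I_N -> 'I_n.+1}) (h' : {ffun 'I_N -> 'I_m.+1}).
Variables (hF : {ffun 'I_#|F| -> 'I_n.+1}) (hF' : {ffun 'I_#|F| -> 'I_m.+1}).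
Hypotheses (hh' : coarser h h') (hhF' : coarser hF hF').
Hypothesis hFE : forall u, hF u = h (enum_val u).
Hypothesis hF'E : forall u, hF' u = h' (enum_val u).

Definition cface_image (a : cface #|F|) : cface N := ([set enum_val u | u in a.1], a.2).

Lemma nverts_image a : nverts (cface_image a) = nverts a.
Proof. by rewrite /nverts /= card_imset //; exact: enum_val_inj. Qed.

Lemma no_face_image a : (cface_image a == no_face) = (a == no_face).
Proof. by apply/negb_inj; rewrite !face_nonempty nverts_image. Qed.

Lemma merge_image x a : cone_merge (cface_image x) (cface_image a) = omap cface_image (cone_merge x a).
Proof.
rewrite /cone_merge /is_point nverts_image /=; case: ifP => _; last by case: ifP.
by rewrite /cface_image /= imsetU.
Qed.

Lemma merge_along_image (c : 'I_n.+1 -> cface #|F|) l :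
  merge_along (fun i => cface_image (c i)) l = omap cface_image (merge_along c l).
Proof.
elim/last_ind: l => [|l i IH]; first by rewrite /= /cface_image /= imset0.
rewrite !merge_along_rcons IH; case: merge_along => [x|] //=; exact: merge_image.
Qed.

Lemma face_imageE n' (x : {ffun 'I_n'.+1 -> cface #|F|}) i :
  face_image x i = cface_image (x i).
Proof. by rewrite ffunE. Qed.

Lemma face_image_face n' (k : {ffun 'I_N -> 'I_n'.+1}) (kF : {ffun 'I_#|F| -> 'I_n'.+1})
    (x : {ffun 'I_n'.+1 -> cface #|F|}) : (forall u, kF u = k (enum_val u)) ->
  is_blowup_face kF x -> is_blowup_face k (face_image x).
Proof.
move=> kFE /blowup_faceP[xE x0 xn]; apply/blowup_faceP; split=> [i|i|].
- rewrite face_imageE; apply/fintype.subsetP => _ /imsetP[u /(fintype.subsetP (xE i)) + ->].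
  by rewrite !inE kFE.
- by rewrite face_imageE no_face_image.
- by rewrite face_imageE.
Qed.

Lemma rescaled_restriction n' (k : {ffun 'I_N -> 'I_n'.+1}) (kF : {ffun 'I_#|F| -> 'I_n'.+1})
    (w : blowup_cochain R k) (x : {ffun 'I_n'.+1 -> cface #|F|}) :
  is_blowup_face kF x -> rescaled (restriction kF w) x = rescaled w (face_image x).
Proof.
move=> hx; have -> : rescaled (restriction kF w) x = twist R x * extend w (face_image x).
  by rewrite /rescaled (_ : x = val (Sub x hx : blowup_face kF)) // extend_val ffunE.
congr (sgn R _ * _); apply: eq_total_pair => i; by rewrite face_imageE !cdimE nverts_image.
Qed.

Lemma merge_along_filter N' (c : 'I_n.+1 -> cface N') l :
  merge_along c l = merge_along c [seq i <- l | c i != apex].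
Proof.
elim/last_ind: l => [//|l i IH]; rewrite filter_rcons merge_along_rcons IH.
case: eqP => [->|_] /=; last by rewrite merge_along_rcons.
by case: merge_along => //= x; exact: merge_apexr.
Qed.

(** In a face of the simplex, the factor i may become empty and move to another
    block; but then x i is an apex, which merging ignores. *)
Lemma merge_along_restriction (x : {ffun 'I_n.+1 -> cface #|F|}) j : is_blowup_face hF x ->
  merge_along x (block h h' j) = merge_along x (block hF hF' j).
Proof.
move=> /blowup_faceP[xE x0 _]; rewrite merge_along_filter [RHS]merge_along_filter.
congr merge_along; rewrite /block -!filter_predI; apply: eq_filter => i /=.
have [//|xi] := eqVneq (x i) apex.
have := mem_block hh' i j; rewrite mem_filter mem_enum andbT => ->.
have := mem_block hhF' i j; rewrite mem_filter mem_enum andbT => ->.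
have [u ui] : exists u, u \in (x i).1.
  apply/set0Pn; move: (x0 i) xi; case: (x i) => A e /=; rewrite !xpair_eqE.
  by case: eqP => // _; case: e.
have hu : hF u = i by have := fintype.subsetP (xE i) u ui; rewrite inE => /eqP.
by rewrite -{2}hu (block_index_level hhF') hF'E -(block_index_level hh') -hFE hu.
Qed.

(** Merging commutes with the inclusion of the vertices of F, and the comparisons
    for F and for the whole simplex use the same factors up to apexes. *)
Lemma restriction_comparison (w : blowup_cochain R h') :
  restriction hF (blowup_comparison h w) = blowup_comparison hF (restriction hF' w).
Proof.
apply: rescaled_inj => x hx; rewrite rescaled_restriction // (rescaled_comparison hhF') //.
have hi := face_image_face hFE hx; rewrite (rescaled_comparison hh') //.
have E j : merge_along (face_image x) (block h h' j) =
    omap cface_image (merge_along x (block hF hF' j)).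
  rewrite -merge_along_restriction // -merge_along_image.
  by apply: eq_in_merge_along => i _; rewrite face_imageE.
have -> : mergeable h h' (face_image x) = mergeable hF hF' x.
  by apply: eq_forallb => j; rewrite E; case: merge_along.
case: ifP => // mx; rewrite rescaled_restriction; last exact: merge_blocks_face.
congr rescaled; apply/ffunP => j; rewrite face_imageE !ffunE E.
by have := merge_blocksP j mx; case: merge_along.
Qed.

End Restriction.

(** * Chain maps in cohomology and linear extensions *)

Section InducedInCohomology.

Lemma class_ofZ (R : pzRingType) (V : lmodType R) (B : submodule V) (a : R) (u : V) :
  class_of B (a *: u) = a *: class_of B u.
Proof.
apply/class_ofP; rewrite -scalerBr -[_ *: _]addr0.
apply: submodule_linear; last exact: submodule_0.
by apply/class_ofP; rewrite class_of_repr.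
Qed.

Variables (R : pzRingType) (V W : lmodType R).
Variables (dV : {linear V -> V}) (C : nat -> submodule V).
Variables (dW : {linear W -> W}) (D : nat -> submodule W).
Variable g : V -> W.
Hypothesis cg : chain_map dV C dW D g.

(** The induced map is defined on representatives; a coboundary is mapped to a
    coboundary, so the choice does not matter. *)
Lemma chain_map_induced k :
  exists phi : {linear cohomology dV C k -> cohomology dW D k},
    induced_in_cohomology g phi.
Proof.
have [lg gC gd] := cg.
have g0 : g 0 = 0.
  have := lg (- 1) 0 0; rewrite scaler0 addr0 => ->; by rewrite scaleN1r addNr.
have gB u v : g (u - v) = g u - g v.
  by rewrite addrC -scaleN1r lg scaleN1r addrC.
have gz (z : elements (cocycles dV C k)) : submodule_pred (cocycles dW D k) (g (val z)).
  have /asboolP[Cz dz] := valP z; apply/asboolP; split; first exact: gC.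
  by rewrite -(gd _ _ Cz) dz g0.
pose G (z : elements (cocycles dV C k)) : elements (cocycles dW D k) := Sub (g (val z)) (gz z).
have GE z : val (G z) = g (val z) by rewrite SubK.
have G_coboundary z : coboundaries dV C k z -> coboundaries dW D k (G z).
  rewrite /= /coboundary_set; case: (k) z G GE => [|k'] z G GE /=.
    by move=> z0; rewrite [sval (G z)]GE (z0 : \val z = 0).
  move=> [y Cy dy]; exists (g y); first exact: gC.
  by rewrite [sval (G z)]GE -[\val z]dy -(gd _ _ Cy).
pose phi0 (x : cohomology dV C k) : cohomology dW D k :=
  cohomology_class (G (repr (x : {ideal_quot submodule_pred (coboundaries dV C k)}))).
have phi0E z : phi0 (cohomology_class z) = cohomology_class (G z).
  apply/class_ofP; have /class_ofP := class_of_repr (cohomology_class z).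
  set r := repr _ => /G_coboundary.
  suff -> : G (r - z) = G r - G z by [].
  by apply: val_inj; rewrite GE raddfB /= gB.
have lphi : linear phi0.
  move=> a x y; rewrite -(class_of_repr x) -(class_of_repr y).
  rewrite -class_ofZ -class_ofD !phi0E -class_ofZ -class_ofD; congr class_of.
  by apply: val_inj; rewrite GE; exact: lg.
pose phi : {linear cohomology dV C k -> cohomology dW D k} :=
  HB.pack phi0 (GRing.isLinear.Build R _ _ *:%R phi0 lphi).
exists phi => z.
by exists (G z).
Qed.

End InducedInCohomology.

Section LinearExtension.
Variables (rr : realType) (R : comPzRingType) (X : filteredSpace) (V : lmodType R).
Implicit Types (c d : chain rr R X) (g : regularSimplex rr X -> V).

Lemma linear_extensionE g c (r : seq (regularSimplex rr X)) :
    uniq r -> (forall s, s \notin r -> val c s = 0) ->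
  linear_extension g c = \sum_(s <- r) (val c s : R) *: g s.
Proof.
move=> ur cr; rewrite /linear_extension (fsbigE r) //.
  by apply: eq_bigl => s; apply/mem_set.
by move=> s _ /cr ->; rewrite scale0r.
Qed.

Lemma chain_support c : exists r : seq (regularSimplex rr X),
  forall s, s \notin r -> val c s = 0.
Proof.
have /asboolP/finite_seqP[r /seteqP[cr _]] := valP c.
by exists r => s; apply: contraNeq => /cr.
Qed.

Lemma linear_extension_linear g : linear (linear_extension g).
Proof.
move=> a c d; have [r cr] := chain_support c; have [r' dr'] := chain_support d.
pose t := undup (r ++ r'); have ut : uniq t := undup_uniq _.
have ct s : s \notin t -> val c s = 0.
  by rewrite mem_undup mem_cat negb_or => /andP[/cr].
have dt s : s \notin t -> val d s = 0.
  by rewrite mem_undup mem_cat negb_or => /andP[_ /dr'].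
rewrite (linear_extensionE _ ut ct) (linear_extensionE _ ut dt) (linear_extensionE _ ut).
  rewrite scaler_sumr -big_split; apply: eq_bigr => s _ /=.
  by rewrite scalerDl scalerA.
by move=> s st; rewrite /= dprodE ct // dt // scaler0 addr0.
Qed.

Lemma linear_extension_sum (I : Type) (r : seq I) (a : I -> R) (x : I -> chain rr R X) g :
  linear_extension g (\sum_(i <- r) a i *: x i) = \sum_(i <- r) a i *: linear_extension g (x i).
Proof.
elim: r => [|i r IH]; last by rewrite !big_cons linear_extension_linear IH.
by rewrite !big_nil; apply: fsbig1 => s _; rewrite scale0r.
Qed.

Lemma linear_extension_generator g s : linear_extension g (generator R s) = g s.
Proof.
rewrite (@linear_extensionE _ _ [:: s]) // => [|t]; last first.
  by rewrite inE /= /generator_fun => /negbTE ->.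
by rewrite big_seq1 /= /generator_fun eqxx scale1r.
Qed.

End LinearExtension.

(** * The pull-back along a stratified map *)

Section Pullback.
Variables (rr : realType) (R : comPzRingType) (X Y : filteredSpace).
Variable f : stratifiedMap X Y.
Implicit Types (s : regularSimplex rr X) (w e : cochain rr R Y).

(** Regular strata are mapped into regular strata, by the condition on
    codimensions. *)
Lemma comp_level_coarser s : coarser (level s) (level (comp_simplex f s)).
Proof.
split.
- exact: level_mono.
- exact: comp_level_le.
- by have /existsP[v /eqP] := regular_level s; exists v.
move=> v lv; rewrite /= ffunE; set S := point_stratum _.
have := smap_codim f S; rewrite /codim.
have -> : stratum_index S = ord_max.
  by apply/val_inj; rewrite -lv; exact: slice_inj (slice_point_index _) (vertex_slice v).
rewrite subnn leqn0 subn_eq0 => le; apply/val_inj/anti_leq.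
by rewrite le -ltnS ltn_ord.
Qed.

Lemma cochain_pullback_linear : linear (@cochain_pullback rr R X Y f).
Proof.
move=> a u v; apply: functional_extensionality_dep => s.
apply/ffunP => b; rewrite dprodE blowup_cochainP !ffunE mulr_sumr -big_split.
by apply: eq_bigr => c _ /=; rewrite dprodE blowup_cochainP mulrDl mulrA.
Qed.

Section Face.
Variables (s : regularSimplex rr X) (F : regular_face s).

Fact comp_face_regular : @is_regular_face rr Y (comp_simplex f s) (val F).
Proof.
have /existsP[v /andP[vF /eqP lv]] := valP F.
apply/existsP; exists v; rewrite vF /=.
by apply/eqP; exact: (coarser_regular (comp_level_coarser s)).
Qed.

Definition comp_face : regular_face (comp_simplex f s) :=
  exist _ (val F) comp_face_regular.

Lemma face_incl_vertex (i : 'I_#|val F|) :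
  face_incl (vertex rr i) = vertex rr (enum_val i).
Proof.
apply: simplex_eq => v; rewrite weight_point weight_vertex /face_weight.
under eq_bigr => j _ do rewrite weight_vertex.
rewrite big_mkcond (bigD1 i) //= eqxx big1 ?addr0 => [|j /negbTE ->]; last by rewrite if_same.
by rewrite eq_sym; case: eqP.
Qed.

Lemma comp_level_face (i : 'I_#|val F|) :
  level (comp_simplex f (face F)) i = level (comp_simplex f s) (enum_val i).
Proof. by rewrite /= !ffunE /= /face_map face_incl_vertex. Qed.

End Face.

Section SimplexEquality.
Variables (Z : filteredSpace) (M : nat).
Variables (M1 M2 : (0 < M)%N) (g1 g2 : std_simplex rr M -> Z).
Variables (l1 l2 : {ffun 'I_M -> 'I_(fspace_dim Z).+1}).
Variables (c1 : continuous g1) (c2 : continuous g2).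
Variables (h1 : {homo l1 : u v / (u <= v)%N}) (h2 : {homo l2 : u v / (u <= v)%N}).
Variables (f1 : forall i t, @filtration Z i (g1 t) <->
    (forall v, weight t v != 0 -> (l1 v <= i)%N)).
Variables (f2 : forall i t, @filtration Z i (g2 t) <->
    (forall v, weight t v != 0 -> (l2 v <= i)%N)).
Variables (r1 : [exists v, l1 v == ord_max]) (r2 : [exists v, l2 v == ord_max]).

Let s1 : regularSimplex rr Z :=
  @RegularSimplex rr Z (@FilteredSimplex rr Z M M1 g1 l1 c1 h1 f1) r1.
Let s2 : regularSimplex rr Z :=
  @RegularSimplex rr Z (@FilteredSimplex rr Z M M2 g2 l2 c2 h2 f2) r2.

Lemma regularSimplex_eq : g1 =1 g2 -> l1 = l2 -> s1 = s2.
Proof.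
move=> /funext eg el; subst g2 l2; rewrite /s1 /s2.
by rewrite (Prop_irrelevance c1 c2) (Prop_irrelevance h1 h2) (Prop_irrelevance f1 f2)
  (bool_irrelevance M1 M2) (bool_irrelevance r1 r2).
Qed.

(** Two regular simplices with the same vertices, maps and levels are equal, but
    the type of w at a simplex mentions its levels; this form of the equality
    avoids a cast. *)
Lemma regularSimplex_transport (P : forall l : {ffun 'I_M -> 'I_(fspace_dim Z).+1},
    blowup_cochain R l -> Prop) (w : cochain rr R Z) :
  g1 =1 g2 -> l1 = l2 -> P l2 (w s2) -> P l1 (w s1).
Proof.
move=> /funext eg el; subst g2 l2; rewrite /s1 /s2.
by rewrite (Prop_irrelevance c1 c2) (Prop_irrelevance h1 h2) (Prop_irrelevance f1 f2)
  (bool_irrelevance M1 M2) (bool_irrelevance r1 r2).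
Qed.

End SimplexEquality.

Lemma comp_simplex_face_map s (F : regular_face s) :
  @comp_map rr X Y f (face F) =1 @face_map rr Y (comp_simplex f s) (comp_face F).
Proof.
move=> t; rewrite /comp_map /face_map /= /comp_map; congr (f (s _)).
by apply: simplex_eq => v; rewrite !weight_point.
Qed.

Lemma comp_simplex_face_level s (F : regular_face s) :
  @comp_level rr X Y f (face F) = @face_level rr Y (comp_simplex f s) (comp_face F).
Proof.
apply/ffunP => i; rewrite [RHS]ffunE; exact: comp_level_face.
Qed.

(** Taking a face and composing with f commute. *)
Lemma comp_simplex_face s (F : regular_face s) :
  comp_simplex f (face F) = @face rr Y (comp_simplex f s) (comp_face F).
Proof.
apply: regularSimplex_eq; [exact: comp_simplex_face_map | exact: comp_simplex_face_level].
Qed.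

Lemma restriction_comp_simplex w s (F : regular_face s) : face_compatible w ->
    #|~: val F| = 1%N ->
  restriction (level (comp_simplex f (face F))) (w (comp_simplex f s))
  = w (comp_simplex f (face F)).
Proof.
move=> cw F1.
have := @regularSimplex_transport Y _ (nvert_gt0 (face F)) (face_gt0 (comp_face F)) _ _ _ _
  (@comp_continuous rr X Y f (face F)) (@face_continuous rr Y _ (comp_face F))
  (@comp_mono rr X Y f (face F)) (@face_mono rr Y _ (comp_face F))
  (@comp_filtered rr X Y f (face F)) (@face_filtered rr Y _ (comp_face F))
  (@comp_regular rr X Y f (face F)) (@face_regular rr Y _ (comp_face F))
  (fun l u => restriction l (w (comp_simplex f s)) = u) w
  (@comp_simplex_face_map s F) (@comp_simplex_face_level s F).
by apply; exact: cw (comp_face F) F1.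
Qed.

Lemma pullback_face_compatible w : face_compatible w ->
  face_compatible (cochain_pullback f w).
Proof.
move=> cw s F F1; rewrite /cochain_pullback -(restriction_comp_simplex cw F1).
apply: restriction_comparison.
- exact: comp_level_coarser s.
- exact: comp_level_coarser (face F).
- by move=> u; rewrite ffunE.
- exact: comp_level_face.
Qed.

Lemma pullback_homogeneous k w : homogeneous k w -> homogeneous k (cochain_pullback f w).
Proof.
move=> hw s a; rewrite -extend_val -twist_rescaled /cochain_pullback.
rewrite (rescaled_comparison (comp_level_coarser s)) ?(valP a) //.
case: ifP => [ma nz|_]; last by rewrite mulr0 eqxx.
rewrite -(total_degree_merge_blocks (comp_level_coarser s) (valP a) ma).
have hm := merge_blocks_face (comp_level_coarser s) (valP a) ma.
pose b : blowup_face (level (comp_simplex f s)) := Sub _ hm.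
apply: (hw _ b); rewrite -extend_val.
by apply: contraNneq nz => w0; rewrite /rescaled [extend _ _]w0 !mulr0.
Qed.

Lemma pullback_blowup k w : blowup rr R Y k w -> blowup rr R X k (cochain_pullback f w).
Proof.
by move=> [cw hw]; split; [exact: pullback_face_compatible | exact: pullback_homogeneous].
Qed.

Lemma pullback_diff w :
  cochain_pullback f (cochain_diff w) = cochain_diff (cochain_pullback f w).
Proof.
apply: functional_extensionality_dep => s.
exact: comparison_diff (comp_level_coarser s) _.
Qed.

Lemma pullback_cup w e :
  cochain_pullback f (cup_product w e) =
  cup_product (cochain_pullback f w) (cochain_pullback f e).
Proof.
apply: functional_extensionality_dep => s.
exact: comparison_cup (comp_level_coarser s) _ _.
Qed.

(** The regular faces of the image simplex which are not regular faces of s do not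
    occur in the cap product, by [cap_simplex_regular]. *)
Lemma pullback_cap_simplex w s :
  chain_pushforward f (cap_on_simplex (cochain_pullback f w) s) =
  cap_on_simplex w (comp_simplex f s).
Proof.
rewrite /chain_pushforward /cap_on_simplex linear_extension_sum.
under eq_bigr => F _ do rewrite linear_extension_generator comp_simplex_face
  (comparison_cap_simplex (comp_level_coarser s)).
rewrite [RHS](bigID (fun F : regular_face (comp_simplex f s) =>
  @is_regular_face rr X s (val F))) /=.
rewrite [X in _ = _ + X]big1 ?addr0 => [|F nF]; last first.
  rewrite -(comparison_cap_simplex (comp_level_coarser s)).
  have [->|] := eqVneq (cap_simplex (blowup_comparison (level s) (w (comp_simplex f s))) (val F)) 0.
    by rewrite scale0r.
  move=> /(cap_simplex_regular (coarser_refl (comp_level_coarser s)))[v vF lv].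
  case/negP: nF; apply/existsP; exists v; by rewrite vF lv eqxx.
rewrite (reindex_omap (@comp_face s)
  (fun F : regular_face (comp_simplex f s) => insub (val F) : option (regular_face s))) /=;
  last first.
  by move=> F sF; rewrite insubT /=; congr Some; exact: val_inj.
by apply: eq_bigl => F; rewrite (valP F) valK eqxx.
Qed.

Lemma pullback_cap w (xi : chain rr R X) :
  chain_pushforward f (cap_product (cochain_pullback f w) xi) =
  cap_product w (chain_pushforward f xi).
Proof.
have [r rxi] := chain_support xi.
have uxi s : s \notin undup r -> val xi s = 0 by rewrite mem_undup; exact: rxi.
rewrite /cap_product /chain_pushforward !(linear_extensionE _ (undup_uniq r) uxi).
rewrite !linear_extension_sum; apply: eq_bigr => s _.
by rewrite linear_extension_generator -/(chain_pushforward f _) pullback_cap_simplex.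
Qed.

(** If the image of s meets S at the point t, the highest level of a vertex
    carrying t is the index of S, and its level in the image simplex is the index
    of the stratum containing f (S). *)
Lemma pullback_allowable (p : perversity X) (q : perversity Y) w :
    (forall S : stratum X, (perversity_pullback f q S <= p S)%E) ->
  allowable q w -> allowable p (cochain_pullback f w).
Proof.
move=> qp qw S S0; apply/stratum_norm_le => s [_ [[t _ <-]] St].
have [v1 wv1] : exists v, weight t v != 0.
  apply: contrapT => no; have := weight_sum t; rewrite big1 => [/eqP|v _].
    by rewrite eq_sym oner_eq0.
  by apply: contrapT => /eqP wv; apply: no; exists v.
case: (@arg_maxnP _ v1 (fun v => weight t v != 0) (fun v => level s v) wv1) => v0 w0 wm.
have lv0 : level s v0 = stratum_index S.
  by apply/val_inj; exact: slice_inj (simplex_slice w0 wm) (stratum_sub St).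
have Sf : stratum_set (smap_stratum f S) (comp_map f t).
  by apply: smap_image; exists (s t).
have lfv0 : level (comp_simplex f s) v0 = stratum_index (smap_stratum f S).
  by apply/val_inj; exact: slice_inj (comp_slice f w0 wm) (stratum_sub Sf).
have blkE : block_index (level s) (level (comp_simplex f s)) (stratum_index S)
    = stratum_index (smap_stratum f S).
  by rewrite -lv0 (block_index_level (comp_level_coarser s)).
apply: (blowup_norm_comparison (comp_level_coarser s)); rewrite blkE.
- move=> lt; apply: le_trans (qp S).
  have Sf0 : (0 < codim (smap_stratum f S))%N by rewrite subn_gt0.
  have := (stratum_norm_le _ w _).1 (qw _ Sf0) (comp_simplex f s); apply.
  by exists (comp_map f t); split => //; exists t.
- move=> eq; apply: le_trans (qp S); rewrite /perversity_pullback perv_regular //.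
  by rewrite /codim eq subnn.
Qed.

End Pullback.

Theorem theorem1 (rr : realType) (R : comPzRingType) (X Y : stratifiedSpace)
    (f : stratifiedMap X Y) :
  [/\ chain_map (@cochain_diff rr R Y) (@blowup rr R Y)
                (@cochain_diff rr R X) (@blowup rr R X) (cochain_pullback f),
      forall w e : cochain rr R Y, face_compatible w -> face_compatible e ->
        cochain_pullback f (cup_product w e) =
        cup_product (cochain_pullback f w) (cochain_pullback f e),
      forall (w : cochain rr R Y) (xi : chain rr R X), face_compatible w ->
        chain_pushforward f (cap_product (cochain_pullback f w) xi) =
        cap_product w (chain_pushforward f xi)
    & forall (p : perversity X) (q : perversity Y),
        (forall S : stratum X, (perversity_pullback f q S <= p S)%E) ->
        chain_map (@cochain_diff rr R Y) (@perverse_blowup rr R Y q)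
                  (@cochain_diff rr R X) (@perverse_blowup rr R X p)
                  (cochain_pullback f)
        /\ forall k : nat,
             exists phi : {linear blownup_cohomology rr R q k ->
                                  blownup_cohomology rr R p k},
               induced_in_cohomology (cochain_pullback f) phi].
Proof.
split.
- split; first exact: cochain_pullback_linear.
    exact: pullback_blowup.
  by move=> k w _; exact: pullback_diff.
- by move=> w e _ _; exact: pullback_cup.
- by move=> w xi _; exact: pullback_cap.
move=> p q pq.
have cm : chain_map (@cochain_diff rr R Y) (@perverse_blowup rr R Y q)
    (@cochain_diff rr R X) (@perverse_blowup rr R X p) (cochain_pullback f).
  split; first exact: cochain_pullback_linear.
    move=> k w [bw aw dw]; split; first exact: pullback_blowup.
      exact: pullback_allowable pq aw.
    by rewrite -pullback_diff; exact: pullback_allowable pq dw.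
  by move=> k w _; exact: pullback_diff.
by split=> // k; exact: chain_map_induced cm k.
Qed.
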